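(* Let $M,N,p\ge1$ be integers. Any finite-dimensional irreducible representation of the superalgebra $\mathcal W_p(M|N)$ is isomorphic to an evaluation representation or to a subquotient of a tensor product of at most $p$ evaluation representations.
   Context: Grading: $[a]=0$ for $1\le a\le M$, $[a]=1$ for $M<a\le M+N$. The super-Yangian $Y(M|N)=Y(gl(M|N))$ is the associative unital $\mathbb Z_2$-graded algebra over $\mathbb C$ generated by $T^{ab}_{(n)}$, $1\le a,b\le M+N$, $n\ge1$, of parity $[a]+[b]$ (with $T^{ab}_{(0)}=\delta^{ab}$), with relations ($[\cdot,\cdot\}$ the graded commutator) $$[T^{ab}_{(m)},T^{cd}_{(n)}\}=\delta^{cb}T^{ad}_{(m+n-1)}-(-1)^{([a]+[b])([c]+[d])}\delta^{ad}T^{cb}_{(m+n-1)}+(-1)^{[c]([a]+[b])+[a][b]}\sum_{r=1}^{\min(m,n)-1}\big(T^{cb}_{(r)}T^{ad}_{(m+n-1-r)}-T^{cb}_{(m+n-1-r)}T^{ad}_{(r)}\big).$$ The truncated super-Yangian $Y_p(M|N)$ is the quotient of $Y(M|N)$ by the ideal generated by all $T^{ab}_{(n)}$ with $n>p$. For representation theory, $\mathcal W_p(M|N)=\mathcal W(gl(Mp|Np),(M+N)gl(p))$ means the (quantum) superalgebra $Y_p(M|N)$, with generators $W^{ab}_{r-1}\leftrightarrow T^{ab}_{(r)}$, $1\le r\le p$. Let $\mathcal E^{ab}$ be the standard generators of $gl(M|N)$: $[\mathcal E^{ab},\mathcal E^{cd}\}=\delta^{cb}\mathcal E^{ad}-(-1)^{([a]+[b])([c]+[d])}\delta^{ad}\mathcal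 E^{cb}$. For a highest weight irreducible representation $\pi$ of $gl(M|N)$, the evaluation representation $ev_\pi$ is given by $ev_\pi(T^{ab}_{(1)})=\pi(\mathcal E^{ab})$ and $ev_\pi(T^{ab}_{(r)})=0$ for $r>1$. The tensor product of evaluation representations $ev_{\pi_1},\dots,ev_{\pi_s}$ is given (with the $\mathbb Z_2$-graded tensor product) by $$ev_{\vec\pi}(T^{ab}_{(r)})=\sum_{r_1+\dots+r_s=r}\ \sum_{i_1,\dots,i_{s-1}=1}^{M+N}ev_{\pi_1}(T^{ai_1}_{(r_1)})\otimes ev_{\pi_2}(T^{i_1i_2}_{(r_2)})\otimes\cdots\otimes ev_{\pi_s}(T^{i_{s-1}b}_{(r_s)}).$$ It vanishes on $T^{ab}_{(r)}$ for $r>s$. Evaluation representations and their tensor products for $\mathcal W_p(M|N)$ are these, under $T^{ab}_{(r)}\leftrightarrow W^{ab}_{r-1}$.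
   Formalization: In the tensor product formula each T^{ab}_(r) with r ≥ 1 is replaced, on both sides, by (-1)^{[a]}T^{ab}_(r), because the displayed formula violates the defining relations when M,N ≥ 1 and s ≥ 2. *)

(* Defs.v *)
From HB Require Import structures.
From mathcomp Require Import all_boot all_order all_algebra.
From mathcomp Require Import zify reals complex.

Set Implicit Arguments.
Unset Strict Implicit.
Unset Printing Implicit Defensive.

Import GRing.Theory.
Local Open Scope ring_scope.

(* [hpart e] is the projection onto the homogeneous component of parity [e]
   ([false] = even, [true] = odd).  The carrier may be infinite-dimensional. *)
Record superspace (K : fieldType) := Superspace {
  carrier :> lmodType K;
  hpart : bool -> {linear carrier -> carrier};
  hpart_comp : forall d e v,
    hpart d (hpart e v) = if d == e then hpart e v else 0;
  hpart_sum : forall v, hpart false v + hpart true v = v }.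

Definition homogeneous (K : fieldType) (V : superspace K) (e : bool) (v : V) :
  Prop := hpart V e v = v.

Definition has_parity (K : fieldType) (V : superspace K) (e : bool)
    (f : V -> V) : Prop :=
  forall d v, homogeneous d v -> homogeneous (d (+) e) (f v).

(* the graded commutator [f, g} of operators f, g of parities d, e *)
Definition supercomm (K : fieldType) (V : superspace K) (d e : bool)
    (f g : V -> V) (v : V) : V :=
  f (g v) - (-1) ^+ (d && e) *: g (f v).

Definition finite_dimensional (K : fieldType) (V : lmodType K) : Prop :=
  exists n (f : {linear V -> 'rV[K]_n}), bijective f.

(* The notions below are shared by gl(M|N) and by the Yangian: [A] is the
   family of operators by which the generators act on V. *)
Definition invariant_subspace (K : fieldType) (V : superspace K) (I : Type)
    (A : I -> V -> V) (S : V -> Prop) : Prop :=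
  [/\ S 0,
      forall c u v, S u -> S v -> S (c *: u + v),
      forall e v, S v -> S (hpart V e v)
    & forall i v, S v -> S (A i v)].

Definition irreducible (K : fieldType) (V : superspace K) (I : Type)
    (A : I -> V -> V) : Prop :=
  (exists v : V, v <> 0) /\
  forall S, invariant_subspace A S ->
    (forall v, S v -> v = 0) \/ (forall v, S v).

Definition intertwiner (K : fieldType) (V W : superspace K) (I : Type)
    (A : I -> V -> V) (B : I -> W -> W) (f : {linear V -> W}) : Prop :=
  (forall e v, f (hpart V e v) = hpart W e (f v)) /\
  (forall i v, f (A i v) = B i (f v)).

(* Indices start at 0 here, so 0 <= a < M is even and M <= a < M + N is odd. *)
Definition par (M N : nat) (a : 'I_(M + N)) : bool := (M <= a)%N.

Record gl_rep (K : fieldType) (M N : nat) := GlRep {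
  gl_space :> superspace K;
  gl_E : 'I_(M + N) -> 'I_(M + N) -> {linear gl_space -> gl_space};
  gl_E_parity : forall a b, has_parity (par a (+) par b) (gl_E a b);
  gl_E_rel : forall a b c d v,
    supercomm (par a (+) par b) (par c (+) par d) (gl_E a b) (gl_E c d) v
    = (c == b)%:R *: gl_E a d v
      - (-1) ^+ ((par a (+) par b) && (par c (+) par d))
          *: ((a == d)%:R *: gl_E c b v) }.

Definition gl_op (K : fieldType) (M N : nat) (pi : gl_rep K M N)
    (x : 'I_(M + N) * 'I_(M + N)) : pi -> pi := gl_E pi x.1 x.2.

Definition highest_weight (K : fieldType) (M N : nat) (pi : gl_rep K M N) :
    Prop :=
  exists (v : pi) (e : bool) (lambda : 'I_(M + N) -> K),
    [/\ v <> 0,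
        homogeneous e v,
        forall a b : 'I_(M + N), (a < b)%N -> gl_E pi a b v = 0,
        forall a, gl_E pi a a v = lambda a *: v
      & forall S, invariant_subspace (@gl_op _ _ _ pi) S -> S v ->
          forall u, S u].

(* A representation of Y(M|N) is given by the images of its generators,
   subject to the defining relations. *)
Record yangian_rep (K : fieldType) (M N : nat) := YangianRep {
  Y_space :> superspace K;
  Y_T : nat -> 'I_(M + N) -> 'I_(M + N) -> {linear Y_space -> Y_space};
  Y_T0 : forall a b v, Y_T 0 a b v = (a == b)%:R *: v;
  Y_T_parity : forall n a b, (0 < n)%N ->
    has_parity (par a (+) par b) (Y_T n a b);
  Y_T_rel : forall m n a b c d v, (0 < m)%N -> (0 < n)%N ->
    supercomm (par a (+) par b) (par c (+) par d) (Y_T m a b) (Y_T n c d) v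
    = (c == b)%:R *: Y_T (m + n - 1) a d v
      - (-1) ^+ ((par a (+) par b) && (par c (+) par d))
          *: ((a == d)%:R *: Y_T (m + n - 1) c b v)
      + (-1) ^+ ((par c && (par a (+) par b)) (+) (par a && par b))
          *: \sum_(1 <= r < minn m n)
               (Y_T r c b (Y_T (m + n - 1 - r) a d v)
                - Y_T (m + n - 1 - r) c b (Y_T r a d v)) }.

(* Representations of W_p(M|N) = Y_p(M|N), the quotient of Y(M|N) by the ideal
   generated by the T^{ab}_(n) with n > p; W^{ab}_{r-1} acts as T^{ab}_(r). *)
Record W_rep (K : fieldType) (M N p : nat) := WRep {
  W_Y :> yangian_rep K M N;
  W_trunc : forall n a b v, (p < n)%N -> Y_T W_Y n a b v = 0 }.

Definition Y_op (K : fieldType) (M N : nat) (V : yangian_rep K M N)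
    (x : nat * ('I_(M + N) * 'I_(M + N))) : V -> V :=
  Y_T V x.1 x.2.1 x.2.2.

Definition isomorphic (K : fieldType) (M N p : nat) (V W : W_rep K M N p) :
    Prop :=
  exists f : {linear V -> W},
    intertwiner (@Y_op _ _ _ V) (@Y_op _ _ _ W) f /\ bijective f.

(* V is isomorphic to a subquotient of W, i.e. to a quotient of a
   subrepresentation of W: U embeds into W and surjects onto V. *)
Definition isomorphic_to_subquotient (K : fieldType) (M N p : nat)
    (V W : W_rep K M N p) : Prop :=
  exists (U : W_rep K M N p) (j : {linear U -> W}) (q : {linear U -> V}),
    [/\ intertwiner (@Y_op _ _ _ U) (@Y_op _ _ _ W) j, injective j,
        intertwiner (@Y_op _ _ _ U) (@Y_op _ _ _ V) q
      & forall v : V, exists u : U, q u = v].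

Section Evaluation.

Context (K : fieldType) (M N : nat) (pi : gl_rep K M N).

Definition ev_T (n : nat) (a b : 'I_(M + N)) : {linear pi -> pi} :=
  match n with
  | 0 => *:%R (a == b)%:R
  | 1 => gl_E pi a b
  | _ => \0
  end.

Lemma ev_T_ge2 n a b v : (1 < n)%N -> ev_T n a b v = 0.
Proof. by case: n => [|[|n]]. Qed.

Lemma ev_T_parity n a b : (0 < n)%N -> has_parity (par a (+) par b) (ev_T n a b).
Proof.
case: n => [//|[|n]] _; first exact: gl_E_parity.
by move=> d v _; rewrite /homogeneous /= linear0.
Qed.

Lemma ev_T_rel m n a b c d v : (0 < m)%N -> (0 < n)%N ->
  supercomm (par a (+) par b) (par c (+) par d) (ev_T m a b) (ev_T n c d) v
  = (c == b)%:R *: ev_T (m + n - 1) a d v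
    - (-1) ^+ ((par a (+) par b) && (par c (+) par d))
        *: ((a == d)%:R *: ev_T (m + n - 1) c b v)
    + (-1) ^+ ((par c && (par a (+) par b)) (+) (par a && par b))
        *: \sum_(1 <= r < minn m n)
             (ev_T r c b (ev_T (m + n - 1 - r) a d v)
              - ev_T (m + n - 1 - r) c b (ev_T r a d v)).
Proof.
move=> m0 n0; have sum0 : \sum_(1 <= r < minn m n)
    (ev_T r c b (ev_T (m + n - 1 - r) a d v)
     - ev_T (m + n - 1 - r) c b (ev_T r a d v)) = 0.
  rewrite big_nat big1 // => r /andP[r0]; rewrite leq_min => /andP[rm rn].
  have h : (1 < m + n - 1 - r)%N by lia.
  by rewrite !(ev_T_ge2 _ _ _ h) linear0 subr0.
rewrite sum0 scaler0 addr0; case: m m0 {sum0} => [//|[|m]] _.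
  by case: n n0 => [//|[|n]] _; rewrite ?gl_E_rel // /supercomm /=
    ?linear0 ?scaler0 ?subr0.
rewrite !(ev_T_ge2 _ _ _ (_ : 1 < m.+2 + n - 1)%N); last first.
- by case: n n0 => // n _; rewrite addnS subn1.
- by case: n n0 => // n _; rewrite addnS subn1.
by rewrite /supercomm /= linear0 !scaler0 subr0.
Qed.

Definition ev_Y : yangian_rep K M N :=
  @YangianRep K M N pi ev_T (fun _ _ _ => erefl) ev_T_parity ev_T_rel.

Definition ev (p : nat) (hp : (0 < p)%N) : W_rep K M N p :=
  @WRep K M N p ev_Y
    (fun n a b v hn => @ev_T_ge2 n a b v (leq_ltn_trans hp hn)).

End Evaluation.

Arguments ev {K M N} pi {p} hp.

(* With sum_r t^{ab}_(r) u^{-r} the entries of the RTT monodromy matrix,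
   t^{ab}_(0) = delta^{ab}, the generators satisfying the relations of
   [yangian_rep] are T^{ab}_(r) = (-1)^{[a]} t^{ab}_(r) for r >= 1.  The
   coproduct t^{ab}_(r) |-> sum t^{ac}_(r1) (x) t^{cb}_(r2) is an algebra
   morphism; the same formula without the signs, in terms of the T^{ab}_(r),
   is not compatible with the relations as soon as M, N >= 1. *)
Definition rtt (K : fieldType) (M N : nat) (V : yangian_rep K M N) (r : nat)
    (a b : 'I_(M + N)) (v : V) : V :=
  (if r == 0%N then 1 else (-1) ^+ par a) *: Y_T V r a b v.

Definition multilinear (K : fieldType) (s : nat) (V : 'I_s -> lmodType K)
    (U : lmodType K) (f : (forall k, V k) -> U) : Prop :=
  forall (v : forall k, V k) (k : 'I_s) (c : K) (x y : V k),
    f (dfwith v (c *: x + y)) = c *: f (dfwith v x) + f (dfwith v y).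

(* universal property of tau : (v_1, ..., v_s) |-> v_1 (x) ... (x) v_s *)
Definition is_tensor_product (K : fieldType) (s : nat) (V : 'I_s -> lmodType K)
    (W : lmodType K) (tau : (forall k, V k) -> W) : Prop :=
  multilinear tau /\
  forall (U : lmodType K) (f : (forall k, V k) -> U), multilinear f ->
    (exists g : {linear W -> U}, forall v, g (tau v) = f v) /\
    (forall g h : {linear W -> U},
       (forall v, g (tau v) = f v) -> (forall v, h (tau v) = f v) -> g =1 h).

(* The sign in (A_1 (x) ... (x) A_s)(v_1 (x) ... (x) v_s)
   = sign A_1 v_1 (x) ... (x) A_s v_s, for A_j of parity d j, v_k of parity
   e k: each A_j is moved past the v_k with k < j. *)
Definition koszul_sign (K : fieldType) (s : nat) (d e : 'I_s -> bool) : K :=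
  \prod_(j < s) \prod_(k < s | (k < j)%N) (-1) ^+ (d j && e k).

(* W is the tensor product of the representations V_1, ..., V_s.  An index
   path is a function i on {0, ..., s} with i 0 = a and i s = b; the j-th
   factor carries the indices (i (j-1), i j). *)
Definition is_tensor_rep (K : fieldType) (M N s : nat)
    (V : 'I_s -> yangian_rep K M N) (W : yangian_rep K M N) : Prop :=
  exists tau : (forall k, V k) -> W,
    [/\ is_tensor_product tau,
        forall (v : forall k, V k) (e : 'I_s -> bool),
          (forall k, homogeneous (e k) (v k)) ->
          homogeneous (\big[addb/false]_(k < s) e k) (tau v)
      & forall (v : forall k, V k) (e : 'I_s -> bool),
          (forall k, homogeneous (e k) (v k)) ->
        forall r a b,
          rtt r a b (tau v) =
          \sum_(rs : {ffun 'I_s -> 'I_r.+1} | (\sum_(k < s) rs k)%N == r)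
          \sum_(i : {ffun 'I_s.+1 -> 'I_(M + N)}
                  | (i ord0 == a) && (i ord_max == b))
            let l := fun k : 'I_s => i (widen_ord (leqnSn s) k) in
            let l' := fun k : 'I_s => i (lift ord0 k) in
            koszul_sign K (fun k => par (l k) (+) par (l' k)) e
              *: tau (fun k => rtt (rs k) (l k) (l' k) (v k))].

(* Main.v *)
Require Import Defs.
From HB Require Import structures.
From mathcomp Require Import freeg.
From mathcomp Require Import all_boot all_order all_algebra.
From mathcomp Require Import generic_quotient ring_quotient boolp functions.
From mathcomp Require Import zify reals complex.

(** Write e_a = (-1)^[a].  Let V be a finite-dimensional irreducible
    representation.  It contains a homogeneous vector v <> 0 that is killed by
    all T^{ab}_(r) with a < b and is a common eigenvector of all T^{aa}_(r)
    ([hw_vector_exists]).  As T^{aa}_(r) = 0 for r > p, the eigenvalues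
    lam_r(a) amount to one monic polynomial of degree p for each a,
      q_a(u) = u^p + e_a lam_1(a) u^(p-1) + ... + e_a lam_p(a),
    and this polynomial splits: q_a(u) is the product over k = 1, ..., p of
    factors u + e_a mu_k(a).  Let pi_k be an irreducible representation of
    gl(M|N) of highest weight mu_k ([irreducible_hw_exists]), and let W be the
    tensor product of the evaluation representations of pi_1, ..., pi_p.  Its
    RTT matrix is, up to a power of u, the product over k of the matrices
    (u delta^{ab} + e_a E_k^{ab}).  On the tensor product w of the highest
    weight vectors this product is triangular with diagonal entries q_a(u)
    ([tensor_rep_up], [tensor_rep_weight]), so w has the same weight as v.

    Let U be the subrepresentation of W + V generated by (w, v).  It projects
    onto V, because V is irreducible.  The projection to W is injective:
    otherwise U would contain (0, V) and hence (0, v), but the vectors of U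
    that have the weight of (w, v) are the multiples of (w, v).  So V is a
    quotient of the subrepresentation U of W ([subquotient_of_hw]).  In this
    way every V is a subquotient of a tensor product of exactly p evaluation
    representations.

    The pi_k are in general infinite-dimensional, which makes the argument
    basis-free: subspaces are predicates, and weight space decompositions are
    replaced by the predicate [below].  Three constructions are needed.

    - Existence of pi_k, for an arbitrary weight.  The algebra gl(M|N) acts on
      polynomials in even and odd variables x_{ij}, i < j, by first-order
      differential operators that depend on the weight as parameters; these
      are found by adding one index at a time ([dyson_gl], [dyson_module]).
      The constant 1 is a highest weight vector, and the constant coefficient
      is a functional that singles it out.  The span of 1 modulo the vectors
      that cannot be moved to a nonzero constant coefficient is irreducible.

    - Existence of the tensor product as a representation.  Operators in one
      factor are extended by parity signs to the other factors, so that
      operators in different factors commute in the graded sense ([slot],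
      [slot_comm]).  The RTT relation for a product of matrices then follows
      from that for the factors ([rtt_fuse]), and its coefficients are the
      defining relations of the Yangian ([yang_op_rel]).

    - The structure of a representation generated by a highest weight vector:
      it is spanned by the words in the lowering generators
      ([words_spanned]), which all have smaller height. *)

Set Implicit Arguments.
Unset Strict Implicit.
Unset Printing Implicit Defensive.

Import GRing.Theory Num.Theory.
Local Open Scope ring_scope.

(** * Deciding identities in abelian groups *)

(** An identity of abelian groups holds as soon as every atom has the same
    integer coefficient on both sides.  Atoms are compared up to unification,
    since the same operator is met under several coercions and structure
    instances. *)
Inductive zterm :=
  | ZVar of nat | ZZero | ZAdd of zterm & zterm | ZOpp of zterm.

Fixpoint zcoef (t : zterm) (i : nat) : int :=
  match t with
  | ZVar j => (i == j)%:Z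
  | ZZero => 0
  | ZAdd t1 t2 => zcoef t1 i + zcoef t2 i
  | ZOpp t1 => - zcoef t1 i
  end.

Fixpoint zeval (V : zmodType) (env : seq V) (t : zterm) : V :=
  match t with
  | ZVar j => nth 0 env j
  | ZZero => 0
  | ZAdd t1 t2 => zeval env t1 + zeval env t2
  | ZOpp t1 => - zeval env t1
  end.

Lemma zeval_coef (V : zmodType) (env : seq V) t :
  zeval env t = \sum_(i < size env) nth 0 env i *~ zcoef t i.
Proof.
elim: t => [j||t1 IH1 t2 IH2|t IH] /=.
- have [lt_j|ge_j] := ltnP j (size env); last first.
    rewrite nth_default // big1 // => i _.
    by rewrite ltn_eqF ?mulr0z // (leq_trans (ltn_ord i)).
  rewrite (bigD1 (Ordinal lt_j)) //= eqxx mulr1z big1 ?addr0 // => i ij.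
  by rewrite (negbTE (_ : (i : nat) != j)) ?mulr0z.
- by rewrite big1.
- by rewrite IH1 IH2 -big_split; apply: eq_bigr => i _; rewrite mulrzDr.
- by rewrite IH -sumrN; apply: eq_bigr => i _; rewrite mulrNz.
Qed.

Lemma zeval_eq (V : zmodType) (env : seq V) t1 t2 :
  all (fun i => zcoef t1 i == zcoef t2 i) (iota 0 (size env)) ->
  zeval env t1 = zeval env t2.
Proof.
move=> /allP h; rewrite !zeval_coef; apply: eq_bigr => i _.
by rewrite (eqP (h i _)) // mem_iota ltn_ord.
Qed.

Ltac zsame x y := match tt with _ => unify x y end.
Ltac zmem x env :=
  match env with
  | nil => constr:(false)
  | ?y :: ?r => match tt with
    | _ => let _ := zsame x y in constr:(true)
    | _ => zmem x r
    end
  end.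
Ltac zindex x env :=
  match env with
  | ?y :: ?r => match tt with
    | _ => let _ := zsame x y in constr:(O)
    | _ => let k := zindex x r in constr:(S k)
    end
  end.
Ltac zatoms env t :=
  match t with
  | (?a + ?b)%R => let e := zatoms env a in zatoms e b
  | (- ?a)%R => zatoms env a
  | (0)%R => env
  | _ => let m := zmem t env in
         match m with true => env | false => constr:(t :: env) end
  end.
Ltac zreify env t :=
  match t with
  | (?a + ?b)%R => let x := zreify env a in let y := zreify env b in
                   constr:(ZAdd x y)
  | (- ?a)%R => let x := zreify env a in constr:(ZOpp x)
  | (0)%R => constr:(ZZero)
  | _ => let k := zindex t env in constr:(ZVar k)
  end.
Ltac zmod :=
  match goal with
  | |- @eq ?V ?l ?r =>
    let e0 := constr:(@nil V) in
    let e1 := zatoms e0 l in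
    let env := zatoms e1 r in
    let x := zreify env l in
    let y := zreify env r in
    let H := fresh in
    have H := @zeval_eq _ env x y; exact: (H erefl)
  end.

(** * Subspaces, quotients and operators *)

Lemma mklinear (K : fieldType) (V W : lmodType K) (f : V -> W) :
  linear f -> {g : {linear V -> W} | g =1 f}.
Proof.
move=> lf; pose mf := GRing.isLinear.Build K V W *:%R f lf.
pose g : {linear V -> W} := HB.pack f mf.
by exists g.
Qed.

(** Subspaces are predicates: the spaces below may be infinite-dimensional,
    and their subspaces are given by undecidable conditions. *)
Definition subspace (K : fieldType) (V : lmodType K) (S : V -> Prop) :=
  S 0 /\ forall c u v, S u -> S v -> S (c *: u + v).

Section Subspaces.
Variables (K : fieldType) (V : lmodType K).

Lemma subspaceZ (S : V -> Prop) c u : subspace S -> S u -> S (c *: u).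
Proof. by move=> [S0 SL] Su; rewrite -[_ *: _]addr0; apply: SL. Qed.

Lemma subspaceD (S : V -> Prop) u v : subspace S -> S u -> S v -> S (u + v).
Proof. by move=> [S0 SL] Su Sv; rewrite -[u]scale1r; apply: SL. Qed.

Lemma subspaceB (S : V -> Prop) u v : subspace S -> S u -> S v -> S (u - v).
Proof.
by move=> [S0 SL] Su Sv; rewrite addrC -scaleN1r; apply: SL.
Qed.

Lemma subspace_sum (S : V -> Prop) (I : Type) (r : seq I) (P : pred I)
    (F : I -> V) :
  subspace S -> (forall i, P i -> S (F i)) -> S (\sum_(i <- r | P i) F i).
Proof.
move=> hS hF; elim/big_ind: _ => //; first by case: hS.
by move=> x y; apply: subspaceD.
Qed.

Definition in_subspace (S : V -> Prop) (_ : subspace S) : pred V :=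
  fun v => `[< S v >].

Fact in_subspace_submod (S : V -> Prop) (hS : subspace S) :
  submod_closed (in_subspace hS).
Proof.
have [S0 SL] := hS; split; first exact/asboolP.
by move=> c u v /asboolP Su /asboolP Sv; apply/asboolP; apply: SL.
Qed.

HB.instance Definition _ S hS :=
  GRing.isSubmodClosed.Build K V (@in_subspace S hS) (in_subspace_submod hS).

Section Sub.
Variables (S : V -> Prop) (hS : subspace S).
Record sub_carrier := SubCarrier { sub_val : V; _ : in_subspace hS sub_val }.
HB.instance Definition _ := [isSub for sub_val].
HB.instance Definition _ := [Choice of sub_carrier by <:].
HB.instance Definition _ := [SubChoice_isSubLmodule of sub_carrier by <:].

Lemma subspace_type :
  exists (W : lmodType K) (i : {linear W -> V}),
    injective i /\ forall v, S v <-> exists w, i w = v.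
Proof.
exists (sub_carrier : lmodType K), (val : {linear sub_carrier -> V}).
split; first exact: val_inj.
move=> v; split => [Sv|[w <-]]; last exact/asboolP/(valP w).
have Pv : in_subspace hS v by apply/asboolP.
by exists (SubCarrier Pv).
Qed.
End Sub.

Section Quot.
Local Open Scope quotient_scope.
Variables (S : V -> Prop) (hS : subspace S).
Local Notation Q := (Quotient.quot (GRing.ZmodClosed.clone V (in_subspace hS) _)).
Let eqQ (x y : V) : (\pi_Q x = \pi_Q y) <-> S (x - y).
Proof.
split=> [/eqP|h]; first by rewrite -Quotient.idealrBE => /asboolP.
by apply/eqP; rewrite -Quotient.idealrBE; apply/asboolP.
Qed.
Let piD x y : \pi_Q (x + y) = \pi_Q x + \pi_Q y.
Proof. by rewrite piE. Qed.
Let scale (c : K) (q : Q) : Q := \pi_Q (c *: repr q).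
Let piZ c x : \pi_Q (c *: x) = scale c (\pi_Q x).
Proof.
apply/eqQ; rewrite -scalerBr; apply: subspaceZ => //.
by apply/eqQ; rewrite reprK.
Qed.
Let scaleA a b q : scale a (scale b q) = scale (a * b) q.
Proof. by elim/quotW: q => x; rewrite -(piZ b) -(piZ a) -(piZ (a * b)) scalerA. Qed.
Let scale1 q : scale 1 q = q.
Proof. by elim/quotW: q => x; rewrite -(piZ 1) scale1r. Qed.
Let scaleDr c q r : scale c (q + r) = scale c q + scale c r.
Proof. by elim/quotW: q => x; elim/quotW: r => y; rewrite -piD -(piZ c) -(piZ c x) -(piZ c y) -piD scalerDr. Qed.
Let scaleDl q a b : scale (a + b) q = scale a q + scale b q.
Proof. by elim/quotW: q => x; rewrite -(piZ a) -(piZ b) -(piZ (a + b)) -piD scalerDl. Qed.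
Let mQ := GRing.Zmodule_isLmodule.Build K Q scaleA scale1 scaleDr scaleDl.

Lemma quotient_type :
  exists (W : lmodType K) (p : {linear V -> W}),
    (forall w, exists v, p v = w) /\ forall v, p v = 0 <-> S v.
Proof.
pose W : lmodType K := HB.pack Q mQ.
have lp : linear (\pi_Q : V -> W) by move=> c x y; rewrite piD piZ.
have [p hp] := mklinear lp.
exists W, p; split => [w|v]; first by exists (repr w); rewrite hp reprK.
rewrite hp; have -> : (0 : W) = \pi_Q 0 by rewrite piE.
by rewrite eqQ subr0.
Qed.
End Quot.

End Subspaces.

(** With operators as elements of a ring, the graded commutation relations
    become ring identities.  The ring is trivial when the space is zero. *)
Section Endo.
Variables (K : fieldType) (W : lmodType K).

Definition is_linear (f : W -> W) : bool := `[< linear f >].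

Fact is_linear_submod : submod_closed is_linear.
Proof.
split; first by apply/asboolP => c u v; rewrite /= [RHS]addr0 scaler0.
move=> a f g /asboolP lf /asboolP lg; apply/asboolP => c u v.
have E x : (a *: f + g) x = a *: f x + g x by [].
by rewrite !E lf lg !scalerDr !scalerA (mulrC a) addrACA.
Qed.
HB.instance Definition _ :=
  GRing.isSubmodClosed.Build K (W -> W) is_linear is_linear_submod.

Record endo := Endo { endo_fun :> W -> W; _ : is_linear endo_fun }.
HB.instance Definition _ := [isSub for endo_fun].
HB.instance Definition _ := [Choice of endo by <:].
HB.instance Definition _ := [SubChoice_isSubLmodule of endo by <:].

Fact endo_linear (f : endo) : linear f.
Proof. by case: f => f lf; apply/asboolP. Qed.
HB.instance Definition _ (f : endo) :=
  GRing.isLinear.Build K W W *:%R (endo_fun f) (endo_linear f).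

Lemma endoP (f g : endo) : f =1 g -> f = g.
Proof. by move=> h; apply/val_inj/funext. Qed.

Fact linear_is_linear (f : {linear W -> W}) : is_linear f.
Proof. by apply/asboolP => c u v; rewrite linearP. Qed.
Definition mkendo (f : {linear W -> W}) : endo := Endo (linear_is_linear f).

Fact endo1_subproof : is_linear id.
Proof. exact/asboolP. Qed.
Fact endoM_subproof (f g : endo) : is_linear (f \o g).
Proof. by apply/asboolP => c u v /=; rewrite !linearP. Qed.
Definition endo1 := Endo endo1_subproof.
Definition endoM (f g : endo) := Endo (endoM_subproof f g).

Lemma endoDE (f g : endo) v : (f + g) v = f v + g v. Proof. by []. Qed.
Lemma endoBE (f g : endo) v : (f - g) v = f v - g v. Proof. by []. Qed.
Lemma endoZE c (f : endo) v : (c *: f) v = c *: f v. Proof. by []. Qed.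

Fact endoMA : associative endoM. Proof. by move=> f g h; apply: endoP. Qed.
Fact endo1M : left_id endo1 endoM. Proof. by move=> f; apply: endoP. Qed.
Fact endoM1 : right_id endo1 endoM. Proof. by move=> f; apply: endoP. Qed.
Fact endoMDl : left_distributive endoM +%R.
Proof. by move=> f g h; apply: endoP. Qed.
Fact endoMDr : right_distributive endoM +%R.
Proof. by move=> f g h; apply: endoP => v; exact: (linearD f). Qed.
HB.instance Definition _ :=
  GRing.Zmodule_isPzRing.Build endo endoMA endo1M endoM1 endoMDl endoMDr.

Lemma endoME (f g : endo) v : (f * g) v = f (g v). Proof. by []. Qed.
Lemma endo1E v : (1 : endo) v = v. Proof. by []. Qed.
Lemma endo_sumE (I : Type) (r : seq I) (P : pred I) (F : I -> endo) v :
  (\sum_(i <- r | P i) F i) v = \sum_(i <- r | P i) F i v.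
Proof. by elim/big_rec2: _ => // i x y _ <-. Qed.
Lemma endoZl c (f g : endo) : c *: (f * g) = (c *: f) * g.
Proof. exact: endoP. Qed.
Lemma endoZr c (f g : endo) : c *: (f * g) = f * (c *: g).
Proof. by apply: endoP => v; rewrite endoZE !endoME endoZE linearZ. Qed.
Lemma endo_signE n (f : endo) v : ((-1) ^+ n * f) v = (-1) ^+ n *: f v.
Proof.
by rewrite -signr_odd -[in RHS]signr_odd mulr_sign scaler_sign; case: odd.
Qed.
Lemma endo_natE n (f : endo) v : (n%:R * f) v = n%:R *: f v.
Proof.
rewrite mulr_natl scaler_nat; elim: n => // n IH.
by rewrite !mulrS endoDE IH.
Qed.
End Endo.

Section Factor.
Variables (K : fieldType).

Lemma factor_surj (V W U : lmodType K) (p : {linear V -> W})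
    (f : {linear V -> U}) :
  (forall w, exists v, p v = w) -> (forall v, p v = 0 -> f v = 0) ->
  exists g : {linear W -> U}, forall v, g (p v) = f v.
Proof.
move=> /choice[r pr] pf.
have fE v v' : p v = p v' -> f v = f v'.
  by move=> h; apply/eqP; rewrite -subr_eq0 -linearB pf // linearB h subrr.
have lg : linear (f \o r).
  by move=> c u v /=; rewrite -linearP; apply: fE; rewrite linearP !pr.
have [g gE] := mklinear lg.
by exists g => v; rewrite gE /=; apply: fE; rewrite pr.
Qed.

Lemma factor_inj (V W U : lmodType K) (i : {linear U -> W})
    (f : {linear V -> W}) :
  injective i -> (forall v, exists u, i u = f v) ->
  exists g : {linear V -> U}, forall v, i (g v) = f v.
Proof.
move=> inj /choice[r ir].
have lg : linear r by move=> c u v; apply: inj; rewrite linearP !ir linearP.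
by have [g gE] := mklinear lg; exists g => v; rewrite gE.
Qed.

End Factor.

(** * Existence of tensor products *)

Section TensorSpace.
Variables (K : fieldType) (s : nat) (V : 'I_s -> lmodType K).
Local Notation X := (forall k, V k).
Local Notation F := ({freeg X / K}).
Local Notation gen v := (<< (v : X) >>%g : F).

Let relator (v : X) (k : 'I_s) (c : K) (x y : V k) : F :=
  << dfwith v (c *: x + y) >> - (c *: << dfwith v x >> + << dfwith v y >>).

(* The span of the relators. *)
Let relations (D : F) : Prop := forall S : F -> Prop, subspace S ->
  (forall v k c x y, S (@relator v k c x y)) -> S D.

Let subspace_relations : subspace relations.
Proof.
split=> [S [] //|c u v Ru Rv S hS SR].
by have [_ SL] := hS; apply: SL; [apply: Ru|apply: Rv].
Qed.

Let freeg_lin (U : lmodType K) (f : X -> U) : linear (@fglift K U X f).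
Proof.
pose mf := GRing.isZmodMorphism.Build _ _ (fglift f) (lift_is_additive f).
pose L : {additive F -> U} := HB.pack (fglift f) mf.
have LU k x : L << k *g x >> = k *: f x by exact: liftU.
move=> c u v; change (L (c *: u + v) = c *: L u + L v); rewrite raddfD; congr (_ + _).
rewrite -[u in RHS]freeg_sumE [in RHS]raddf_sum scaler_sumr.
rewrite [c *: u]/(fgscale c u) /fgscale raddf_sum.
by apply: eq_bigr => x _; rewrite !LU scalerA.
Qed.

(** The free vector space on all families of vectors, modulo the relations
    that express multilinearity. *)
Lemma tensor_space_exists :
  exists (W : lmodType K) (tau : X -> W), is_tensor_product tau.
Proof.
have [W [p [psurj pker]]] := quotient_type subspace_relations.
exists W, (fun v => p << v >>); split.
  move=> v k c x y; apply/eqP; rewrite -linearP -subr_eq0 -linearB.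
  by apply/eqP/pker => S hS SR; exact: (SR v k c x y).
move=> U f fm; split.
  have [L LE] := mklinear (freeg_lin f).
  have Lg v : L << v >> = f v by rewrite LE [LHS]liftU scale1r.
  have [g gE] : exists g : {linear W -> U}, forall D, g (p D) = L D.
    apply: factor_surj => // D /pker/(_ (fun D => L D = 0)); apply; last first.
      by move=> v k c x y; rewrite /relator linearB linearP !Lg fm subrr.
    by split=> [|c x y Lx Ly]; rewrite ?linear0 // linearP Lx Ly scaler0 addr0.
  by exists g => v; rewrite gE Lg.
move=> g h gE hE w; have [D <-] := psurj w.
rewrite -[D]freeg_sumE !linear_sum; apply: eq_bigr => x _ /=.
have -> : << coeff x D *g x >> = coeff x D *: << x >> :> F.
  by apply/eqP/freeg_eqP => y; rewrite coeffZ !coeffU mul1r.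
by rewrite !linearZ /= gE hE.
Qed.

End TensorSpace.

(** * Parity *)

Section Parity.
Variable K : numFieldType.

(** Parity is governed by one involution, 1 on even and -1 on odd vectors:
    being homogeneous is an eigenvalue equation for it, and the parity of an
    operator is the sign with which it commutes with it. *)
Definition parity_op (V : superspace K) : endo V :=
  locked (mkendo (hpart V false) - mkendo (hpart V true)).

Lemma parity_opE (V : superspace K) (v : V) :
  parity_op V v = hpart V false v - hpart V true v.
Proof. by rewrite /parity_op -lock. Qed.

Lemma parity_opK (V : superspace K) : parity_op V * parity_op V = 1.
Proof.
apply: endoP => v; rewrite endoME !parity_opE !linearB !hpart_comp /=.
by rewrite subr0 oppr0 sub0r opprK hpart_sum.
Qed.

Lemma half2 (W : lmodType K) (v : W) : 2^-1 *: (v + v) = v.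
Proof.
by rewrite -mulr2n -scaler_nat scalerA mulVf ?scale1r // pnatr_eq0.
Qed.

Lemma hpartE (V : superspace K) e (v : V) :
  hpart V e v = 2^-1 *: (v + (-1) ^+ e *: parity_op V v).
Proof.
rewrite -[X in X + _](hpart_sum v) parity_opE.
case: e => /=; rewrite ?addr0 ?add0r ?expr1 ?expr0 ?scale1r ?scaleN1r.
  by rewrite opprB addrC -addrA addKr half2.
by rewrite addrACA subrr addr0 half2.
Qed.

Lemma homogeneousP (V : superspace K) e (v : V) :
  homogeneous e v <-> parity_op V v = (-1) ^+ e *: v.
Proof.
rewrite /homogeneous; split=> [<-|h].
  rewrite parity_opE !hpart_comp; case: e => /=.
    by rewrite sub0r expr1 scaleN1r.
  by rewrite subr0 expr0 scale1r.
by rewrite hpartE h scalerA -signr_addb addbb scale1r half2.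
Qed.

Lemma hpart_homogeneous (V : superspace K) e (v : V) :
  homogeneous e (hpart V e v).
Proof. by rewrite /homogeneous hpart_comp eqxx. Qed.

Lemma has_parityP (V : superspace K) e (f : endo V) :
  has_parity e f <-> parity_op V * f = (-1) ^+ e * (f * parity_op V).
Proof.
split=> h.
  apply: endoP => v; rewrite endo_signE !endoME.
  rewrite -[v in LHS]hpart_sum [parity_op V v]parity_opE !(linearB, linearD) /=.
  have hd d := (homogeneousP _ _).1 (h d _ (hpart_homogeneous d v)).
rewrite !hd /=; case: (e); rewrite /= ?linearB ?expr0 ?expr1 ?scale1r ?scaleN1r //.
  by rewrite opprK addrC.
move=> d v /homogeneousP hv; apply/homogeneousP.
rewrite -[LHS]/((parity_op V * f) v) h endo_signE endoME hv linearZ scalerA.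
by rewrite -signr_addb addbC.
Qed.

Section OfInvolution.
Variables (W : lmodType K) (P : endo W) (PP : P * P = 1).

Let hp (e : bool) : endo W := 2^-1 *: (1 + (-1) ^+ e * P).

Let hpE e v : hp e v = 2^-1 *: (v + (-1) ^+ e *: P v).
Proof. by rewrite endoZE endoDE endo1E endo_signE. Qed.

Let hp_comp d e v : hp d (hp e v) = if d == e then hp e v else 0.
Proof.
have PK w : P (P w) = w by rewrite -endoME PP.
rewrite (hpE d) hpE [P (2^-1 *: _)]linearZ /= [P (v + _)]linearD /=.
rewrite [P (_ *: P v)]linearZ /= PK; case: d; case: e;
  rewrite /= ?expr0 ?expr1 ?scaleN1r ?scale1r.
- by rewrite -scalerN -scalerDr opprD opprK [- P v + v]addrC half2.
- by rewrite [P v + v]addrC subrr scaler0.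
- by rewrite -(opprB v) scalerN subrr scaler0.
- by rewrite -scalerDr [P v + v]addrC half2.
Qed.

Let hp_sum v : hp false v + hp true v = v.
Proof.
rewrite !hpE expr0 expr1 scale1r scaleN1r.
by rewrite -scalerDr addrACA subrr addr0 half2.
Qed.

Definition superspace_of : superspace K :=
  @Superspace K W (fun e => hp e : {linear W -> W}) hp_comp hp_sum.

Lemma parity_superspace_of : parity_op superspace_of = P.
Proof.
apply: endoP => v; rewrite parity_opE.
rewrite -[hpart _ _ v]/(hp false v) -[hpart _ true v]/(hp true v) !hpE.
rewrite expr0 expr1 scale1r scaleN1r.
by rewrite -scalerBr opprD opprK addrACA subrr add0r half2.
Qed.
End OfInvolution.

End Parity.

Lemma has_parity_hpart (K : numFieldType) (V : superspace K) e (f : {linear V -> V}) d v :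
  has_parity e f -> f (hpart V d v) = hpart V (d (+) e) (f v).
Proof.
move=> fe; have /has_parityP PF : has_parity e (mkendo f) by exact: fe.
have Pf : parity_op V (f v) = (-1) ^+ e *: f (parity_op V v).
  rewrite -[LHS]/((parity_op V * mkendo f) v) PF.
  exact: endo_signE.
rewrite !hpartE Pf linearZ linearD linearZ /= scalerA -signr_addb.
by rewrite -addbA addbb addbF.
Qed.

(** * Operators acting in one factor of a graded tensor product *)

Section Slots.
Variables (K : numFieldType) (s : nat) (V : 'I_s -> superspace K).
Variables (W : lmodType K) (tau : (forall k, V k) -> W).
Hypothesis tauP : is_tensor_product tau.

Lemma tensor_ext (U : lmodType K) (f g : {linear W -> U}) :
  (forall v, f (tau v) = g (tau v)) -> f =1 g.
Proof.
move=> fg; have fm : multilinear (f \o tau).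
  by move=> v k c x y /=; rewrite tauP.1 linearP.
have [_] := tauP.2 _ _ fm; apply => v //=; by rewrite fg.
Qed.

Lemma tensor_ext_endo (f g : endo W) :
  (forall v, f (tau v) = g (tau v)) -> f = g.
Proof. by move=> fg; apply/endoP; apply: tensor_ext. Qed.

Lemma dfwith_app (B : forall k, endo (V k)) (v : forall k, V k) k (x : V k) :
  (fun l => B l (dfwith v x l)) = dfwith (fun l => B l (v l)) (B k x).
Proof.
apply/functional_extensionality_dep => l.
by case: (dfwithP v x) => [|j kj]; rewrite ?dfwith_in ?dfwith_out.
Qed.

Lemma dfwith_app2 (B : forall k, endo (V k)) (v : forall k, V k) k (A : endo (V k)) :
  (fun l => dfwith B A l (v l)) = dfwith (fun l => B l (v l)) (A (v k)).
Proof.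
apply/functional_extensionality_dep => l.
by case: (dfwithP B A) => [|j kj]; rewrite ?dfwith_in ?dfwith_out.
Qed.

Lemma dfwith_id (v : forall k, V k) k : dfwith v (v k) = v.
Proof.
apply/functional_extensionality_dep => l.
by case: (dfwithP v (v k)).
Qed.

Lemma tensor0 (w : forall k, V k) (k : 'I_s) : tau (dfwith w (0 : V k)) = 0.
Proof.
have := tauP.1 w k 1 0 0; rewrite scaler0 addr0 scale1r => /eqP.
by rewrite -[X in X == _]addr0 (inj_eq (addrI _)) eq_sym => /eqP.
Qed.

Lemma tensor_eq0 (w : forall k, V k) k : w k = 0 -> tau w = 0.
Proof. by move=> w0; rewrite -(dfwith_id w k) w0 tensor0. Qed.

Lemma tensorZ (w : forall k, V k) (k : 'I_s) a (x : V k) :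
  tau (dfwith w (a *: x)) = a *: tau (dfwith w x).
Proof. by rewrite -[a *: x]addr0 tauP.1 tensor0 addr0. Qed.

Lemma tensor_functional (l : forall k, {linear V k -> K^o}) :
  exists f : {linear W -> K^o}, forall v, f (tau v) = \prod_k (l k (v k) : K).
Proof.
pose f (v : forall k, V k) : K^o := \prod_k (l k (v k) : K).
have fE v k (y : V k) :
    f (dfwith v y) = (l k y : K) * \prod_(i | i != k) (l i (v i) : K).
  rewrite /f (bigD1 k) //= dfwith_in; congr (_ * _).
  by apply: eq_bigr => i ik; rewrite dfwith_out // eq_sym.
have fm : multilinear f by move=> v k c x y; rewrite !fE linearP mulrDl -mulrA.
by have [[g gE] _] := tauP.2 _ f fm; exists g.
Qed.

Lemma tensor_scale (c : 'I_s -> K) (v : forall k, V k) :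
  tau (fun k => c k *: v k) = (\prod_k c k) *: tau v.
Proof.
suff H (r : seq 'I_s) : uniq r ->
    tau (fun k => (if k \in r then c k else 1) *: v k)
    = (\prod_(k <- r) c k) *: tau v.
  rewrite -H ?index_enum_uniq //; congr tau.
  by apply/functional_extensionality_dep => k; rewrite mem_index_enum.
elim: r => [_|k r IH /= /andP[kr ur]].
  rewrite big_nil scale1r; congr tau.
  by apply/functional_extensionality_dep => k; rewrite in_nil scale1r.
rewrite big_cons -scalerA -IH //.
set w := fun l => (if l \in r then c l else 1) *: v l.
have E1 : w = dfwith w (v k).
  by rewrite -[in LHS](dfwith_id w k) /w (negbTE kr) scale1r.
rewrite [in RHS]E1 -tensorZ; congr tau; apply/functional_extensionality_dep => l.
case: (dfwithP w) => [|j kj]; first by rewrite mem_head.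
by rewrite in_cons eq_sym (negbTE kj).
Qed.

Lemma tensor_map_exists :
  exists tmap : (forall k, endo (V k)) -> endo W,
    forall B v, tmap B (tau v) = tau (fun k => B k (v k)).
Proof.
suff /choice[t tE] : forall B : (forall k, endo (V k)), exists f : endo W,
    forall v, f (tau v) = tau (fun k => B k (v k)) by exists t.
move=> B; have fm : multilinear (fun v => tau (fun k => B k (v k))).
  move=> v k c x y.
  by rewrite !dfwith_app linearP tauP.1.
have [[g gE] _] := tauP.2 _ _ fm.
by exists (mkendo g) => v; rewrite -gE.
Qed.

Variable tmap : (forall k, endo (V k)) -> endo W.
Hypothesis tmapE : forall B v, tmap B (tau v) = tau (fun k => B k (v k)).

Lemma tmapM B C : tmap (fun k => B k * C k) = tmap B * tmap C.
Proof. by apply: tensor_ext_endo => v; rewrite endoME !tmapE. Qed.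

Lemma tmap1 : tmap (fun k => 1) = 1.
Proof. by apply: tensor_ext_endo => v; rewrite tmapE. Qed.

Lemma tmap_linear B k (c : K) (x y : endo (V k)) :
  tmap (dfwith B (c *: x + y)) = c *: tmap (dfwith B x) + tmap (dfwith B y).
Proof.
apply: tensor_ext_endo => v; rewrite endoDE endoZE !tmapE !dfwith_app2.
by rewrite tauP.1.
Qed.

Lemma tmap_dfwith0 B k : tmap (dfwith B (0 : endo (V k))) = 0.
Proof.
have := tmap_linear B 1 (0 : endo (V k)) 0; rewrite !scale1r addr0 => /eqP.
by rewrite -[X in X == _]addr0 (inj_eq (addrI _)) eq_sym => /eqP.
Qed.

Lemma tmap_dfwithZ B k c (x : endo (V k)) :
  tmap (dfwith B (c *: x)) = c *: tmap (dfwith B x).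
Proof. by rewrite -[c *: x]addr0 tmap_linear tmap_dfwith0 addr0. Qed.

Lemma tmap_prod (I : Type) (r : seq I) (B : I -> forall k, endo (V k)) :
  \prod_(i <- r) tmap (B i) = tmap (fun k => \prod_(i <- r) B i k).
Proof.
elim: r => [|i r IH].
  rewrite big_nil -tmap1; congr tmap; apply/functional_extensionality_dep => k.
  by rewrite big_nil.
rewrite big_cons IH -tmapM; congr tmap; apply/functional_extensionality_dep => k.
by rewrite big_cons.
Qed.

Local Notation P k := (parity_op (V k)).

(** An operator of parity d that enters the tensor product from the left
    passes the factors l < k, at the cost of the sign operator P^d in each. *)
Definition klein (d : bool) (k l : 'I_s) : endo (V l) :=
  if (l < k)%N then P l ^+ d else 1.

Definition slot (k : 'I_s) (d : bool) (A : endo (V k)) : endo W :=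
  tmap (dfwith (klein d k) A).

Lemma slot_linear k d c (A B : endo (V k)) :
  slot d (c *: A + B) = c *: slot d A + slot d B.
Proof. exact: tmap_linear. Qed.

Lemma slot0 k d : slot d (0 : endo (V k)) = 0.
Proof. exact: tmap_dfwith0. Qed.

Lemma slotZ k d c (A : endo (V k)) : slot d (c *: A) = c *: slot d A.
Proof. exact: tmap_dfwithZ. Qed.

Lemma slotD k d (A B : endo (V k)) : slot d (A + B) = slot d A + slot d B.
Proof. by rewrite -[A]scale1r slot_linear !scale1r. Qed.

Lemma slotN k d (A : endo (V k)) : slot d (- A) = - slot d A.
Proof. by rewrite -scaleN1r slotZ scaleN1r. Qed.

Lemma slot_sign k d n (A : endo (V k)) :
  slot d ((-1) ^+ n * A) = (-1) ^+ n * slot d A.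
Proof.
by rewrite -signr_odd -[in RHS]signr_odd !mulr_sign; case: odd => //; rewrite slotN.
Qed.

Lemma slotM k d e (A B : endo (V k)) :
  slot d A * slot e B = slot (d (+) e) (A * B).
Proof.
rewrite /slot -tmapM; congr tmap; apply/functional_extensionality_dep => l.
case: (dfwithP (klein d k) A) => [|j kj]; rewrite ?dfwith_in ?dfwith_out //.
rewrite /klein; case: ltnP => _; last by rewrite mulr1.
by case: d; case: e; rewrite /= ?expr0 ?expr1 ?mulr1 ?mul1r ?parity_opK.
Qed.

Lemma slot1 k : slot (k := k) false 1 = 1.
Proof.
rewrite /slot -[in RHS]tmap1; congr tmap; apply/functional_extensionality_dep => l.
case: (dfwithP (klein false k) 1) => // j _.
by rewrite /klein; case: ifP.
Qed.

Definition odd_by (U : lmodType K) (Q : endo U) (d : bool) (A : endo U) :=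
  Q * A = (-1) ^+ d * (A * Q).

(** The sign arises in the left factor k only, where A meets the parity
    operator that belongs to B. *)
Lemma slot_comm_lt k l d e (A : endo (V k)) (B : endo (V l)) : (k < l)%N ->
  odd_by (P k) d A ->
  slot d A * slot e B = (-1) ^+ (d && e) * (slot e B * slot d A).
Proof.
move=> kl hA; have nkl : k != l by rewrite neq_ltn kl.
have swap : A * P k ^+ e = (-1) ^+ (d && e) * (P k ^+ e * A).
  case: (e); rewrite /= ?andbF ?andbT ?expr0 ?expr1 ?mulr1 ?mul1r //.
  by rewrite hA mulrA -signr_addb addbb mul1r.
have E1 : slot d A * slot e B
    = tmap (dfwith (fun j => dfwith (klein d k) A j * dfwith (klein e l) B j)
                   (A * P k ^+ e)).
  rewrite /slot -tmapM; congr tmap; apply/functional_extensionality_dep => j.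
  case: (dfwithP (fun j => dfwith (klein d k) A j * dfwith (klein e l) B j)) => //.
  by rewrite dfwith_in dfwith_out 1?eq_sym // /klein kl.
have E2 : slot e B * slot d A
    = tmap (dfwith (fun j => dfwith (klein d k) A j * dfwith (klein e l) B j)
                   (P k ^+ e * A)).
  rewrite /slot -tmapM; congr tmap; apply/functional_extensionality_dep => j.
  case: (dfwithP (fun j => dfwith (klein d k) A j * dfwith (klein e l) B j)).
    by rewrite dfwith_in dfwith_out 1?eq_sym // /klein kl.
  move=> i ki; rewrite [dfwith (klein d k) _ _]dfwith_out //.
  case: (dfwithP (klein e l) B) => [|j' lj'].
    rewrite /klein ifN ?mul1r ?mulr1 // -leqNgt; exact: ltnW.
  rewrite /klein; case: ltnP => _; case: ltnP => _; rewrite ?mulr1 ?mul1r //.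
  by case: (d); case: (e); rewrite ?expr0 ?mulr1 ?mul1r.
rewrite E1 E2 swap; case: (d && e); last by rewrite expr0 !mul1r.
by rewrite expr1 !mulN1r -scaleN1r tmap_dfwithZ scaleN1r.
Qed.

Lemma slot_comm k l d e (A : endo (V k)) (B : endo (V l)) : k != l ->
  odd_by (P k) d A -> odd_by (P l) e B ->
  slot d A * slot e B = (-1) ^+ (d && e) * (slot e B * slot d A).
Proof.
rewrite neq_ltn => /orP[kl|lk] hA hB; first exact: slot_comm_lt.
by rewrite (slot_comm_lt d A lk hB) mulrA andbC -signr_addb addbb mul1r.
Qed.

Definition tensor_parity : endo W := tmap (fun k => P k).

Lemma tensor_parityK : tensor_parity * tensor_parity = 1.
Proof.
rewrite /tensor_parity -tmapM -[in RHS]tmap1; congr tmap.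
by apply/functional_extensionality_dep => k; rewrite parity_opK.
Qed.

Lemma slot_odd_by k d (A : endo (V k)) :
  odd_by (P k) d A -> odd_by tensor_parity d (slot d A).
Proof.
move=> hA; pose C l := dfwith (klein d k) A l * P l.
have E1 : slot d A * tensor_parity = tmap (dfwith C (A * P k)).
  rewrite /slot -tmapM; congr tmap; apply/functional_extensionality_dep => j.
  by case: (dfwithP C) => //; rewrite dfwith_in.
have E2 : tensor_parity * slot d A = tmap (dfwith C (P k * A)).
  rewrite /slot -tmapM; congr tmap; apply/functional_extensionality_dep => j.
  case: (dfwithP C) => [|i ki]; rewrite ?dfwith_in // /C !dfwith_out // /klein.
  by case: ltnP => _; case: (d); rewrite ?mulr1 ?mul1r.
rewrite /odd_by E1 E2 hA; case: (d); last by rewrite !mul1r.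
by rewrite expr1 !mulN1r -scaleN1r tmap_dfwithZ scaleN1r.
Qed.

Lemma tensor_parityE v (e : 'I_s -> bool) :
  (forall k, homogeneous (e k) (v k)) ->
  tensor_parity (tau v) = (-1) ^+ (\big[addb/false]_k e k) *: tau v.
Proof.
move=> he; rewrite tmapE.
have -> : (fun k => P k (v k)) = (fun k => (-1) ^+ e k *: v k).
  by apply/functional_extensionality_dep => k; apply/homogeneousP.
rewrite tensor_scale; congr (_ *: _).
by elim/big_rec2: _ => // k x y _ ->; rewrite signr_addb.
Qed.

(** The operators are listed from left to right, so the one in the last factor
    acts first, when the vectors on its left are still the v_k. *)
Lemma slot_prod_apply (d e : 'I_s -> bool) (A : forall k, endo (V k)) v :
  (forall k, homogeneous (e k) (v k)) ->
  (\prod_k slot (d k) (A k)) (tau v)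
  = koszul_sign K d e *: tau (fun k => A k (v k)).
Proof.
move=> he; rewrite /slot tmap_prod tmapE.
pose c (r : seq 'I_s) (k : 'I_s) : K := \prod_(j <- r | (k < j)%N) (-1) ^+ (d j && e k).
suff H (r : seq 'I_s) k : sorted (fun i j : 'I_s => (i < j)%N) r ->
    (\prod_(j <- r) dfwith (klein (d j) j) (A j) k) (v k)
    = c r k *: (if k \in r then A k (v k) else v k).
  have -> : (fun k => (\prod_j dfwith (klein (d j) j) (A j) k) (v k))
          = (fun k => c (index_enum 'I_s) k *: A k (v k)).
    apply/functional_extensionality_dep => k; rewrite H ?mem_index_enum //.
    rewrite [index_enum _]unlock -enumT.
    have := iota_ltn_sorted 0 s; rewrite -val_enum_ord.
    by rewrite sorted_map.
  rewrite tensor_scale; congr (_ *: _); rewrite /koszul_sign.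
  by rewrite /c (exchange_big_dep xpredT).
elim: r => [_|j r IH rs].
  by rewrite /c !big_nil in_nil scale1r.
have rs' : sorted (fun i j : 'I_s => (i < j)%N) r by exact: path_sorted rs.
have jr i : i \in r -> (j < i)%N.
  move: rs; rewrite /= path_sortedE; last by move=> ? ? ?; apply: ltn_trans.
  by move=> /andP[/allP h _] /h.
rewrite big_cons endoME IH //= linearZ /= in_cons /c big_cons.
have [->|kj] := eqVneq k j.
  rewrite dfwith_in ltnn /=; case: ifP => // /jr; by rewrite ltnn.
rewrite dfwith_out 1?eq_sym // /klein /=; case: (ltnP k j) => kj'.
  have -> : k \in r = false by apply/negP => /jr; rewrite ltnNge ltnW.
  rewrite mulrC -scalerA; congr (_ *: _).
  case: (d j); rewrite /= ?expr0 ?endo1E ?scale1r // expr1.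
  exact/homogeneousP.
by [].
Qed.
End Slots.

(** * The RTT relation *)

Section SignedSwap.
Variable A : pzRingType.
Implicit Types (x y z w : A) (s t : bool).

Lemma signM s t x : (-1) ^+ s * ((-1) ^+ t * x) = (-1) ^+ (s (+) t) * x.
Proof. by rewrite mulrA signr_addb. Qed.

Lemma mul_sign x s y : x * ((-1) ^+ s * y) = (-1) ^+ s * (x * y).
Proof. by rewrite !mulrA commr_sign. Qed.

Lemma mul_swap x y z w s :
  y * z = (-1) ^+ s * (z * y) -> x * y * (z * w) = (-1) ^+ s * (x * z * (y * w)).
Proof.
move=> h; rewrite -mulrA [y * _]mulrA h -[_ * (z * y) * w]mulrA mul_sign.
by rewrite !mulrA.
Qed.

Lemma supercomm_mul (p p' q q' : A) s t :
  p * q - (-1) ^+ (s (+) t) * (p' * q')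
  = (p - (-1) ^+ s * p') * q + (-1) ^+ s * (p' * (q - (-1) ^+ t * q')).
Proof.
by rewrite mulrBl mulrBr mulrBr mul_sign signM -[_ * p' * q]mulrA addrA subrK.
Qed.
End SignedSwap.

Section RTT.
Variables (K : numFieldType) (W : lmodType K) (n : nat) (par : 'I_n -> bool).
Local Notation A := (endo W).
Implicit Types (T X Y : K -> 'M[A]_n).

Definition index_parity (a b : 'I_n) : bool := par a (+) par b.
Definition rtt_parity (a b c : 'I_n) : bool :=
  (par c && (par a (+) par b)) (+) (par a && par b).
Local Notation ip := index_parity.

(** The RTT relation with the rational R-matrix, cleared of denominators. *)
Definition rtt_rel T := forall u v a b c d,
  (u - v) *: (T u a b * T v c d - (-1) ^+ (ip a b && ip c d) * (T v c d * T u a b))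
  = (-1) ^+ rtt_parity a b c * (T u c b * T v a d - T v c b * T u a d).

Definition supercommuting X Y := forall u v a b c d,
  X u a b * Y v c d = (-1) ^+ (ip a b && ip c d) * (Y v c d * X u a b).

Lemma supercommuting_sym X Y : supercommuting X Y -> supercommuting Y X.
Proof. by move=> h u v a b c d; rewrite h andbC signM addbb mul1r. Qed.

(** The fusion principle.  Moving the Y's past the X's turns the commutator of
    two entries of X Y into a double sum over intermediate indices e, f, in
    which first the X's and then the Y's are exchanged by their own relations.
    The mixed terms A2 from the two exchanges cancel once e and f are
    renamed in one of them. *)
Lemma rtt_fuse X Y : rtt_rel X -> rtt_rel Y -> supercommuting X Y ->
  rtt_rel (fun u => X u * Y u).
Proof.
move=> hX hY hXY; have hYX := supercommuting_sym hXY.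
have mE Z Z' u a b : (Z u * Z' u : 'M[A]_n) a b
    = \sum_e Z u a e * Z' u e b by rewrite mxE.
move=> u v a b c d.
pose A1 e f := X u c e * X v a f * (Y u e b * Y v f d).
pose A2 e f := X v c e * X u a f * (Y u e b * Y v f d).
pose A3 e f := X v c e * X u a f * (Y v e b * Y u f d).
pose t1 e f := (ip e b && ip c f) (+) rtt_parity a e c.
pose t2 e f := (ip e b && ip c f) (+) (ip a e && ip c f) (+) rtt_parity e b f.
have termE e f :
    (u - v) *: (X u a e * Y u e b * (X v c f * Y v f d)
      - (-1) ^+ (ip a b && ip c d)
        * (X v c f * Y v f d * (X u a e * Y u e b)))
    = ((-1) ^+ t1 e f * A1 e f - (-1) ^+ t1 e f * A2 e f)
      + ((-1) ^+ t2 e f * A2 f e - (-1) ^+ t2 e f * A3 f e).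
  rewrite (mul_swap _ _ (hYX u v e b c f)) (mul_swap _ _ (hYX v u f d a e)) signM.
  have -> : (ip a b && ip c d) (+) (ip f d && ip a e)
      = (ip e b && ip c f) (+) ((ip a e && ip c f) (+) (ip e b && ip f d)).
    rewrite /ip; by case: (par a); case: (par b); case: (par c); case: (par d);
      case: (par e); case: (par f).
  rewrite -signM -mulrBr supercomm_mul endoZr scalerDr.
  rewrite [X in _ * (X + _)]endoZl hX [X in _ * (_ + X)]endoZr.
  rewrite [X in _ * (_ + _ * X)]endoZr hY.
  rewrite mulrDr -!mulrA !signM [X in _ + _ * X]mulrA mul_sign signM.
  by rewrite mulrBl !mulrBr /A1 /A2 /A3 /t1 /t2 -!mulrA.
rewrite !mE !big_distrlr /=.
transitivity (\sum_e \sum_f (u - v) *: (X u a e * Y u e b * (X v c f * Y v f d)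
  - (-1) ^+ (ip a b && ip c d) * (X v c f * Y v f d * (X u a e * Y u e b)))).
  under [RHS]eq_bigr do rewrite -scaler_sumr sumrB.
  rewrite -scaler_sumr sumrB; congr (_ *: (_ - _)).
  rewrite exchange_big mulr_sumr; apply: eq_bigr => e _.
  by rewrite mulr_sumr.
transitivity (\sum_e \sum_f
    (((-1) ^+ t1 e f * A1 e f - (-1) ^+ t1 e f * A2 e f)
     + ((-1) ^+ t2 f e * A2 e f - (-1) ^+ t2 f e * A3 e f))).
  under [RHS]eq_bigr do rewrite big_split.
  rewrite [RHS]big_split /= [X in _ = _ + X]exchange_big -big_split /=.
  apply: eq_bigr => e _; rewrite -big_split; apply: eq_bigr => f _.
  exact: termE.
rewrite mulrBr !mulr_sumr -sumrB; apply: eq_bigr => e _.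
rewrite !mulr_sumr -sumrB; apply: eq_bigr => f _ /=.
rewrite (mul_swap _ _ (hYX u v e b a f)) (mul_swap _ _ (hYX v u e b a f)) !signM.
rewrite -/(A1 e f) -/(A3 e f).
have -> : t2 f e = t1 e f.
  rewrite /t1 /t2 /rtt_parity /ip.
  by case: (par a); case: (par b); case: (par c); case: (par d);
      case: (par e); case: (par f).
have -> : rtt_parity a b c (+) (ip e b && ip a f) = t1 e f.
  rewrite /t1 /rtt_parity /ip.
  by case: (par a); case: (par b); case: (par c); case: (par d);
      case: (par e); case: (par f).
by rewrite addrA subrK.
Qed.

Lemma supercommuting_fuse X Y Z :
  supercommuting X Y -> supercommuting X Z ->
  supercommuting X (fun u => Y u * Z u).
Proof.
move=> hY hZ u v a b c d; rewrite mxE mulr_sumr mulr_suml mulr_sumr.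
apply: eq_bigr => e _; rewrite mulrA hY -!mulrA hZ mul_sign signM.
congr (_ ^+ _ * _); rewrite /ip.
by case: (par a); case: (par b); case: (par c); case: (par d); case: (par e).
Qed.

Lemma supercommuting1 X : supercommuting X (fun=> 1).
Proof.
move=> u v a b c d; rewrite mxE; case: eqP => [->|_] /=; last first.
  by rewrite mulr0 mul0r mulr0.
by rewrite /ip addbb andbF mulr1 !mul1r.
Qed.

Lemma rtt1 : rtt_rel (fun=> 1).
Proof.
move=> u v a b c d; rewrite !mxE subrr mulr0.
case: (eqVneq c d) => [->|_] /=; last by rewrite mulr0 mul0r mulr0 subrr scaler0.
by rewrite /ip addbb andbF mulr1 !mul1r subrr scaler0.
Qed.

Lemma supercommuting_prod (I : Type) (r : seq I) X (L : I -> K -> 'M[A]_n) :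
  (forall k, supercommuting X (L k)) ->
  supercommuting X (fun u => \prod_(k <- r) L k u).
Proof.
move=> h; elim: r => [|k r IH] u v a b c d.
  by rewrite big_nil; exact: (supercommuting1 X u v).
by rewrite big_cons; exact: (supercommuting_fuse (h k) IH u v).
Qed.

Lemma rtt_prod s (L : 'I_s -> K -> 'M[A]_n) :
  (forall k, rtt_rel (L k)) ->
  (forall k l : 'I_s, k != l -> supercommuting (L k) (L l)) ->
  rtt_rel (fun u => \prod_(k < s) L k u).
Proof.
elim: s L => [|s IH] L hL hLL.
  by move=> u v a b c d; rewrite !big_ord0; exact: (rtt1 u v).
move=> u v a b c d; rewrite !big_ord_recl.
have hR : rtt_rel (fun u => \prod_(i < s) L (lift ord0 i) u).
  by apply: IH => // k l kl; apply: hLL; rewrite (inj_eq lift_inj).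
have hC : supercommuting (L ord0) (fun u => \prod_(i < s) L (lift ord0 i) u).
  by apply: supercommuting_prod => k; apply: hLL; rewrite neq_lift.
exact: (rtt_fuse (hL ord0) hR hC).
Qed.

Definition gl_relations (E : 'I_n -> 'I_n -> A) := forall a b c d,
  E a b * E c d - (-1) ^+ (ip a b && ip c d) * (E c d * E a b)
  = (c == b)%:R * E a d - (-1) ^+ (ip a b && ip c d) * ((a == d)%:R * E c b).

(** The RTT matrix of an evaluation representation, multiplied by u. *)
Definition ev_matrix (E : 'I_n -> 'I_n -> A) (u : K) : 'M[A]_n :=
  \matrix_(a, b) (u *: ((a == b)%:R : A) + ((-1) ^+ par a * E a b : A)).

(** Both sides are polynomials in u and v.  The terms with a scalar entry
    cancel on the left, and what is left on both sides is u - v times the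
    relation of gl(M|N). *)
Lemma rtt_ev E : gl_relations E -> rtt_rel (ev_matrix E).
Proof.
move=> hE u v a b c d; rewrite !mxE.
have deltaC (x y : 'I_n) (f : A) w :
    f * (w *: ((x == y)%:R : A)) = w *: ((x == y)%:R : A) * f.
  by case: eqP => _; rewrite ?scaler0 ?mulr0 ?mul0r // -endoZr -endoZl mulr1 mul1r.
set S : A := (-1) ^+ (ip a b && ip c d).
set D1 := u *: ((a == b)%:R : A); set D2 := v *: ((c == d)%:R : A).
set P := _ * E a b; set Q := _ * E c d.
have hS1 f : S * (D1 * f) = D1 * f.
  rewrite /D1 /S; case: eqP => [->|_]; last by rewrite scaler0 mul0r mulr0.
  by rewrite /ip addbb expr0 mul1r.
have hS2 f : S * (D2 * f) = D2 * f.
  rewrite /D2 /S; case: eqP => [->|_]; last by rewrite scaler0 mul0r mulr0.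
  by rewrite /ip addbb andbF expr0 mul1r.
have -> : (D1 + P) * (D2 + Q) - S * ((D2 + Q) * (D1 + P)) = P * Q - S * (Q * P).
  rewrite !mulrDl !mulrDr ![P * _]deltaC ![Q * _]deltaC.
  rewrite -/D1 -/D2 !hS1 !hS2 [D2 * D1]deltaC -/D1.
  by zmod.
set d1 : A := (c == b)%:R; set d2 : A := (a == d)%:R.
set P' : A := _ * E a d; set Q' : A := _ * E c b.
have -> : (u *: d1 + Q') * (v *: d2 + P') - (v *: d1 + Q') * (u *: d2 + P')
    = (u - v) *: (d1 * P' - d2 * Q').
  have dd w w' : w *: d1 * (w' *: d2) = (w * w') *: (d1 * d2).
    by rewrite -endoZl -endoZr scalerA.
  have Qd w : Q' * (w *: d2) = w *: (d2 * Q') by rewrite deltaC -endoZl.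
  rewrite !mulrDl !mulrDr !dd !Qd -!(endoZl _ d1) (mulrC v u).
  rewrite scalerBl !scalerBr.
  by zmod.
rewrite -endoZr; congr (_ *: _).
have -> : P * Q - S * (Q * P) = (-1) ^+ (par a (+) par c)
    * (E a b * E c d - S * (E c d * E a b)).
  have -> : P * Q = (-1) ^+ (par a (+) par c) * (E a b * E c d).
    by rewrite /P /Q -mulrA mul_sign signM.
  have -> : Q * P = (-1) ^+ (par a (+) par c) * (E c d * E a b).
    by rewrite /P /Q -mulrA mul_sign signM addbC.
  by rewrite [RHS]mulrBr; congr (_ - _); rewrite /S !signM addbC.
rewrite hE !mulrBr /P' /Q' (mul_sign d1) (mul_sign d2) !signM; congr (_ - _).
  rewrite /d1; case: eqP => [->|_]; last by rewrite !mul0r !mulr0.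
  congr ((-1) ^+ _ * _); rewrite /rtt_parity.
  by case: (par a); case: (par b).
rewrite /S ?signM /d2; case: eqP => [->|_]; last by rewrite !mul0r !mulr0.
congr ((-1) ^+ _ * _); rewrite /rtt_parity /ip.
by case: (par b); case: (par c); case: (par d).
Qed.
End RTT.

(** * Coefficients of products of matrices *)

Section PolynomialCoefficients.
Variables (K : numFieldType) (V : lmodType K).

(** Evaluating at m distinct points gives a system with an invertible
    Vandermonde matrix. *)
Lemma poly_vector_eq0 m (a : 'I_m -> V) :
  (forall u : K, \sum_(i < m) u ^+ i *: a i = 0) -> forall i, a i = 0.
Proof.
move=> h l; pose x : 'rV[K]_m := \row_j j%:R.
have Mu : Vandermonde m x \in unitmx.
  rewrite unitmxE det_Vandermonde unitfE; apply/prodf_neq0 => i _.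
  apply/prodf_neq0 => j ij; rewrite !mxE subr_eq0 eqr_nat.
  by rewrite neq_ltn ij orbT.
have MV (i : 'I_m) :
    \sum_(j < m) (j%:R : K) ^+ i * invmx (Vandermonde m x) j l = (i == l)%:R.
  transitivity ((Vandermonde m x *m invmx (Vandermonde m x)) i l).
    rewrite mxE; apply: eq_bigr => j _; congr (_ * _).
    by rewrite /Vandermonde !mxE.
  by rewrite mulmxV // mxE.
have E : \sum_(j < m) invmx (Vandermonde m x) j l
    *: \sum_(i < m) (j%:R : K) ^+ i *: a i = a l.
  under eq_bigr do rewrite scaler_sumr.
  rewrite exchange_big /= (eq_bigr (fun i => (i == l)%:R *: a i)) => [|i _].
    rewrite (bigD1 l) //= eqxx scale1r big1 ?addr0 // => i /negbTE->.
    by rewrite scale0r.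
  rewrite -MV scaler_suml; apply: eq_bigr => j _.
  by rewrite scalerA mulrC.
by rewrite -E big1 // => j _; rewrite h scaler0.
Qed.

Lemma poly_vector2_eq0 m (a : 'I_m -> 'I_m -> V) :
  (forall u v : K, \sum_(i < m) \sum_(j < m) (u ^+ i * v ^+ j) *: a i j = 0) ->
  forall i j, a i j = 0.
Proof.
move=> h i; apply: poly_vector_eq0 => v; move: i; apply: poly_vector_eq0 => u.
rewrite -[RHS](h u v); apply: eq_bigr => i _; rewrite scaler_sumr.
by apply: eq_bigr => j _; rewrite scalerA.
Qed.
End PolynomialCoefficients.

Section Paths.
Variables (K : numFieldType) (W : lmodType K) (n : nat).
Local Notation A := (endo W).

Lemma prod_mx_paths s (L : 'I_s -> 'M[A]_n) a b :
  (\prod_k L k) a b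
  = \sum_(i : {ffun 'I_s.+1 -> 'I_n} | (i ord0 == a) && (i ord_max == b))
      \prod_k L k (i (widen_ord (leqnSn s) k)) (i (lift ord0 k)).
Proof.
elim: s L a => [|s IH] L a.
  rewrite big_ord0 mxE; under eq_bigr do rewrite big_ord0.
  have E (i : {ffun 'I_1 -> 'I_n}) : i = [ffun=> i ord0].
    by apply/ffunP => k; rewrite ffunE ord1.
  have M : ord_max = ord0 :> 'I_1 by apply: val_inj.
  case: (eqVneq a b) => [<-|nab].
    rewrite (big_pred1 [ffun=> a]) // => i; rewrite M andbb.
    by apply/eqP/eqP => [<-|->]; rewrite -?E // ffunE.
  rewrite big_pred0 // => i; rewrite M; apply/negP => /andP[/eqP-> /eqP ab].
  by rewrite ab eqxx in nab.
rewrite big_ord_recl mxE.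
pose cons (j : {ffun 'I_s.+1 -> 'I_n}) : {ffun 'I_s.+2 -> 'I_n} :=
  [ffun k => if unlift ord0 k is Some k' then j k' else a].
pose tail (i : {ffun 'I_s.+2 -> 'I_n}) : {ffun 'I_s.+1 -> 'I_n} :=
  [ffun k => i (lift ord0 k)].
have cons0 j : cons j ord0 = a by rewrite ffunE unlift_none.
have consS j k : cons j (lift ord0 k) = j k by rewrite ffunE liftK.
rewrite [RHS](reindex_onto cons tail); last first.
  move=> i /andP[/eqP i0 _]; apply/ffunP => k; rewrite ffunE.
  by case: unliftP => [k' ->|->]; rewrite ?ffunE.
rewrite (eq_bigl (fun j : {ffun 'I_s.+1 -> 'I_n} => j ord_max == b)); last first.
  move=> j; rewrite cons0 eqxx /= (_ : ord_max = lift ord0 ord_max) ?consS.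
    by rewrite (_ : tail _ = j) ?eqxx ?andbT //; apply/ffunP => k; rewrite ffunE.
  exact: val_inj.
rewrite (partition_big (fun j : {ffun 'I_s.+1 -> 'I_n} => j ord0) xpredT) //=.
apply: eq_bigr => e _; rewrite IH mulr_sumr.
apply: eq_big => [j|j /andP[/eqP j0 _]]; first by rewrite andbC.
rewrite big_ord_recl (_ : widen_ord _ ord0 = ord0); last exact: val_inj.
rewrite cons0 consS j0; congr (_ * _); apply: eq_bigr => k _.
rewrite (_ : widen_ord _ (lift ord0 k) = lift ord0 (widen_ord (leqnSn s) k)).
  by rewrite !consS.
exact: val_inj.
Qed.

Lemma prod_scale (I : Type) (r : seq I) (c : I -> K) (x : I -> A) :
  \prod_(i <- r) (c i *: x i) = (\prod_(i <- r) c i) *: \prod_(i <- r) x i.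
Proof.
elim: r => [|i r IH]; first by rewrite !big_nil scale1r.
by rewrite !big_cons IH -endoZl -endoZr scalerA.
Qed.

(** The coefficient of u^(s - r) in the product of the matrices
    u G_k(false) + G_k(true): the r factors with f k contribute G_k(true). *)
Definition path_coef s (G : 'I_s -> bool -> 'M[A]_n) (r : nat) : 'M[A]_n :=
  \matrix_(a, b)
   \sum_(f : {ffun 'I_s -> bool} | (\sum_k f k == r)%N)
   \sum_(i : {ffun 'I_s.+1 -> 'I_n} | (i ord0 == a) && (i ord_max == b))
     \prod_k G k (f k) (i (widen_ord (leqnSn s) k)) (i (lift ord0 k)).

Lemma prod_mx_coef s (G : 'I_s -> bool -> 'M[A]_n) (u : K) a b :
  (\prod_k (\matrix_(x, y) (u *: G k false x y + G k true x y)) : 'M[A]_n) a b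
  = \sum_(r < s.+1) u ^+ (s - r) *: path_coef G r a b.
Proof.
have EL k x y : ((\matrix_(x, y) (u *: G k false x y + G k true x y)) : 'M[A]_n) x y
   = \sum_(c : bool) u ^+ (~~ c) *: G k c x y.
  by rewrite mxE big_bool /= expr0 expr1 scale1r addrC.
rewrite prod_mx_paths.
transitivity (\sum_(f : {ffun 'I_s -> bool}) u ^+ (s - \sum_k f k) *:
    \sum_(i : {ffun 'I_s.+1 -> 'I_n} | (i ord0 == a) && (i ord_max == b))
     \prod_k G k (f k) (i (widen_ord (leqnSn s) k)) (i (lift ord0 k))).
  under [RHS]eq_bigr do rewrite scaler_sumr.
  rewrite [RHS]exchange_big; apply: eq_bigr => i _ /=.
  under eq_bigr do rewrite EL.
  rewrite bigA_distr_bigA /=; apply: eq_bigr => f _.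
  rewrite prod_scale; congr (_ *: _); rewrite prodrXr; congr (_ ^+ _).
  rewrite -[X in (X - _)%N]card_ord -sum1_card -sumnB => [|k _]; last by case: (f k).
  by apply: eq_bigr => k _; case: (f k).
have fs (f : {ffun 'I_s -> bool}) : (\sum_k f k < s.+1)%N.
  rewrite ltnS -[X in (_ <= X)%N]card_ord -sum1_card; apply: leq_sum => k _.
  by case: (f k).
rewrite (partition_big (fun f : {ffun 'I_s -> bool} => Ordinal (fs f)) xpredT) //=.
apply: eq_bigr => r _; rewrite mxE scaler_sumr; apply: eq_big => f.
  by rewrite -val_eqE.
by move=> /eqP <-.
Qed.

Lemma path_coef_gt s (G : 'I_s -> bool -> 'M[A]_n) r a b :
  (s < r)%N -> path_coef G r a b = 0.
Proof.
move=> sr; rewrite mxE big_pred0 // => f; apply/negbTE; rewrite neq_ltn.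
apply/orP; left; apply: leq_ltn_trans sr.
rewrite -[X in (_ <= X)%N]card_ord -sum1_card; apply: leq_sum => k _.
by case: (f k).
Qed.

Lemma path_coef0 s (G : 'I_s -> bool -> 'M[A]_n) :
  (forall k, G k false = 1) -> path_coef G 0 = 1.
Proof.
move=> hG; apply/matrixP => a b; rewrite mxE (big_pred1 [ffun=> false]).
  transitivity ((\prod_(k < s) (1 : 'M[A]_n)) a b); last by rewrite big1.
  rewrite prod_mx_paths; apply: eq_bigr => i _; apply: eq_bigr => k _.
  by rewrite ffunE hG.
move=> f; rewrite sum_nat_eq0; apply/forallP/eqP => [h|-> k]; last by rewrite ffunE.
by apply/ffunP => k; rewrite ffunE; move: (h k); case: (f k).
Qed.

End Paths.

(** * From the RTT relation to the Yangian relations *)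

Lemma oppr_self_eq0 (K : numFieldType) (V : lmodType K) (x : V) : x = - x -> x = 0.
Proof.
move=> /eqP; rewrite -subr_eq0 opprK => /eqP h.
by rewrite -[x]half2 h scaler0.
Qed.

Section RttCoefficients.
Variables (K : numFieldType) (W : lmodType K) (n : nat) (par : 'I_n -> bool).
Local Notation A := (endo W).
Variables (s : nat) (t : nat -> 'M[A]_n).
Hypothesis t0 : t 0 = 1.
Hypothesis t_gt : forall r a b, (s < r)%N -> t r a b = 0.
Let T (u : K) : 'M[A]_n := \matrix_(a, b) \sum_(r < s.+1) u ^+ (s - r) *: t r a b.
Hypothesis hT : rtt_rel par T.

Local Notation ip := (index_parity par).

Let C m k a b c d : A :=
  t m a b * t k c d - (-1) ^+ (ip a b && ip c d) * (t k c d * t m a b).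
Let D m k a b c d : A :=
  (-1) ^+ rtt_parity par a b c * (t m c b * t k a d - t k c b * t m a d).

Let shift (V : lmodType K) (F : nat -> V) (u : K) : F 0%N = 0 -> F s.+1 = 0 ->
  \sum_(m < s.+1) u ^+ (s - m) *: F m.+1
  = u *: \sum_(m < s.+1) u ^+ (s - m) *: F m.
Proof.
move=> F0 Fs; rewrite scaler_sumr big_ord_recr [RHS]big_ord_recl /=.
rewrite Fs F0 !scaler0 addr0 add0r; apply: eq_bigr => i _.
by rewrite scalerA -exprS subnSK.
Qed.

Let CE m k a b c d : (s < m)%N || (s < k)%N -> C m k a b c d = 0.
Proof.
by rewrite /C; case/orP => h; rewrite !(t_gt _ _ h) ?mul0r ?mulr0 ?mul0r ?mulr0 subrr.
Qed.

Let C0 k a b c d : C 0 k a b c d = 0.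
Proof.
rewrite /C t0 mxE; case: eqP => [->|_]; last by rewrite mul0r !mulr0 subrr.
by rewrite /index_parity addbb mulr1 !mul1r subrr.
Qed.

Let C_0 m a b c d : C m 0 a b c d = 0.
Proof.
rewrite /C t0 mxE; case: eqP => [->|_]; last by rewrite mulr0 mul0r mulr0 subrr.
by rewrite /index_parity addbb andbF mulr1 !mul1r subrr.
Qed.

Let TT (u v : K) a b c d : T u a b * T v c d
  = \sum_(m < s.+1) \sum_(k < s.+1) (u ^+ (s - m) * v ^+ (s - k)) *: (t m a b * t k c d).
Proof.
rewrite !mxE big_distrlr /=; apply: eq_bigr => i _; apply: eq_bigr => j _.
by rewrite -endoZl -endoZr scalerA.
Qed.

(* Comparing the coefficients of u^(s - m) v^(s - k). *)
Let rtt_coef m k a b c d : C m.+1 k a b c d - C m k.+1 a b c d = D m k a b c d.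
Proof.
have [hm|hm] := ltnP s m.
  have hm1 : (s < m.+1)%N by exact: leqW.
  by rewrite !CE ?hm ?hm1 // /D !(t_gt _ _ hm) mulr0 mul0r subrr mulr0 ?subr0.
have [hk|hk] := ltnP s k.
  have hk1 : (s < k.+1)%N by exact: leqW.
  by rewrite !CE ?hk ?hk1 ?orbT // /D !(t_gt _ _ hk) mulr0 mul0r subrr mulr0 ?subr0.
pose X m k := C m.+1 k a b c d - C m k.+1 a b c d - D m k a b c d.
suff H : forall i j : 'I_s.+1, X (s - i)%N (s - j)%N = 0.
  have := H (inord (s - m)) (inord (s - k)).
  rewrite !inordK ?ltnS ?leq_subr // !subKn // => /eqP.
  by rewrite subr_eq0 => /eqP.
apply: poly_vector2_eq0 => u v.
transitivity (\sum_(m < s.+1) \sum_(k < s.+1) (u ^+ (s - m) * v ^+ (s - k)) *: X m k).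
  rewrite (reindex_inj rev_ord_inj); apply: eq_bigr => i _.
  rewrite (reindex_inj rev_ord_inj); apply: eq_bigr => j _ /=.
  by rewrite !subSS !subKn // -ltnS.
have hTuv := hT u v a b c d; rewrite !TT in hTuv.
have E1 : \sum_(m < s.+1) \sum_(k < s.+1) (u ^+ (s - m) * v ^+ (s - k)) *: C m k a b c d
  = \sum_(m < s.+1) \sum_(k < s.+1) (u ^+ (s - m) * v ^+ (s - k)) *: (t m a b * t k c d)
    - (-1) ^+ (ip a b && ip c d) * \sum_(m < s.+1) \sum_(k < s.+1)
       (v ^+ (s - m) * u ^+ (s - k)) *: (t m c d * t k a b).
  rewrite [X in _ - _ * X]exchange_big mulr_sumr -sumrB; apply: eq_bigr => i _.
  rewrite mulr_sumr -sumrB; apply: eq_bigr => j _ /=.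
  by rewrite /C scalerBr -endoZr [v ^+ _ * _]mulrC.
have E2 : \sum_(m < s.+1) \sum_(k < s.+1) (u ^+ (s - m) * v ^+ (s - k)) *: D m k a b c d
  = (-1) ^+ rtt_parity par a b c
   * (\sum_(m < s.+1) \sum_(k < s.+1) (u ^+ (s - m) * v ^+ (s - k)) *: (t m c b * t k a d)
    - \sum_(m < s.+1) \sum_(k < s.+1) (v ^+ (s - m) * u ^+ (s - k)) *: (t m c b * t k a d)).
  rewrite [X in _ * (_ - X)]exchange_big -sumrB mulr_sumr; apply: eq_bigr => i _.
  rewrite -sumrB mulr_sumr; apply: eq_bigr => j _ /=.
  by rewrite /D [v ^+ _ * _]mulrC -scalerBr -endoZr.
rewrite -E1 -E2 in hTuv.
transitivity
  (\sum_(m < s.+1) \sum_(k < s.+1) (u ^+ (s - m) * v ^+ (s - k)) *: C m.+1 k a b c d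
   - \sum_(m < s.+1) \sum_(k < s.+1) (u ^+ (s - m) * v ^+ (s - k)) *: C m k.+1 a b c d
   - \sum_(m < s.+1) \sum_(k < s.+1) (u ^+ (s - m) * v ^+ (s - k)) *: D m k a b c d).
  rewrite -!sumrB; apply: eq_bigr => i _; rewrite -!sumrB.
  by apply: eq_bigr => j _; rewrite -!scalerBr.
rewrite -hTuv; apply/eqP; rewrite subr_eq0 scalerBl; apply/eqP.
congr (_ - _).
  pose F m := \sum_(k < s.+1) v ^+ (s - k) *: C m k a b c d.
  have FE w (i : 'I_s.+1) : w *: F i
      = \sum_(j < s.+1) (w * v ^+ (s - j)) *: C i j a b c d.
    by rewrite scaler_sumr; apply: eq_bigr => j _; rewrite scalerA.
  transitivity (\sum_(i < s.+1) u ^+ (s - i) *: F i.+1).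
    apply: eq_bigr => i _; rewrite scaler_sumr.
    by apply: eq_bigr => j _; rewrite scalerA.
  rewrite shift; first by congr (_ *: _); apply: eq_bigr => i _; rewrite FE.
  - by apply: big1 => j _; rewrite C0 scaler0.
  - by apply: big1 => j _; rewrite CE ?ltnSn // scaler0.
rewrite scaler_sumr; apply: eq_bigr => i _.
pose F k := C i k a b c d.
transitivity (u ^+ (s - i) *: \sum_(j < s.+1) v ^+ (s - j) *: F j.+1).
  by rewrite scaler_sumr; apply: eq_bigr => j _; rewrite scalerA.
rewrite shift; [|exact: C_0|by rewrite /F CE ?ltnSn ?orbT].
rewrite scalerA mulrC -scalerA; congr (_ *: _); rewrite scaler_sumr.
by apply: eq_bigr => j _; rewrite scalerA.
Qed.

(** The coefficients of the RTT relation give the recursion [rtt_coef], which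
    lowers m and raises k.  Followed down to m = 0 it yields a sum over r < m.
    If k < m, the terms with k <= r < m cancel, because r |-> m + k - 1 - r
    permutes them and changes their sign. *)
Lemma rtt_closed_form m k a b c d :
  t m a b * t k c d - (-1) ^+ (ip a b && ip c d) * (t k c d * t m a b)
  = (-1) ^+ rtt_parity par a b c * \sum_(0 <= r < minn m k)
      (t r c b * t (m + k - 1 - r) a d - t (m + k - 1 - r) c b * t r a d).
Proof.
have step1 : forall k, C m k a b c d = \sum_(0 <= r < m) D r (m + k - 1 - r) a b c d.
  elim: m => [|m' IH] k'; first by rewrite big_geq // C0.
  have /eqP := rtt_coef m' k' a b c d; rewrite subr_eq => /eqP ->.
  rewrite IH big_nat_recr //= addrC.
  rewrite (_ : m'.+1 + k' - 1 - m' = k')%N; last by lia.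
  congr (_ + _); apply: eq_bigr => r _.
  by rewrite (_ : m' + k'.+1 - 1 - r = m'.+1 + k' - 1 - r)%N //; lia.
rewrite -/(C m k a b c d) step1 mulr_sumr.
have [mk|km] := leqP m k; first by [].
rewrite (big_cat_nat (n := k)) //=; last exact: ltnW.
rewrite [X in _ + X](_ : _ = 0) ?addr0 //; apply: oppr_self_eq0.
rewrite {1}big_nat_rev /= -sumrN big_nat_cond [RHS]big_nat_cond.
apply: eq_bigr => r /andP[/andP[kr rm] _].
have -> : (m + k - 1 - (k + m - r.+1) = r)%N by lia.
have -> : (k + m - r.+1 = m + k - 1 - r)%N by lia.
by rewrite /D -[RHS]mulrN opprB.
Qed.

(** From the coefficients t^{ab}_(r) of the RTT matrix back to the generators
    T^{ab}_(r). *)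
Definition yang_op (r : nat) (a b : 'I_n) : A :=
  if r is 0 then t 0 a b else (-1) ^+ par a * t r a b.

(** The two terms that are linear in the generators are the summand r = 0 of
    [rtt_closed_form], where t_0 = 1. *)
Lemma yang_op_rel m k a b c d : (0 < m)%N -> (0 < k)%N ->
  yang_op m a b * yang_op k c d
  - (-1) ^+ (ip a b && ip c d) * (yang_op k c d * yang_op m a b)
  = (c == b)%:R * yang_op (m + k - 1) a d
    - (-1) ^+ (ip a b && ip c d) * ((a == d)%:R * yang_op (m + k - 1) c b)
    + (-1) ^+ rtt_parity par a b c * \sum_(1 <= r < minn m k)
        (yang_op r c b * yang_op (m + k - 1 - r) a d
         - yang_op (m + k - 1 - r) c b * yang_op r a d).
Proof.
have yE r x y : (0 < r)%N -> yang_op r x y = (-1) ^+ par x * t r x y by case: r.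
have yM r r' x y x' y' : (0 < r)%N -> (0 < r')%N ->
    yang_op r x y * yang_op r' x' y'
    = (-1) ^+ (par x (+) par x') * (t r x y * t r' x' y').
  by move=> r0 r0'; rewrite !yE // -mulrA mul_sign signM.
move=> m0 k0; have mk0 : (0 < m + k - 1)%N by lia.
rewrite !yM // [par c (+) _]addbC.
rewrite [X in _ - X](mul_sign ((-1) ^+ (ip a b && ip c d))) -mulrBr.
rewrite rtt_closed_form big_ltn ?leq_min ?m0 // subn0 t0.
rewrite !mulrDr; congr (_ + _); last first.
  rewrite signM addbC -signM; congr (_ * _); rewrite mulr_sumr.
  rewrite big_nat_cond [RHS]big_nat_cond; apply: eq_bigr => r /andP[/andP[r1]].
  rewrite leq_min => /andP[rm rk] _.
  by rewrite !yM // ?mulrBr 1?[par c (+) _]addbC //; lia.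
rewrite !mxE !mulrN !yE //; congr (_ - _).
  case: eqP => [->|_]; last by rewrite !mul0r !mulr0.
  rewrite !mul1r signM; congr ((-1) ^+ _ * _); rewrite /rtt_parity.
  by case: (par a); case: (par b).
case: eqP => [->|_]; last by rewrite !mul0r !mulr0.
rewrite mulr1 mul1r !signM; congr ((-1) ^+ _ * _); rewrite /rtt_parity /index_parity.
by case: (par b); case: (par c); case: (par d).
Qed.
End RttCoefficients.

(** * Tensor products of evaluation representations *)

Section MatrixParity.
Variables (K : numFieldType) (W : lmodType K) (n : nat) (par : 'I_n -> bool).
Variable P : endo W.
Local Notation A := (endo W).
Local Notation ip := (index_parity par).

Lemma odd_byM d e (x y : A) :
  odd_by P d x -> odd_by P e y -> odd_by P (d (+) e) (x * y).
Proof.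
rewrite /odd_by => hx hy.
by rewrite mulrA hx -!mulrA hy mul_sign signM.
Qed.

Lemma odd_by_sum (I : Type) (r : seq I) (Q : pred I) d (F : I -> A) :
  (forall i, Q i -> odd_by P d (F i)) -> odd_by P d (\sum_(i <- r | Q i) F i).
Proof.
move=> h; rewrite /odd_by mulr_sumr mulr_suml mulr_sumr.
by apply: eq_bigr => i /h.
Qed.

Lemma odd_byZ d c (x : A) : odd_by P d x -> odd_by P d (c *: x).
Proof. by rewrite /odd_by -endoZr => ->; rewrite -endoZl -endoZr. Qed.

Lemma odd_by_sign d (b : bool) (x : A) : odd_by P d x -> odd_by P d ((-1) ^+ b * x).
Proof. by rewrite /odd_by mul_sign => ->; rewrite -mulrA !signM addbC. Qed.

Lemma odd_by_delta a b : odd_by P (ip a b) (a == b)%:R.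
Proof.
rewrite /odd_by; case: eqP => [->|_]; last by rewrite mulr0 mul0r mulr0.
by rewrite /index_parity addbb mulr1 !mul1r.
Qed.

Lemma odd_by_prod_mx s (L : 'I_s -> 'M[A]_n) :
  (forall k a b, odd_by P (ip a b) (L k a b)) ->
  forall a b, odd_by P (ip a b) ((\prod_k L k) a b).
Proof.
move=> hL; elim/big_ind: _ => // [a b|X Y hX hY a b].
  by rewrite mxE; apply: odd_by_delta.
rewrite mxE; apply: odd_by_sum => e _.
rewrite (_ : ip a b = ip a e (+) ip e b); first exact: odd_byM.
by rewrite /index_parity; case: (par a); case: (par b); case: (par e).
Qed.

Lemma odd_by_coef s (t : nat -> A) d :
  (forall u : K, odd_by P d (\sum_(r < s.+1) u ^+ (s - r) *: t r)) ->
  forall r, (r <= s)%N -> odd_by P d (t r).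
Proof.
move=> h r rs.
suff H (i : 'I_s.+1) : P * t (s - i)%N - (-1) ^+ d * (t (s - i)%N * P) = 0.
  have /eqP := H (inord (s - r)).
  by rewrite inordK ?ltnS ?leq_subr // subKn // subr_eq0 => /eqP.
move: i; apply: poly_vector_eq0 => u.
have := h u; rewrite /odd_by mulr_sumr mulr_suml mulr_sumr => /eqP.
rewrite -subr_eq0 -sumrB => /eqP E0; rewrite -[RHS]E0.
rewrite (reindex_inj rev_ord_inj); apply: eq_bigr => i _ /=.
have hi : (i <= s)%N by rewrite -ltnS.
rewrite subSS (subKn hi) scalerBr [X in X - _]endoZr; congr (_ - _).
by rewrite endoZr endoZl.
Qed.

Lemma supercommuting_ev (E E' : 'I_n -> 'I_n -> A) :
  (forall a b c d, E a b * E' c d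
     = (-1) ^+ (ip a b && ip c d) * (E' c d * E a b)) ->
  supercommuting par (ev_matrix par E) (ev_matrix par E').
Proof.
move=> h u v a b c d; rewrite !mxE.
have deltaC (x y : 'I_n) (f : A) w :
    f * (w *: ((x == y)%:R : A)) = w *: ((x == y)%:R : A) * f.
  by case: eqP => _; rewrite ?scaler0 ?mulr0 ?mul0r // -endoZr -endoZl mulr1 mul1r.
set S : A := (-1) ^+ (ip a b && ip c d).
set D1 := u *: ((a == b)%:R : A); set D2 := v *: ((c == d)%:R : A).
set X := _ * E a b; set Y := _ * E' c d.
have hS1 f : S * (D1 * f) = D1 * f.
  rewrite /D1 /S; case: eqP => [->|_]; last by rewrite scaler0 mul0r mulr0.
  by rewrite /index_parity addbb expr0 mul1r.
have hS2 f : S * (D2 * f) = D2 * f.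
  rewrite /D2 /S; case: eqP => [->|_]; last by rewrite scaler0 mul0r mulr0.
  by rewrite /index_parity addbb andbF expr0 mul1r.
have XY : X * Y = S * (Y * X).
  rewrite /X /Y -!mulrA (mul_sign (E a b)) (mul_sign (E' c d)) h /S !signM.
  by congr ((-1) ^+ _ * _); case: (par a); case: (par c); case: (_ && _).
rewrite !mulrDl !mulrDr ![X * _]deltaC ![Y * _]deltaC -/D1 -/D2.
by rewrite !hS1 !hS2 XY [D2 * D1]deltaC -/D1; zmod.
Qed.

End MatrixParity.

Section TensorRep.
Variables (K : numFieldType) (M N p : nat) (hp : (0 < p)%N).
Variable pi : 'I_p -> gl_rep K M N.
Local Notation par := (@par M N).
Local Notation ip := (index_parity par).
Local Notation V := (fun k => gl_space (pi k)).
Variables (W : lmodType K) (tau : (forall k, V k) -> W).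
Hypothesis tauP : is_tensor_product tau.
Variable tmap : (forall k, endo (V k)) -> endo W.
Hypothesis tmapE : forall B v, tmap B (tau v) = tau (fun k => B k (v k)).
Local Notation A := (endo W).

Let Pi k a b : endo (V k) := mkendo (gl_E (pi k) a b).
Let E k a b : A := slot tmap (ip a b) (Pi k a b).

Let s_sign k d (n : nat) (X : endo (V k)) := slot_sign tauP tmapE d n X.
Let s_N k d (X : endo (V k)) := slotN tauP tmapE d X.
Let s_D k d (X Y : endo (V k)) := slotD tauP tmapE d X Y.
Let s_0 k d := slot0 tauP tmapE k d.
Let s_1 k := slot1 tauP tmapE k.

Let Pi_odd k a b : odd_by (parity_op (V k)) (ip a b) (Pi k a b).
Proof. exact/has_parityP/gl_E_parity. Qed.

Let E_gl k : gl_relations par (E k).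
Proof.
move=> a b c d; rewrite /E !(slotM tauP tmapE) [ip c d (+) _]addbC -s_sign.
have R : Pi k a b * Pi k c d - (-1) ^+ (ip a b && ip c d) * (Pi k c d * Pi k a b)
  = (c == b)%:R * Pi k a d - (-1) ^+ (ip a b && ip c d) * ((a == d)%:R * Pi k c b).
  apply: endoP => v; rewrite !endoBE !endo_signE !endo_natE.
  exact: gl_E_rel.
rewrite -s_N -s_D R s_D s_N s_sign; congr (_ - _ * _).
  case: eqP => [->|_]; last by rewrite !mul0r s_0.
  rewrite !mul1r; congr (slot tmap _ _); rewrite /index_parity.
  by case: (par a); case: (par b); case: (par d).
case: eqP => [->|_]; last by rewrite !mul0r s_0.
rewrite !mul1r; congr (slot tmap _ _); rewrite /index_parity.
by case: (par c); case: (par b); case: (par d).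
Qed.

Let G k (c : bool) : 'M[A]_(M + N) :=
  if c then \matrix_(a, b) ((-1) ^+ par a * E k a b) else 1.
Let L k (u : K) := ev_matrix par (E k) u.
Let t r := path_coef G r.

Let LG k u : L k u = \matrix_(a, b) (u *: G k false a b + G k true a b).
Proof. by apply/matrixP => a b; rewrite !mxE. Qed.

Let tE u a b : (\prod_k L k u) a b = \sum_(r < p.+1) u ^+ (p - r) *: t r a b.
Proof.
rewrite -prod_mx_coef; congr (fun_of_matrix _ a b).
by apply: eq_bigr => k _; rewrite LG.
Qed.

Let hT : rtt_rel par (fun u => \matrix_(a, b) \sum_(r < p.+1) u ^+ (p - r) *: t r a b).
Proof.
have H : rtt_rel par (fun u => \prod_k L k u).
  apply: rtt_prod => [k|k l kl]; first exact: rtt_ev.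
  apply: supercommuting_ev => a b c d; rewrite /E.
  by rewrite (slot_comm tauP tmapE kl (Pi_odd _ _ _) (Pi_odd _ _ _)).
by move=> u v a b c d; rewrite !mxE -!tE; apply: H.
Qed.

Let t0 : t 0 = 1. Proof. exact: path_coef0. Qed.
Let t_gt r a b : (p < r)%N -> t r a b = 0. Proof. exact: path_coef_gt. Qed.

Let PW := tensor_parity tmap.
Let Wsp : superspace K := superspace_of (tensor_parityK tauP tmapE).
Let YT r a b : {linear Wsp -> Wsp} := (yang_op par t r a b : endo W).

Let t_odd r a b : odd_by PW (ip a b) (t r a b).
Proof.
have [rp|pr] := leqP r p; last by rewrite t_gt // /odd_by mulr0 mul0r mulr0.
apply: (@odd_by_coef _ _ _ p (fun r => t r a b)) rp => u.
rewrite -tE; apply: odd_by_prod_mx => k x y; rewrite mxE.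
rewrite /odd_by mulrDr mulrDl mulrDr; congr (_ + _).
  exact/odd_byZ/odd_by_delta.
by apply/odd_by_sign/(slot_odd_by tauP tmapE)/Pi_odd.
Qed.

Let YT_parity r a b : (0 < r)%N -> has_parity (par a (+) par b) (YT r a b).
Proof.
case: r => // r _; apply/has_parityP; rewrite parity_superspace_of.
exact/odd_by_sign/t_odd.
Qed.

Let YT0 a b v : YT 0 a b v = (a == b)%:R *: v.
Proof.
rewrite /YT /= t0 mxE; case: eqP => _; by rewrite ?scale1r ?scale0r.
Qed.

Let YT_rel m k a b c d v : (0 < m)%N -> (0 < k)%N ->
  supercomm (par a (+) par b) (par c (+) par d) (YT m a b) (YT k c d) v
    = (c == b)%:R *: YT (m + k - 1) a d v
      - (-1) ^+ ((par a (+) par b) && (par c (+) par d))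
          *: ((a == d)%:R *: YT (m + k - 1) c b v)
      + (-1) ^+ ((par c && (par a (+) par b)) (+) (par a && par b))
          *: \sum_(1 <= r < minn m k)
               (YT r c b (YT (m + k - 1 - r) a d v)
                - YT (m + k - 1 - r) c b (YT r a d v)).
Proof.
move=> m0 k0; have R := yang_op_rel t0 t_gt hT a b c d m0 k0.
have := congr1 (fun f : endo W => f v) R.
rewrite [LHS]endoBE [RHS]endoDE [X in _ = X + _]endoBE.
rewrite !endo_signE !endo_natE endo_sumE => Rv.
exact: Rv.
Qed.

Let YT_trunc r a b v : (p < r)%N -> YT r a b v = 0.
Proof.
by case: r => // r pr; rewrite /YT /yang_op t_gt // mulr0.
Qed.

Let WY : yangian_rep K M N := YangianRep YT0 YT_parity YT_rel.

Definition tensor_rep : W_rep K M N p := @WRep K M N p WY YT_trunc.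

Let g k (c : bool) x y : endo (V k) :=
  if c then (-1) ^+ par x * Pi k x y else (x == y)%:R.

Let G_slot k c x y : G k c x y = slot tmap (ip x y) (g k c x y).
Proof.
rewrite /G /g; case: c; rewrite mxE; first by rewrite s_sign.
case: eqP => [->|_]; last by rewrite s_0.
by rewrite /index_parity addbb s_1.
Qed.

Let rtt_g k (c : bool) x y v : rtt (V := ev (pi k) hp) c x y v = g k c x y v.
Proof.
rewrite /rtt /g; case: c; first by rewrite [RHS]endo_signE.
by rewrite eqxx scale1r /=; case: eqP => _; rewrite ?scale1r ?scale0r.
Qed.

Let rtt_t r a b v : rtt (V := WY) r a b v = t r a b v.
Proof.
rewrite /rtt; case: r => [|r]; first by rewrite eqxx scale1r.
rewrite -[LHS]/((-1) ^+ par a *: (((-1) ^+ par a * t r.+1 a b : A) v)).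
by rewrite endo_signE scalerA -expr2 sqrr_sign scale1r.
Qed.

Lemma tensor_rep_parity v (e : 'I_p -> bool) :
  (forall k, homogeneous (e k) (v k)) ->
  homogeneous (V := tensor_rep) (\big[addb/false]_k e k) (tau v).
Proof.
move=> he; apply/homogeneousP; rewrite parity_superspace_of.
exact: tensor_parityE.
Qed.

(** A generator of degree at least 2 acts by 0 on an evaluation representation,
    so among the compositions of r only those into parts 0 and 1 contribute;
    they are the choices f of r factors in [path_coef]. *)
Lemma tensor_rep_spec : is_tensor_rep (fun k => ev (pi k) hp) tensor_rep.
Proof.
exists tau; split => // [v e he|v e he r a b]; first exact: tensor_rep_parity.
rewrite [LHS]rtt_t /t mxE endo_sumE.
pose F (rs : 'I_p -> nat) : W :=
  \sum_(i : {ffun 'I_p.+1 -> 'I_(M + N)} | (i ord0 == a) && (i ord_max == b))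
    koszul_sign K (fun k => par (i (widen_ord (leqnSn p) k))
                            (+) par (i (lift ord0 k))) e
     *: tau (fun k => rtt (V := ev (pi k) hp) (rs k)
          (i (widen_ord (leqnSn p) k)) (i (lift ord0 k)) (v k)).
rewrite (eq_bigr (fun f : {ffun 'I_p -> bool} => F (fun k => f k))); last first.
  move=> f _; rewrite endo_sumE; apply: eq_bigr => i _.
  under eq_bigr do rewrite G_slot.
  rewrite (slot_prod_apply tauP tmapE _ _ he); congr (_ *: tau _).
  by apply/functional_extensionality_dep => k; rewrite rtt_g.
rewrite [RHS](_ : _ = \sum_(rs : {ffun 'I_p -> 'I_r.+1} | (\sum_(k < p) rs k)%N == r) F (fun k => rs k)) //.
rewrite [RHS](bigID (fun rs : {ffun 'I_p -> 'I_r.+1} => [forall k, (rs k <= 1)%N])) /=.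
rewrite [X in _ = _ + X]big1 ?addr0; last first.
  move=> rs /andP[_ /forallPn[k]]; rewrite -ltnNge => rk.
  rewrite /F big1 // => i _; rewrite -[tau _](_ : 0 = _) ?scaler0 //.
  by apply/esym/(tensor_eq0 tauP (k := k)); rewrite /rtt /= ev_T_ge2 // scaler0.
pose h (f : {ffun 'I_p -> bool}) : {ffun 'I_p -> 'I_r.+1} := [ffun k => inord (f k)].
pose h' (rs : {ffun 'I_p -> 'I_r.+1}) : {ffun 'I_p -> bool} := [ffun k => (0 < rs k)%N].
have hh (rs : {ffun 'I_p -> 'I_r.+1}) : [forall k, (rs k <= 1)%N] -> h (h' rs) = rs.
  move=> /forallP rs1; apply/ffunP => k; apply: val_inj; rewrite /h !ffunE /=.
  rewrite inordK; first by move: (rs1 k); case: (nat_of_ord (rs k)) => [|[]].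
  by apply: leq_trans (ltn_ord (rs k)); rewrite ltnS; case: (nat_of_ord (rs k)).
rewrite [RHS](reindex_onto h h'); last by move=> rs /andP[_ /hh].
have hf (f : {ffun 'I_p -> bool}) k : (\sum_k f k == r)%N -> (h f k = f k :> nat).
  move=> /eqP fr; rewrite ffunE inordK // ltnS -[X in (_ <= X)%N]fr (bigD1 k) //=.
  exact: leq_addr.
apply: eq_big => [f|f fr]; last first.
  by congr F; apply/functional_extensionality_dep => k; rewrite hf.
apply/idP/idP => [fr|].
  have -> : [forall k, (h f k <= 1)%N] by apply/forallP => k; rewrite hf //; case: (f k).
  rewrite andbT; apply/andP; split.
    by rewrite -[X in _ == X](eqP fr); apply/eqP/eq_bigr => k _; rewrite hf.
  by apply/eqP/ffunP => k; rewrite ffunE hf //; case: (f k).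
move=> /andP[/andP[/eqP sr _] /eqP hf']; apply/eqP; rewrite -[RHS]sr.
apply: eq_bigr => k _; rewrite -[f in LHS]hf' ffunE.
have : (h f k <= 1)%N.
  by rewrite ffunE /inord val_insubd; case: ifP => //; case: (f k).
by case: (nat_of_ord (h f k)) => [|[]].
Qed.

Section HighestWeight.
Variables (v : forall k, V k) (e : 'I_p -> bool) (mu : 'I_p -> 'I_(M + N) -> K).
Hypothesis he : forall k, homogeneous (e k) (v k).
Hypothesis hv : forall k (a b : 'I_(M + N)), (a < b)%N -> gl_E (pi k) a b (v k) = 0.
Hypothesis hmu : forall k a, gl_E (pi k) a a (v k) = mu k a *: v k.

Let step k (u : K) x y : endo (V k) := u *: g k false x y + g k true x y.

Let L_step u a b : (\prod_k L k u) a b (tau v)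
  = \sum_(i : {ffun 'I_p.+1 -> 'I_(M + N)} | (i ord0 == a) && (i ord_max == b))
    koszul_sign K (fun k => ip (i (widen_ord (leqnSn p) k)) (i (lift ord0 k))) e
     *: tau (fun k => step k u (i (widen_ord (leqnSn p) k)) (i (lift ord0 k)) (v k)).
Proof.
rewrite prod_mx_paths endo_sumE; apply: eq_bigr => i _.
rewrite -(slot_prod_apply tauP tmapE _ _ he); congr (endo_fun _ (tau v)).
apply: eq_bigr => k _; rewrite LG mxE !G_slot /step.
by rewrite -(slotZ tauP tmapE) -s_D.
Qed.

Let step_up k u (x y : 'I_(M + N)) : (x < y)%N -> step k u x y (v k) = 0.
Proof.
move=> xy; rewrite /step /g (_ : (x == y) = false).
  by rewrite scaler0 add0r endo_signE [X in _ *: X]hv // scaler0.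
by apply/eqP => xyE; move: xy; rewrite xyE ltnn.
Qed.

Let step_flat k u a :
  step k u a a (v k) = (u + (-1) ^+ par a * mu k a) *: v k.
Proof.
rewrite /step /g eqxx endoDE endoZE endo1E endo_signE.
by rewrite -[Pi _ _ _ _]/(gl_E (pi k) a a (v k)) hmu scalerDl scalerA.
Qed.

Let no_rise (i : {ffun 'I_p.+1 -> 'I_(M + N)}) :
  (forall k, i (lift ord0 k) <= i (widen_ord (leqnSn p) k))%N ->
  forall x y : 'I_p.+1, (x <= y)%N -> (i y <= i x)%N.
Proof.
move=> h x [y yp] /=; elim: y yp => [|y IH] yp.
  by rewrite leqn0 => /eqP x0; rewrite (_ : Ordinal yp = x) //; apply: val_inj.
rewrite leq_eqVlt => /orP[/eqP xy|xy].
  by rewrite (_ : Ordinal yp = x) //; apply: val_inj.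
have yp' : (y < p)%N by [].
have := h (Ordinal yp').
rewrite (_ : lift ord0 _ = Ordinal yp); last exact: val_inj.
rewrite (_ : widen_ord _ _ = Ordinal (ltnW yp)); last exact: val_inj.
move=> /leq_trans; apply; exact: IH.
Qed.

Let path_up u (i : {ffun 'I_p.+1 -> 'I_(M + N)}) :
  tau (fun k => step k u (i (widen_ord (leqnSn p) k)) (i (lift ord0 k)) (v k)) != 0 ->
  forall x y : 'I_p.+1, (x <= y)%N -> (i y <= i x)%N.
Proof.
move=> n0; apply: no_rise => k; rewrite leqNgt; apply: contra n0 => up.
by apply/eqP/(tensor_eq0 tauP (k := k)); rewrite step_up.
Qed.

Let prod_up u (a b : 'I_(M + N)) : (a < b)%N -> (\prod_k L k u) a b (tau v) = 0.
Proof.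
move=> ab; rewrite L_step big1 // => i /andP[/eqP ia /eqP ib].
set T := tau _; have [->|Tn0] := eqVneq T 0; first by rewrite scaler0.
have := path_up Tn0 (leq0n _ : (ord0 <= ord_max)%N).
by rewrite ia ib leqNgt ab.
Qed.

Let prod_flat u a :
  (\prod_k L k u) a a (tau v) = (\prod_k (u + (-1) ^+ par a * mu k a)) *: tau v.
Proof.
rewrite L_step (bigD1 [ffun=> a]) ?ffunE ?eqxx //= [X in _ + X]big1 ?addr0.
  rewrite (_ : koszul_sign _ _ _ = 1).
    rewrite scale1r -(tensor_scale tauP); congr tau; apply/functional_extensionality_dep => k.
    rewrite !ffunE; exact: step_flat.
  rewrite /koszul_sign big1 // => k _; rewrite big1 // => l _.
  by rewrite !ffunE /index_parity addbb.
move=> i /andP[/andP[/eqP i0 /eqP i1] /eqP ni].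
set T := tau _; have [->|Tn0] := eqVneq T 0; first by rewrite scaler0.
case: ni; apply/ffunP => k; rewrite ffunE; apply/val_inj/eqP.
rewrite eqn_leq; apply/andP; split.
  by rewrite -[X in (_ <= val X)%N]i0; exact: (path_up Tn0 (leq0n k : (ord0 <= k)%N)).
by rewrite -[X in (val X <= _)%N]i1; apply: (path_up Tn0); rewrite -ltnS.
Qed.

Let t_eq (x : nat -> W) a b :
  (forall u, (\prod_k L k u) a b (tau v) = \sum_(r < p.+1) u ^+ (p - r) *: x r) ->
  forall r, (r <= p)%N -> t r a b (tau v) = x r.
Proof.
move=> h r rp.
suff H (i : 'I_p.+1) : t (p - i)%N a b (tau v) - x (p - i)%N = 0.
  have /eqP := H (inord (p - r)).
  by rewrite inordK ?ltnS ?leq_subr // subKn // subr_eq0 => /eqP.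
move: i; apply: poly_vector_eq0 => u.
have := h u; rewrite tE endo_sumE => /eqP.
rewrite -subr_eq0 -sumrB => /eqP E0; rewrite -[RHS]E0.
rewrite (reindex_inj rev_ord_inj); apply: eq_bigr => i _ /=.
have hi : (i <= p)%N by rewrite -ltnS.
by rewrite subSS (subKn hi) scalerBr.
Qed.

(** In the expansion over index paths each ascending step applies a raising
    operator to a highest weight vector.  So only weakly decreasing paths
    contribute, and none of these leads from a to b > a. *)
Lemma tensor_rep_up r (a b : 'I_(M + N)) :
  (0 < r)%N -> (a < b)%N -> Y_T tensor_rep r a b (tau v) = 0.
Proof.
move=> r0 ab; have [rp|pr] := leqP r p; last exact: YT_trunc.
case: r r0 rp => // r _ rp; rewrite [LHS]endo_signE.
rewrite (t_eq (x := fun _ => 0)) ?scaler0 // => u.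
by rewrite prod_up // big1 // => i _; rewrite scaler0.
Qed.

(** Between equal ends the only weakly decreasing path is the constant one, on
    which every factor acts by a scalar and no sign occurs. *)
Lemma tensor_rep_weight (c : nat -> K) r a :
  (forall u : K, \prod_k (u + (-1) ^+ par a * mu k a)
             = \sum_(i < p.+1) u ^+ (p - i) * c i) ->
  (0 < r <= p)%N -> Y_T tensor_rep r a a (tau v) = ((-1) ^+ par a * c r) *: tau v.
Proof.
move=> hc /andP[]; case: r => // r _ rp; rewrite [LHS]endo_signE.
rewrite (t_eq (x := fun i => c i *: tau v)) ?scalerA // => u.
rewrite prod_flat hc scaler_suml; apply: eq_bigr => i _; by rewrite scalerA.
Qed.

End HighestWeight.

End TensorRep.

(** * Graded commutators *)

Lemma mul_nat (A : pzRingType) (x y : A) n : x * (n%:R * y) = n%:R * (x * y).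
Proof. by rewrite !mulr_natl mulrnAr. Qed.

Lemma mul_nat_sign (A : pzRingType) (b : bool) n (y : A) :
  (-1) ^+ b * (n%:R * y) = n%:R * ((-1) ^+ b * y).
Proof. exact: mul_nat. Qed.

Section Brackets.
Variables (K : numFieldType) (W : lmodType K).
Local Notation A := (endo W).
Implicit Types (x y z : A) (i j l s : bool).

Definition br s x y : A := x * y - (-1) ^+ s * (y * x).

Lemma brDl s x y z : br s (x + y) z = br s x z + br s y z.
Proof. by rewrite /br mulrDl !mulrDr; zmod. Qed.
Lemma brDr s x y z : br s x (y + z) = br s x y + br s x z.
Proof. by rewrite /br mulrDl !mulrDr; zmod. Qed.
Lemma br_suml s (I : Type) (r : seq I) (Q : pred I) (F : I -> A) z :
  br s (\sum_(i <- r | Q i) F i) z = \sum_(i <- r | Q i) br s (F i) z.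
Proof. by rewrite /br mulr_suml !mulr_sumr -sumrB. Qed.
Lemma br_sumr s (I : Type) (r : seq I) (Q : pred I) (F : I -> A) z :
  br s z (\sum_(i <- r | Q i) F i) = \sum_(i <- r | Q i) br s z (F i).
Proof. by rewrite /br mulr_suml !mulr_sumr -sumrB. Qed.
Lemma br_sym s x y : br s x y = - ((-1) ^+ s * br s y x).
Proof. by rewrite /br mulrBr signM addbb mul1r opprB. Qed.
Lemma brMl i j l x y z : br ((i (+) j) && l) (x * y) z
  = x * br (j && l) y z + (-1) ^+ (j && l) * (br (i && l) x z * y).
Proof.
rewrite /br mulrBl !mulrBr mul_sign !mulrA -!signr_addb.
by case: i; case: j; case: l; rewrite /= ?mulrA; zmod.
Qed.
Lemma brMr i j l x y z : br (i && (j (+) l)) x (y * z)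
  = br (i && j) x y * z + (-1) ^+ (i && j) * (y * br (i && l) x z).
Proof.
rewrite /br mulrBl !mulrBr mul_sign !mulrA -!signr_addb.
by case: i; case: j; case: l; rewrite /= ?mulrA; zmod.
Qed.
Lemma brE s x y : br s x y = 0 -> x * y = (-1) ^+ s * (y * x).
Proof. by move=> /eqP; rewrite subr_eq0 => /eqP. Qed.
Lemma br_eq0 s x y : x * y = (-1) ^+ s * (y * x) -> br s x y = 0.
Proof. by move=> h; rewrite /br h subrr. Qed.

Lemma brNr s y z : br s y (- z) = - br s y z.
Proof. by rewrite /br mulrN mulNr mulrN; zmod. Qed.
Lemma br_signr s (t : bool) y z :
  br s y ((-1) ^+ t * z) = (-1) ^+ t * br s y z.
Proof. by rewrite /br mul_sign mulrBr -[_ * z * y]mulrA !signM addbC. Qed.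

Definition gcomm i y j z := y * z = (-1) ^+ (i && j) * (z * y).

Lemma gcommM i y j l x z : gcomm i y j x -> gcomm i y l z ->
  gcomm i y (j (+) l) (x * z).
Proof.
rewrite /gcomm => hx hz; rewrite mulrA hx -!mulrA hz mul_sign signM.
by congr ((-1) ^+ _ * _); case: (i); case: (j); case: (l).
Qed.
Lemma gcomm_sum i y (I : Type) (r : seq I) (Q : pred I) j (F : I -> A) :
  (forall k, Q k -> gcomm i y j (F k)) ->
  gcomm i y j (\sum_(k <- r | Q k) F k).
Proof.
move=> h; rewrite /gcomm mulr_sumr mulr_suml mulr_sumr.
by apply: eq_bigr => k /h.
Qed.
Lemma gcommD i y j x z : gcomm i y j x -> gcomm i y j z -> gcomm i y j (x + z).
Proof. by rewrite /gcomm => hx hz; rewrite mulrDr mulrDl mulrDr hx hz. Qed.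
Lemma gcomm_sign i y j (b : bool) x : gcomm i y j x ->
  gcomm i y j ((-1) ^+ b * x).
Proof. by rewrite /gcomm mul_sign => ->; rewrite -mulrA !signM addbC. Qed.
Lemma gcommN i y j x : gcomm i y j x -> gcomm i y j (- x).
Proof. by move=> h; have := gcomm_sign true h; rewrite expr1 mulN1r. Qed.
Lemma gcomm0 i y j : gcomm i y j 0.
Proof. by rewrite /gcomm mulr0 mul0r mulr0. Qed.
Lemma gcomm_scalar i y (c : K) : gcomm i y false (c *: (1 : endo W)).
Proof. by rewrite /gcomm andbF expr0 mul1r -endoZr -endoZl mulr1 mul1r. Qed.
Lemma gcomm1 i y : gcomm i y false 1.
Proof. by rewrite -[1]scale1r; apply: gcomm_scalar. Qed.
Lemma gcomm_br i y j z : gcomm i y j z -> br (i && j) y z = 0.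
Proof. exact: br_eq0. Qed.
Lemma gcomm_sym i y j z : gcomm i y j z -> gcomm j z i y.
Proof. by rewrite /gcomm => ->; rewrite signM andbC addbb mul1r. Qed.
End Brackets.

(** * One step of the Dyson realization *)

Section DysonStep.
Variables (K : numFieldType) (W : lmodType K) (n : nat) (par : 'I_n -> bool).
Local Notation A := (endo W).
Local Notation ip := (index_parity par).
Variables (k : 'I_n) (x d : 'I_n -> A) (E : 'I_n -> 'I_n -> A) (c0 : K).
Local Notation q := (ip k).
Hypothesis xx : forall b c : 'I_n, (k < b)%N -> (k < c)%N -> gcomm (q b) (x b) (q c) (x c).
Hypothesis dd : forall b c : 'I_n, (k < b)%N -> (k < c)%N -> gcomm (q b) (d b) (q c) (d c).
Hypothesis dx : forall b c : 'I_n, (k < b)%N -> (k < c)%N ->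
  br (q b && q c) (d b) (x c) = (b == c)%:R.
Hypothesis Ex : forall a b c : 'I_n, (k < a)%N -> (k < b)%N -> (k < c)%N ->
  gcomm (q c) (x c) (ip a b) (E a b).
Hypothesis Ed : forall a b c : 'I_n, (k < a)%N -> (k < b)%N -> (k < c)%N ->
  gcomm (q c) (d c) (ip a b) (E a b).
Hypothesis EE : forall a b c e : 'I_n,
  (k < a)%N -> (k < b)%N -> (k < c)%N -> (k < e)%N ->
  br (ip a b && ip c e) (E a b) (E c e)
  = (c == b)%:R * E a e - (-1) ^+ (ip a b && ip c e) * ((a == e)%:R * E c b).

(** Let E realize the E^{ab} with a, b > k, and let x_b, d_b for b > k be
    coordinates and derivations that commute with E in the graded sense.  The
    Dyson realization for a, b >= k is that of the induced module on the affine
    chart x_k = 1 of projective superspace: x_a d_b, where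
    d_k = c0 - sum_e x_e d_e comes from Euler's relation in degree c0, plus a
    term in which E acts on the fibre, with p_{eb} the matrix of the vectors b
    modulo the point (1, x) of the chart. *)
Definition dy_x a : A := if a == k then 1 else x a.
Definition dy_d b : A :=
  if b == k then c0 *: (1 : A) - \sum_(e : 'I_n | (k < e)%N) x e * d e else d b.
Definition dy_p e b : A :=
  if b == k then - ((-1) ^+ q e * x e) else (e == b)%:R.
Definition dy_F a b : A :=
  if a == k then 0 else \sum_(e : 'I_n | (k < e)%N) E a e * dy_p e b.
Definition dyson a b : A := dy_x a * dy_d b + dy_F a b.

Local Notation X := dy_x.
Local Notation D := dy_d.
Local Notation P := dy_p.
Local Notation F := dy_F.

Lemma qk : q k = false. Proof. by rewrite /index_parity addbb. Qed.
Lemma ip_q a b : ip a b = q a (+) q b.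
Proof. by rewrite /index_parity; case: (par a); case: (par b); case: (par k). Qed.

Variant geq_spec (b : 'I_n) : bool -> Prop :=
  | GeqEq of b = k : geq_spec b true
  | GeqLt of (k < b)%N : geq_spec b false.
Lemma geqP (b : 'I_n) : (k <= b)%N -> geq_spec b (b == k).
Proof.
rewrite leq_eqVlt => /orP[/eqP kb|kb].
  by have <- : k = b; [apply: val_inj|rewrite eqxx; constructor].
have /negbTE-> : b != k by rewrite neq_ltn kb orbT.
by constructor.
Qed.

Lemma gt_neq (b : 'I_n) : (k < b)%N -> (b == k) = false.
Proof. by move=> kb; apply/negbTE; rewrite neq_ltn kb orbT. Qed.

Lemma dy_d_gt (b : 'I_n) : (k < b)%N -> D b = d b.
Proof. by move=> kb; rewrite /D gt_neq. Qed.

Lemma dy_x_gt (b : 'I_n) : (k < b)%N -> X b = x b.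
Proof. by move=> kb; rewrite /X gt_neq. Qed.

Lemma sum_delta (Q : pred 'I_n) (G : 'I_n -> A) c : Q c ->
  \sum_(e : 'I_n | Q e) (c == e)%:R * G e = G c.
Proof.
move=> Qc; rewrite (bigD1 c) //= eqxx mul1r big1 ?addr0 // => e /andP[_ /negbTE ec].
by rewrite eq_sym ec mul0r.
Qed.

(** What commutes with x, d and E commutes with the new operators: this keeps
    the oscillators that are used in the next step independent of them. *)
Lemma dy_gcomm i y :
  (forall b : 'I_n, (k < b)%N -> gcomm i y (q b) (x b)) ->
  (forall b : 'I_n, (k < b)%N -> gcomm i y (q b) (d b)) ->
  (forall a b : 'I_n, (k < a)%N -> (k < b)%N -> gcomm i y (ip a b) (E a b)) ->
  forall a b : 'I_n, (k <= a)%N -> (k <= b)%N -> gcomm i y (ip a b) (dyson a b).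
Proof.
move=> hx hd hE a b ka kb; apply: gcommD.
  rewrite ip_q; apply: gcommM.
    by rewrite /X; case: (geqP ka) => [->|ka']; [rewrite qk; apply: gcomm1|apply: hx].
  rewrite /D; case: (geqP kb) => [->|kb']; last exact: hd.
  rewrite qk; apply: gcommD; first exact: gcomm_scalar.
  apply/gcommN/gcomm_sum => e ke; rewrite -(addbb (q e)).
  by apply: gcommM; [apply: hx|apply: hd].
rewrite /F; case: (geqP ka) => [_|ka']; first exact: gcomm0.
apply: gcomm_sum => e ke; rewrite (_ : ip a b = ip a e (+) ip e b).
  apply: gcommM; first exact: hE.
  rewrite /P; case: (geqP kb) => [->|kb'].
    by apply/gcommN/gcomm_sign; rewrite /index_parity addbC; apply: hx.
  case: eqP => [->|_]; last exact: gcomm0.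
  by rewrite /index_parity addbb; apply: gcomm1.
by rewrite /index_parity; case: (par a); case: (par b); case: (par e).
Qed.

Lemma dy_xx (a c : 'I_n) : (k <= a)%N -> (k <= c)%N -> gcomm (q a) (X a) (q c) (X c).
Proof.
move=> ka kc; rewrite /X; case: (geqP ka) => [->|ka'].
  by rewrite qk /gcomm mulr1 !mul1r.
case: (geqP kc) => [->|kc']; last exact: xx.
by rewrite qk /gcomm andbF mulr1 !mul1r.
Qed.

Lemma dy_dx (b c : 'I_n) : (k <= b)%N -> (k <= c)%N ->
  br (q b && q c) (D b) (X c) = (b == c)%:R - (b == k)%:R * X c.
Proof.
move=> kb kc; rewrite /X /D; case: (geqP kb) => [->|kb']; last first.
  rewrite mul0r subr0; case: (geqP kc) => [->|kc']; last exact: dx.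
  rewrite qk andbF /br mulr1 !mul1r subrr [b == k](_ : _ = false) //.
  by apply/negbTE; rewrite neq_ltn kb' orbT.
rewrite qk mul1r /=; case: (geqP kc) => [->|kc'].
  by rewrite eqxx subrr /br mulr1 !mul1r subrr.
rewrite (_ : (k == c) = false) ?sub0r; last first.
  by apply/negbTE; rewrite neq_ltn kc'.
rewrite brDl (gcomm_br (i := false) (j := q c)); last first.
  exact/gcomm_sym/gcomm_scalar.
rewrite add0r -sumrN br_suml.
transitivity (- \sum_(e : 'I_n | (k < e)%N) (c == e)%:R * x e); last by rewrite sum_delta.
rewrite -sumrN; apply: eq_bigr => e ke.
have := brMl (q e) (q e) (q c) (x e) (d e) (x c).
rewrite addbb /= => h; have -> : br false (- (x e * d e)) (x c)
    = - br false (x e * d e) (x c) by rewrite /br mulNr mulrN mulrN; zmod.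
rewrite h dx // (gcomm_br (xx ke kc')) mul0r mulr0 addr0 eq_sym.
by congr (- _); case: eqP => _; rewrite ?mulr1 ?mul1r ?mulr0 ?mul0r.
Qed.

Lemma dy_dd (b e : 'I_n) : (k <= b)%N -> (k <= e)%N ->
  br (q b && q e) (D b) (D e) = (b == k)%:R * D e - (e == k)%:R * D b.
Proof.
have H (c : 'I_n) : (k < c)%N -> br false (D k) (d c) = d c.
  move=> kc; rewrite /D eqxx brDl (gcomm_br (i := false) (j := q c)); last first.
    exact/gcomm_sym/gcomm_scalar.
  rewrite add0r -sumrN br_suml.
  rewrite -[RHS](sum_delta (Q := fun e : 'I_n => (k < e)%N)) //.
  apply: eq_bigr => f kf.
  have := brMl (q f) (q f) (q c) (x f) (d f) (d c).
  rewrite addbb /= => h; have -> : br false (- (x f * d f)) (d c)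
    = - br false (x f * d f) (d c) by rewrite /br mulNr mulrN mulrN; zmod.
  rewrite h (gcomm_br (dd kf kc)) mulr0 add0r br_sym andbC dx //.
  rewrite mulNr mulrN opprK mulrA signM addbb mul1r.
  by [].
move=> kb ke; case: (geqP kb) => [-> {b kb}|kb']; case: (geqP ke) => [-> {e ke}|ke'].
- by rewrite qk /br !mul1r !subrr.
- by rewrite qk /= mul1r mul0r subr0 (dy_d_gt ke') H.
- by rewrite qk andbF mul0r mul1r sub0r br_sym expr0 mul1r (dy_d_gt kb') H.
- rewrite !mul0r subrr; apply/gcomm_br; rewrite (dy_d_gt kb') (dy_d_gt ke').
  exact: dd.
Qed.

Lemma dy_DD (a b c e : 'I_n) :
  (k <= a)%N -> (k <= b)%N -> (k <= c)%N -> (k <= e)%N ->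
  br (ip a b && ip c e) (X a * D b) (X c * D e)
  = (c == b)%:R * (X a * D e)
    - (-1) ^+ (ip a b && ip c e) * ((a == e)%:R * (X c * D b)).
Proof.
move=> ka kb kc ke; rewrite (ip_q a b) (ip_q c e) brMl.
rewrite (brMr (q b)) (brMr (q a)) (gcomm_br (dy_xx ka kc)) mul0r add0r.
rewrite dy_dd // dy_dx // [br (q a && q e) _ _]br_sym [q a && q e]andbC dy_dx //.
rewrite -[_ * (X c * - _) * D b]mulrA.
have XX : X c * X a = (-1) ^+ (q c && q a) * (X a * X c) := dy_xx kc ka.
have -> : X c * - ((-1) ^+ (q e && q a) * ((e == a)%:R - (e == k)%:R * X a)) * D b
    = - ((-1) ^+ (q e && q a) * ((e == a)%:R * (X c * D b)
         - (e == k)%:R * ((-1) ^+ (q c && q a) * (X a * (X c * D b))))).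
  rewrite mulrN mulNr mul_sign -mulrA mulrBr mulrBl; congr (- (_ * (_ - _))).
    by case: (e == a); rewrite ?mulr1 ?mul1r ?mulr0 ?mul0r.
  case: (e == k); rewrite ?mul1r ?mul0r ?mulr0 ?mul0r //.
  by rewrite XX -!mulrA.
rewrite [c == b]eq_sym [a == e]eq_sym.
case: (geqP kb) => [->|kb']; case: (geqP ke) => [->|ke']; rewrite ?qk.
all: move: (X a) (X c) (D k) (D b) (D e) => xa xc Dk Db De.
all: move: (q a) (q b) (q c) (q e) => qa qb qc qe.
all: rewrite ?mul0r ?mul1r ?subr0 ?sub0r ?mulr0 ?addbF ?subrr ?mulr0 ?addr0.
all: rewrite ?(mulrBr xa) ?(mulrDr xa) ?mulrBl ?(mulrBr xa) ?(mulrDr xa).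
all: rewrite ?(mul_sign xa) ?mulrN ?mulrBr ?signM ?(mul_nat xa).
- by rewrite [qc && qa]andbC addbb expr0 mul1r; zmod.
- have -> : (qa && qc) (+) (qe && qa) = qa && (qc (+) qe).
    by case: qa; case: qe; case: qc.
  by zmod.
- have -> : (qb && qc) (+) (qa && qc) = (qa (+) qb) && qc.
    by case: qa; case: qb; case: qc.
  have -> : ((qa (+) qb) && qc) (+) (qc && qa) = qb && qc.
    by case: qa; case: qb; case: qc.
  by zmod.
- have -> : (qb && (qc (+) qe)) (+) (qa && qc) (+) (qe && qa)
      = (qa (+) qb) && (qc (+) qe).
    by case: qa; case: qb; case: qc; case: qe.
  by [].
Qed.

Lemma dy_p_gcomm i y : (forall b : 'I_n, (k < b)%N -> gcomm i y (q b) (x b)) ->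
  forall e b : 'I_n, (k < e)%N -> (k <= b)%N -> gcomm i y (ip e b) (P e b).
Proof.
move=> hx e b ke kb; rewrite /P; case: (geqP kb) => [->|kb'].
  by apply/gcommN/gcomm_sign; rewrite /index_parity addbC; apply: hx.
case: eqP => [->|_]; last exact: gcomm0.
by rewrite /index_parity addbb; apply: gcomm1.
Qed.

Lemma dy_pp (e b f c : 'I_n) :
  (k < e)%N -> (k <= b)%N -> (k < f)%N -> (k <= c)%N ->
  gcomm (ip e b) (P e b) (ip f c) (P f c).
Proof.
move=> ke kb kf kc; apply: dy_p_gcomm => // g kg; apply: gcomm_sym.
by apply: dy_p_gcomm => // h kh; apply: xx.
Qed.

Lemma dy_Ep (a b f c : 'I_n) :
  (k < a)%N -> (k < b)%N -> (k < f)%N -> (k <= c)%N ->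
  gcomm (ip a b) (E a b) (ip f c) (P f c).
Proof.
move=> ka kb kf kc; apply: dy_p_gcomm => // g kg; apply: gcomm_sym.
exact: Ex.
Qed.

Lemma dy_Xp (a f c : 'I_n) : (k <= a)%N -> (k < f)%N -> (k <= c)%N ->
  gcomm (q a) (X a) (ip f c) (P f c).
Proof.
move=> ka kf kc; apply: dy_p_gcomm => // g kg.
by rewrite -(dy_x_gt kg); apply: dy_xx => //; apply: ltnW.
Qed.

Lemma dy_dp (b e c : 'I_n) : (k <= b)%N -> (k < e)%N -> (k <= c)%N ->
  br (q b && ip e c) (D b) (P e c)
  = - ((c == k)%:R * ((-1) ^+ q e * ((b == e)%:R - (b == k)%:R * x e))).
Proof.
move=> kb ke kc; rewrite /P; case: (geqP kc) => [->|kc'].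
  rewrite mul1r brNr br_signr (_ : ip e k = q e); last by rewrite /index_parity addbC.
  by rewrite -(dy_x_gt ke) dy_dx // ltnW.
rewrite mul0r oppr0; case: eqP => [->|_].
  by rewrite /index_parity addbb andbF /br mulr1 !mul1r subrr.
by rewrite /br mulr0 mul0r mulr0 subrr.
Qed.

Lemma dy_DDp (a b e c : 'I_n) :
  (k <= a)%N -> (k <= b)%N -> (k < e)%N -> (k <= c)%N ->
  br (ip a b && ip e c) (X a * D b) (P e c)
  = - ((c == k)%:R * ((-1) ^+ q e * (X a * ((b == e)%:R - (b == k)%:R * x e)))).
Proof.
move=> ka kb ke kc; rewrite (ip_q a b) brMl (gcomm_br (dy_Xp ka ke kc)).
rewrite mul0r mulr0 addr0 dy_dp // mulrN; congr (- _).
by rewrite mul_nat (mul_sign (X a)).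
Qed.

Lemma dy_DDE (a b c e : 'I_n) :
  (k <= a)%N -> (k <= b)%N -> (k < c)%N -> (k < e)%N ->
  gcomm (ip a b) (X a * D b) (ip c e) (E c e).
Proof.
move=> ka kb kc ke; apply/gcomm_sym; rewrite (ip_q a b); apply: gcommM.
  rewrite /X; case: (geqP ka) => [->|ka']; last exact/gcomm_sym/Ex.
  by rewrite qk; apply: gcomm1.
rewrite /D; case: (geqP kb) => [->|kb']; last exact/gcomm_sym/Ed.
rewrite qk; apply: gcommD; first exact: gcomm_scalar.
apply/gcommN/gcomm_sum => f kf; rewrite -(addbb (q f)).
by apply: gcommM; apply/gcomm_sym; [apply: Ex|apply: Ed].
Qed.

Lemma dy_DF (a b c e : 'I_n) :
  (k <= a)%N -> (k <= b)%N -> (k <= c)%N -> (k <= e)%N ->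
  br (ip a b && ip c e) (X a * D b) (F c e)
  = - ((e == k)%:R * ((-1) ^+ ((ip a b && ip c b) (+) q b) * (F c b * X a))).
Proof.
move=> ka kb kc ke; rewrite /F; case: (geqP kc) => [->|kc'].
  by rewrite mul0r !mulr0 oppr0 /br mulr0 mul0r mulr0 subrr.
rewrite br_sumr mulr_suml !mulr_sumr -sumrN; apply: eq_bigr => f kf.
rewrite (_ : ip c e = ip c f (+) ip f e); last first.
  by rewrite /index_parity; case: (par c); case: (par f); case: (par e).
rewrite brMr (gcomm_br (dy_DDE ka kb kc' kf)) mul0r add0r dy_DDp //.
rewrite mulrN mulrN (mul_nat (E c f)) mul_nat; congr (- (_ * _)).
rewrite (mul_sign (E c f)) signM /P; case: (geqP kb) => [->|kb'].
  have -> : (k == f) = false by rewrite eq_sym gt_neq.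
  rewrite mul1r sub0r -[_ * _ * X a]mulrA mulNr -[_ * x f * X a]mulrA !mulrN.
  rewrite (mul_sign (E c f)) signM.
  have -> : X a * x f = (-1) ^+ (q a && q f) * (x f * X a).
    by rewrite -(dy_x_gt kf); apply: dy_xx => //; apply: ltnW.
  rewrite (mul_sign (E c f)) signM; congr (- (_ ^+ _ * _)).
  by rewrite /index_parity; case: (par a); case: (par k); case: (par c); case: (par f).
rewrite mul0r subr0 [f == b]eq_sym; case: eqP => [->|_].
  by rewrite !mulr1 ?mul1r; congr (_ ^+ _ * _); rewrite addbC.
by rewrite ?mulr0 ?mul0r ?mulr0 ?mul0r ?mulr0.
Qed.

Lemma ip_trans a b c : ip a b (+) ip b c = ip a c.
Proof. by rewrite /index_parity; case: (par a); case: (par b); case: (par c). Qed.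

Lemma dy_FF (a b c e : 'I_n) :
  (k < a)%N -> (k <= b)%N -> (k < c)%N -> (k <= e)%N ->
  br (ip a b && ip c e) (F a b) (F c e)
  = (-1) ^+ (ip c b && ip c e) * (F a e * P c b)
    - (-1) ^+ (ip a b && ip a c) * (F c b * P a e).
Proof.
move=> ka kb kc ke; rewrite /F !gt_neq // br_suml.
have term (f g : 'I_n) : (k < f)%N -> (k < g)%N ->
    br (ip a b && ip c e) (E a f * P f b) (E c g * P g e)
    = (c == f)%:R * ((-1) ^+ (ip f b && ip c g) * (E a g * (P f b * P g e)))
      - (a == g)%:R * ((-1) ^+ (ip a b && ip c g) * (E c f * (P f b * P g e))).
  move=> kf kg; rewrite /br.
  rewrite (mul_swap _ _ (gcomm_sym (dy_Ep kc kg kf kb))).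
  rewrite (mul_swap _ _ (gcomm_sym (dy_Ep ka kf kg ke))).
  rewrite (dy_pp kg ke kf kb) (mul_sign (E c g * E a f)) !signM.
  have -> : (ip a b && ip c e) (+) (ip g e && ip a f) (+) (ip g e && ip f b)
      = (ip f b && ip c g) (+) (ip a f && ip c g).
    rewrite -(ip_trans a f b) -(ip_trans c g e).
    by case: (ip a f); case: (ip f b); case: (ip c g); case: (ip g e).
  rewrite -[X in _ - X]signM -mulrBr [X in _ * (_ - X)]mulrA -mulrBl.
  rewrite -/(br (ip a f && ip c g) (E a f) (E c g)) EE //.
  rewrite mulrBl mulrBr; congr (_ - _).
    by rewrite -!mulrA mul_nat_sign.
  rewrite -!mulrA signM mul_nat_sign.
  congr (_ * (_ ^+ _ * _)).
  rewrite -(ip_trans a f b).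
  by case: (ip a f); case: (ip f b); case: (ip c g).
transitivity (\sum_(f : 'I_n | (k < f)%N) \sum_(g : 'I_n | (k < g)%N)
    ((c == f)%:R * ((-1) ^+ (ip f b && ip c g) * (E a g * (P f b * P g e)))
     - (a == g)%:R * ((-1) ^+ (ip a b && ip c g) * (E c f * (P f b * P g e))))).
  by apply: eq_bigr => f kf; rewrite br_sumr; apply: eq_bigr => g kg; rewrite term.
under eq_bigr do rewrite sumrB.
rewrite sumrB; congr (_ - _).
  under eq_bigr do rewrite -mulr_sumr.
  rewrite sum_delta // mulr_suml mulr_sumr; apply: eq_bigr => g kg.
  rewrite (dy_pp kc kb kg ke) (mul_sign (E a g)) signM.
  rewrite -[_ * P g e * P c b]mulrA; congr (_ ^+ _ * _); rewrite -(ip_trans c g e).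
  by case: (ip c b); case: (ip c g); case: (ip g e).
rewrite exchange_big /=; under eq_bigr do rewrite -mulr_sumr.
rewrite sum_delta // mulr_suml mulr_sumr; apply: eq_bigr => f kf.
by rewrite -[_ * P f b * P a e]mulrA; congr (_ ^+ _ * _);
  rewrite /index_parity [par c (+) _]addbC.
Qed.

(** The terms x d satisfy the relations by themselves ([dy_DD]).  The brackets
    of x d with F and of F with F produce only terms of the form F x and F p,
    and these combine because p_{ek} is x_e up to sign. *)
Lemma dyson_gl (a b c e : 'I_n) :
  (k <= a)%N -> (k <= b)%N -> (k <= c)%N -> (k <= e)%N ->
  br (ip a b && ip c e) (dyson a b) (dyson c e)
  = (c == b)%:R * dyson a e - (-1) ^+ (ip a b && ip c e) * ((a == e)%:R * dyson c b).
Proof.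
move=> ka kb kc ke; rewrite /dyson brDl !brDr dy_DD // dy_DF //.
rewrite [br _ (F a b) (_ * _)]br_sym [br _ _ (F a b)](_ : _ = br (ip c e && ip a b) (X c * D e) (F a b)); last by rewrite andbC.
rewrite dy_DF //.
have F0 f : F k f = 0 by rewrite /F eqxx.
have X1 : X k = 1 by rewrite /X eqxx.
suff key : - ((e == k)%:R * ((-1) ^+ ((ip a b && ip c b) (+) q b) * (F c b * X a)))
    + (-1) ^+ (ip a b && ip c e)
      * ((b == k)%:R * ((-1) ^+ ((ip c e && ip a e) (+) q e) * (F a e * X c)))
    + br (ip a b && ip c e) (F a b) (F c e)
  = (c == b)%:R * F a e - (-1) ^+ (ip a b && ip c e) * ((a == e)%:R * F c b).
  transitivity ((c == b)%:R * (X a * D e)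
      - (-1) ^+ (ip a b && ip c e) * ((a == e)%:R * (X c * D b))
      + ((c == b)%:R * F a e - (-1) ^+ (ip a b && ip c e) * ((a == e)%:R * F c b))).
    by rewrite -key !mulrN; zmod.
  by rewrite !mulrDr; zmod.
case: (geqP ka) => [ak|ka']; case: (geqP kc) => [ck|kc'].
- by rewrite ak ck !F0 /br !(mul0r, mulr0); zmod.
- rewrite ak !F0 X1 /br !(mul0r, mulr0) ?subr0 ?addr0 ?sub0r mulr1 [k == e]eq_sym.
  case: (geqP ke) => [->|_]; last by rewrite !(mul0r, mulr0).
  rewrite !mul1r; congr (- (_ ^+ _ * _)); rewrite /index_parity.
  by case: (par k); case: (par b); case: (par c).
- rewrite ck !F0 X1 /br !(mul0r, mulr0) ?oppr0 ?subr0 ?addr0 ?add0r mulr1 [k == b]eq_sym.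
  case: (geqP kb) => [->|_]; last by rewrite !(mul0r, mulr0).
  rewrite !mul1r signM -[RHS]mul1r; congr (_ * _).
  rewrite -(expr0 (-1)); congr (_ ^+ _); rewrite /index_parity.
  by case: (par k); case: (par a); case: (par e).
rewrite dy_FF // (dy_x_gt ka') (dy_x_gt kc').
have E1 : (-1) ^+ (ip a b && ip c e)
      * ((b == k)%:R * ((-1) ^+ ((ip c e && ip a e) (+) q e) * (F a e * x c)))
    + (-1) ^+ (ip c b && ip c e) * (F a e * P c b) = (c == b)%:R * F a e.
  rewrite /P; case: (geqP kb) => [->|kb']; last first.
    rewrite mul0r mulr0 add0r; case: eqP => [->|_]; last by rewrite mulr0 mul0r mulr0.
    by rewrite /index_parity addbb mulr1 !mul1r.
  rewrite gt_neq // mul0r mul1r signM mulrN (mul_sign (F a e)) mulrN signM.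
  apply/eqP; rewrite subr_eq0; apply/eqP; congr (_ ^+ _ * _); rewrite /index_parity.
  by case: (par a); case: (par k); case: (par c); case: (par e).
have E2 : (e == k)%:R * ((-1) ^+ ((ip a b && ip c b) (+) q b) * (F c b * x a))
    + (-1) ^+ (ip a b && ip a c) * (F c b * P a e)
  = (-1) ^+ (ip a b && ip c e) * ((a == e)%:R * F c b).
  rewrite /P; case: (geqP ke) => [->|ke']; last first.
    rewrite mul0r add0r; case: eqP => [->|_]; last by rewrite mulr0 mul0r !mulr0.
    by rewrite mulr1 mul1r; congr (_ ^+ _ * _); rewrite /index_parity [par c (+) _]addbC.
  rewrite gt_neq // mul0r mulr0 mul1r mulrN (mul_sign (F c b)) mulrN signM.
  apply/eqP; rewrite subr_eq0; apply/eqP; congr (_ ^+ _ * _); rewrite /index_parity.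
  by case: (par a); case: (par k); case: (par c); case: (par b).
by rewrite -E1 -E2; zmod.
Qed.

End DysonStep.

(** * Vacuum vectors of the Dyson realization *)

Section DysonVacuum.
Variables (K : numFieldType) (W : lmodType K) (n : nat) (par : 'I_n -> bool).
Local Notation A := (endo W).
Variables (k : 'I_n) (x d : 'I_n -> A) (E : 'I_n -> 'I_n -> A) (c0 : K).
Local Notation G := (dyson par k x d E c0).
Variables (vac : W) (l : {linear W -> K^o}) (lam : 'I_n -> K).
Hypothesis d_vac : forall b : 'I_n, (k < b)%N -> d b vac = 0.
Hypothesis l_x : forall (b : 'I_n) v, (k < b)%N -> l (x b v) = 0.
Hypothesis E_vac : forall a b : 'I_n, (k < a)%N -> (a < b)%N -> E a b vac = 0.
Hypothesis E_vac_diag : forall a : 'I_n, (k < a)%N -> E a a vac = lam a *: vac.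
Hypothesis l_E : forall (a : 'I_n) v, (k < a)%N -> l (E a a v) = lam a * l v.
Hypothesis lam_k : lam k = c0.

Let F_vac (a b : 'I_n) (v : W) : (k < a)%N -> (k < b)%N ->
  dy_F par k x E a b v = E a b v.
Proof.
move=> ka kb; rewrite /dy_F gt_neq //; congr (endo_fun _ v).
rewrite (bigD1 b) //= big1 => [|e /andP[_ eb]].
  by rewrite addr0 /dy_p gt_neq // eqxx mulr1.
by rewrite /dy_p gt_neq // (negbTE eb) mulr0.
Qed.

Lemma dyson_vac (a b : 'I_n) : (k <= a)%N -> (a < b)%N -> G a b vac = 0.
Proof.
move=> ka ab; have kb : (k < b)%N by apply: leq_ltn_trans ab.
rewrite /dyson endoDE endoME dy_d_gt // d_vac // linear0 add0r.
case: (geqP ka) => [->|ka']; first by rewrite /dy_F eqxx.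
by rewrite F_vac // E_vac.
Qed.

Lemma dyson_vac_diag (a : 'I_n) : (k <= a)%N -> G a a vac = lam a *: vac.
Proof.
move=> ka; rewrite /dyson endoDE endoME.
case: (geqP ka) => [->|ka']; last first.
  by rewrite dy_d_gt // d_vac // linear0 add0r F_vac // E_vac_diag.
rewrite /dy_F eqxx addr0 /dy_x eqxx endo1E /dy_d eqxx endoBE endoZE endo1E.
rewrite endo_sumE big1 ?subr0 ?lam_k // => e ke.
by rewrite endoME d_vac // linear0.
Qed.

Lemma dyson_functional (a : 'I_n) v : (k <= a)%N -> l (G a a v) = lam a * l v.
Proof.
move=> ka; rewrite /dyson endoDE endoME linearD /=.
case: (geqP ka) => [->|ka']; last first.
  by rewrite dy_x_gt // l_x // add0r F_vac // l_E.
rewrite /dy_F eqxx linear0 addr0 /dy_x eqxx endo1E /dy_d eqxx endoBE endoZE endo1E.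
rewrite linearB linearZ /= endo_sumE linear_sum big1 ?subr0 ?lam_k // => e ke.
by rewrite endoME l_x.
Qed.
End DysonVacuum.

(** * Fock spaces *)

Section Oscillator.
Variable K : numFieldType.

(** One variable x and its derivation d, even or odd according to q, acting on
    the functions of x; vac is the constant 1 and osc_l the value at x = 0. *)
Record oscillator (q : bool) := Oscillator {
  osc_space : superspace K;
  osc_x : endo osc_space;
  osc_d : endo osc_space;
  osc_vac : osc_space;
  osc_l : {linear osc_space -> K^o};
  osc_alg : [/\ odd_by (parity_op osc_space) q osc_x,
    odd_by (parity_op osc_space) q osc_d,
    gcomm q osc_x q osc_x, gcomm q osc_d q osc_d & br q osc_d osc_x = 1];
  osc_vacP : [/\ osc_d osc_vac = 0, homogeneous false osc_vac,
    osc_l osc_vac = 1 & forall v, osc_l (osc_x v) = 0] }.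

(** For an odd variable the functions c + c' x form a plane; for an even one
    they are the polynomials. *)
Lemma oscillator_exists (q : bool) : inhabited (oscillator q).
Proof.
case: q.
  pose W : lmodType K := (K^o * K^o)%type.
  have lin (f : W -> W) : linear f -> {g : endo W | g =1 f}.
    by move=> /mklinear[g gE]; exists (mkendo g).
  have [x xE] := lin (fun v => (0, v.1)) (fun c u v =>
    congr1 (fun z => (z, _)) (esym (etrans (addr0 (c *: 0)) (scaler0 _ c)))).
  have [d dE] := lin (fun v => (v.2, 0)) (fun c u v =>
    congr1 (fun z => (_, z)) (esym (etrans (addr0 (c *: 0)) (scaler0 _ c)))).
  have lP : linear (fun v : W => (v.1, - v.2) : W).
    by move=> c u v; rewrite /= opprD -scalerN.
  have [P PE] := lin _ lP.
  have PP : P * P = 1.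
    by apply: endoP => v; rewrite endoME !PE /= opprK; case: v.
  have ll : linear (fun v : W => v.1 : K^o) by [].
  have [l lE] := mklinear ll.
  apply: inhabits.
  apply: (@Oscillator _ (superspace_of PP) x d (1, 0) l);
    rewrite ?parity_superspace_of; split.
  - apply: endoP => v; rewrite endo_signE !endoME scaleN1r !(PE, xE).
    by apply: congr2 => /=; rewrite ?oppr0.
  - apply: endoP => v; rewrite endo_signE !endoME scaleN1r !(PE, dE).
    by apply: congr2 => /=; rewrite ?oppr0 ?opprK.
  - apply: endoP => v; rewrite endo_signE !endoME scaleN1r !xE.
    by apply: congr2 => /=; rewrite ?oppr0.
  - apply: endoP => v; rewrite endo_signE !endoME scaleN1r !dE.
    by apply: congr2 => /=; rewrite ?oppr0.
  - apply: endoP => v; rewrite /br endoBE endo_signE !endoME scaleN1r opprK.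
    rewrite !(xE, dE) endo1E; case: v => v1 v2.
    by rewrite -[LHS]/(v1 + 0, 0 + v2) addr0 add0r.
  - by rewrite dE.
  - by apply/homogeneousP; rewrite parity_superspace_of PE /= oppr0 scale1r.
  - by rewrite lE.
  - by move=> v; rewrite lE xE.
pose W : lmodType K := {poly K}.
have lX : linear (fun p : W => p * 'X : W).
  by move=> c u v; rewrite mulrDl scalerAl.
have [x0 xE] := mklinear lX; pose x := mkendo x0.
have [d0 dE] := mklinear (@linearP _ _ _ _ (@deriv K) : linear (@deriv K : W -> W)).
pose d := mkendo d0.
have ll : linear (fun p : W => p`_0 : K^o) by move=> c u v; rewrite coefD coefZ.
have [l lE] := mklinear ll.
have P1 : (1 : endo W) * 1 = 1 by rewrite mulr1.
apply: inhabits.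
apply: (@Oscillator _ (superspace_of P1) x d 1 l);
  rewrite ?parity_superspace_of; split.
- by rewrite /odd_by expr0 !mul1r mulr1.
- by rewrite /odd_by expr0 !mul1r mulr1.
- by rewrite /gcomm expr0 mul1r.
- by rewrite /gcomm expr0 mul1r.
- apply: endoP => p; rewrite /br expr0 mul1r endoBE !endoME endo1E.
  by rewrite /x /d /= !(xE, dE) derivM derivX mulr1 addrAC subrr add0r.
- by rewrite /d /= dE -polyC1 derivC.
- by apply/homogeneousP; rewrite parity_superspace_of scale1r.
- by rewrite lE coef1.
- by move=> v; rewrite lE /x /= xE coefMX.
Qed.
End Oscillator.

Section Fock.
Variables (K : numFieldType) (n : nat) (par : 'I_n -> bool).
Local Notation ip := (index_parity par).

(** One oscillator for each pair of indices, in the graded tensor product of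
    their function spaces. *)
Lemma fock_exists :
  exists (W : superspace K) (x d : 'I_n -> 'I_n -> endo W) (vac : W)
         (l : {linear W -> K^o}),
    [/\ forall i j, odd_by (parity_op W) (ip i j) (x i j),
        forall i j, odd_by (parity_op W) (ip i j) (d i j),
        forall i j i' j', gcomm (ip i j) (x i j) (ip i' j') (x i' j'),
        forall i j i' j', gcomm (ip i j) (d i j) (ip i' j') (d i' j')
      & forall i j i' j', br (ip i j && ip i' j') (d i j) (x i' j')
          = ((i == i') && (j == j'))%:R] /\
    [/\ forall i j, d i j vac = 0, homogeneous false vac, l vac = 1
      & forall i j v, l (x i j v) = 0].
Proof.
have [O0] := oscillator_exists K false; have [O1] := oscillator_exists K true.
pose O q : oscillator K q := match q with true => O1 | false => O0 end.
pose I := ('I_n * 'I_n)%type; pose s := #|{: I}|.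
pose q (k : 'I_s) := let ij := enum_val k in ip ij.1 ij.2.
pose V k := osc_space (O (q k)).
have [W [tau tauP]] := tensor_space_exists (fun k => V k : lmodType K).
have [tmap tmapE] := tensor_map_exists tauP.
pose rk i j : 'I_s := enum_rank (i, j).
have qrk i j : q (rk i j) = ip i j by rewrite /q /rk enum_rankK.
have rk_inj i j i' j' : (rk i j == rk i' j') = ((i == i') && (j == j')).
  by rewrite (inj_eq enum_rank_inj).
pose sx k := slot tmap (q k) (osc_x (O (q k)) : endo (V k)).
pose sd k := slot tmap (q k) (osc_d (O (q k)) : endo (V k)).
have x_odd k : odd_by (parity_op (V k)) (q k) (osc_x (O (q k))).
  by case: (osc_alg (O (q k))).
have d_odd k : odd_by (parity_op (V k)) (q k) (osc_d (O (q k))).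
  by case: (osc_alg (O (q k))).
have sxx k k' : gcomm (q k) (sx k) (q k') (sx k').
  case: (eqVneq k k') => [<-|kk']; last exact: (slot_comm tauP tmapE kk' (x_odd k) (x_odd k')).
  rewrite /gcomm /sx (slotM tauP tmapE) addbb -(slot_sign tauP tmapE).
  by congr slot; case: (osc_alg (O (q k))).
have sdd k k' : gcomm (q k) (sd k) (q k') (sd k').
  case: (eqVneq k k') => [<-|kk']; last exact: (slot_comm tauP tmapE kk' (d_odd k) (d_odd k')).
  rewrite /gcomm /sd (slotM tauP tmapE) addbb -(slot_sign tauP tmapE).
  by congr slot; case: (osc_alg (O (q k))).
have sdx k k' : br (q k && q k') (sd k) (sx k') = (k == k')%:R.
  case: (eqVneq k k') => [<-|kk']; last first.
    exact/gcomm_br/(slot_comm tauP tmapE kk' (d_odd k) (x_odd k')).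
  rewrite /br /sd /sx !(slotM tauP tmapE) addbb andbb -(slot_sign tauP tmapE).
  rewrite -(slotN tauP tmapE) -(slotD tauP tmapE).
  rewrite (_ : _ - _ = 1) ?(slot1 tauP tmapE) //.
  by case: (osc_alg (O (q k))).
pose Wsp := superspace_of (tensor_parityK tauP tmapE).
pose vac k : V k := osc_vac (O (q k)).
have [l lE] := tensor_functional tauP (fun k => osc_l (O (q k))).
have vac_hom k : homogeneous false (vac k) by case: (osc_vacP (O (q k))).
exists Wsp, (fun i j => sx (rk i j)), (fun i j => sd (rk i j)), (tau vac), l.
have slot_tau k e (B : endo (V k)) v :
    slot tmap e B (tau v) = tau (dfwith (fun i : 'I_s => (if (i < k)%N then parity_op (V i) ^+ e else 1) (v i)) (B (v k))).
  rewrite /slot tmapE; congr tau; exact: dfwith_app2.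
split; split.
- move=> i j; rewrite parity_superspace_of -qrk.
  exact/(slot_odd_by tauP tmapE)/x_odd.
- move=> i j; rewrite parity_superspace_of -qrk.
  exact/(slot_odd_by tauP tmapE)/d_odd.
- by move=> i j i' j'; rewrite -!qrk; apply: sxx.
- by move=> i j i' j'; rewrite -!qrk; apply: sdd.
- by move=> i j i' j'; rewrite -!qrk -rk_inj; apply: sdx.
- move=> i j; rewrite /sd slot_tau // (_ : osc_d _ _ = 0) ?(tensor0 tauP) //.
  by case: (osc_vacP (O (q (rk i j)))).
- apply/homogeneousP; rewrite parity_superspace_of.
  rewrite (tensor_parityE tauP tmapE vac_hom); congr (_ ^+ _ *: _).
  by rewrite big1_eq.
- by rewrite lE big1 // => k _; case: (osc_vacP (O (q k))).
move=> i j v.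
rewrite -[LHS]/((l \o sx (rk i j)) v).
have : (l \o sx (rk i j) : {linear W -> K^o}) =1 (\0 : {linear W -> K^o}).
  apply: (tensor_ext tauP) => w /=; rewrite /sx slot_tau // lE.
  rewrite (bigD1 (rk i j)) //= dfwith_in.
  by case: (osc_vacP (O (q (rk i j)))) => _ _ _ ->; rewrite mul0r.
by move=> /(_ v).
Qed.

End Fock.

(** * Existence of modules of any highest weight *)

Section DysonModule.
Variables (K : numFieldType) (n : nat) (par : 'I_n -> bool) (lam : 'I_n -> K).
Local Notation ip := (index_parity par).
Variables (W : superspace K) (x d : 'I_n -> 'I_n -> endo W) (vac : W)
  (l : {linear W -> K^o}).
Hypothesis x_odd : forall i j, odd_by (parity_op W) (ip i j) (x i j).
Hypothesis d_odd : forall i j, odd_by (parity_op W) (ip i j) (d i j).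
Hypothesis xx : forall i j i' j', gcomm (ip i j) (x i j) (ip i' j') (x i' j').
Hypothesis dd : forall i j i' j', gcomm (ip i j) (d i j) (ip i' j') (d i' j').
Hypothesis dx : forall i j i' j',
  br (ip i j && ip i' j') (d i j) (x i' j') = ((i == i') && (j == j'))%:R.
Hypothesis d_vac : forall i j, d i j vac = 0.
Hypothesis l_x : forall i j v, l (x i j v) = 0.

(** The Dyson step is applied to k = n - 1, ..., 0; the step at k uses the
    oscillators (k, b) and the weight lam k as its degree. *)
Lemma dyson_module :
  exists E : 'I_n -> 'I_n -> endo W,
    [/\ gl_relations par E, forall a b, odd_by (parity_op W) (ip a b) (E a b),
        forall a b : 'I_n, (a < b)%N -> E a b vac = 0,
        forall a, E a a vac = lam a *: vac
      & forall a v, l (E a a v) = lam a * l v].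
Proof.
suff H (j : nat) : (j <= n)%N -> exists E : 'I_n -> 'I_n -> endo W,
    [/\ forall a b c e : 'I_n, (n - j <= a)%N -> (n - j <= b)%N ->
          (n - j <= c)%N -> (n - j <= e)%N ->
          br (ip a b && ip c e) (E a b) (E c e) = (c == b)%:R * E a e
            - (-1) ^+ (ip a b && ip c e) * ((a == e)%:R * E c b),
        forall i y,
          (forall k b : 'I_n, (n - j <= k)%N -> gcomm i y (ip k b) (x k b)) ->
          (forall k b : 'I_n, (n - j <= k)%N -> gcomm i y (ip k b) (d k b)) ->
          forall a b : 'I_n, (n - j <= a)%N -> (n - j <= b)%N ->
            gcomm i y (ip a b) (E a b),
        forall a b : 'I_n, (n - j <= a)%N -> (a < b)%N -> E a b vac = 0,
        forall a : 'I_n, (n - j <= a)%N -> E a a vac = lam a *: vac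
      & forall (a : 'I_n) v, (n - j <= a)%N -> l (E a a v) = lam a * l v].
  have [E] := H n (leqnn n); rewrite subnn => -[h1 h2 h3 h4 h5].
  exists E; split => [a b c e|a b|a b|a|a v]; [exact: h1| |exact: h3|exact: h4|exact: h5].
  by apply: (h2 true) => // k f _; [exact: x_odd|exact: d_odd].
elim: j => [_|j IH jn].
  exists (fun _ _ => 0); split => [a b c e|i y _ _ a b|a b|a|a v];
    by rewrite subn0 leqNgt ltn_ord.
have [E [h1 h2 h3 h4 h5]] := IH (ltnW jn).
have kn : (n - j.+1 < n)%N by lia.
pose k : 'I_n := Ordinal kn.
have gtk (a : 'I_n) : (k < a)%N -> (n - j <= a)%N by rewrite /k /=; lia.
have gek (a : 'I_n) : (n - j.+1 <= a)%N = (k <= a)%N by [].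
have neqk (a b : 'I_n) : (k < b)%N -> (k == b) = false.
  by move=> kb; apply/negbTE; rewrite neq_ltn kb.
have Ex (a b c : 'I_n) : (k < a)%N -> (k < b)%N -> (k < c)%N ->
    gcomm (ip k c) (x k c) (ip a b) (E a b).
  move=> /gtk ka /gtk kb kc; apply: h2 => // f g kf.
  apply/gcomm_sym/brE; rewrite dx [f == k]eq_sym neqk //.
  by move: kf; rewrite /k /=; lia.
have Ed (a b c : 'I_n) : (k < a)%N -> (k < b)%N -> (k < c)%N ->
    gcomm (ip k c) (d k c) (ip a b) (E a b).
  move=> /gtk ka /gtk kb kc; apply: h2 => // f g kf.
  apply/brE; rewrite dx neqk //.
  by move: kf; rewrite /k /=; lia.
exists (dyson par k (x k) (d k) E (lam k)); split.
- move=> a b c e ka kb kc ke; apply: dyson_gl => //.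
  + by move=> b' c' _ _; rewrite dx eqxx.
  + by move=> a' b' c' e' /gtk ? /gtk ? /gtk ? /gtk ?; apply: h1.
- move=> i y hx hd a b ka kb; apply: dy_gcomm => // [b' _|b' _|a' b' /gtk ka' /gtk kb'].
  + by apply: hx; rewrite gek.
  + by apply: hd; rewrite gek.
  + apply: h2 => // k' b0 kk'; [apply: hx|apply: hd]; apply: leq_trans kk';
      exact: leq_sub2l.
- move=> a b ka ab; apply: dyson_vac => // a' b' /gtk; exact: h3.
- move=> a ka; apply: dyson_vac_diag => // a' /gtk; exact: h4.
move=> a v ka; apply: dyson_functional => // a' v' /gtk; exact: h5.
Qed.
End DysonModule.

(** The functional l tells the highest weight vector from all vectors of lower
    weight, which is what the passage to an irreducible subquotient needs.  The
    vacuum is even, and is given parity e by a change of sign of the parity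
    operator. *)
Lemma weight_module_exists (K : numFieldType) (M N : nat)
    (lam : 'I_(M + N) -> K) (e : bool) :
  exists (pi : gl_rep K M N) (v : pi) (l : {linear pi -> K^o}),
    [/\ homogeneous e v,
        forall a b : 'I_(M + N), (a < b)%N -> gl_E pi a b v = 0,
        forall a, gl_E pi a a v = lam a *: v,
        l v = 1
      & forall a u, l (gl_E pi a a u) = lam a * l u].
Proof.
have [W [x [d [vac [l [[xo yo xx dd dx] [dv hv lv lx]]]]]]] :=
  fock_exists K (@par M N).
have [E [E_gl E_odd E_v E_vv E_l]] := dyson_module lam xo yo xx dd dx dv lx.
pose P : endo W := (-1) ^+ e * parity_op W.
have PP : P * P = 1.
  by rewrite /P mul_sign -mulrA signM addbb mul1r parity_opK.
have gE_parity a b : has_parity (V := superspace_of PP) (par a (+) par b)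
    (E a b : {linear superspace_of PP -> superspace_of PP}).
  apply/has_parityP; rewrite parity_superspace_of /P -mulrA E_odd.
  by rewrite (mul_sign (E a b)) !signM addbC.
have gE_rel a b c f (v : superspace_of PP) :
    supercomm (par a (+) par b) (par c (+) par f) (E a b) (E c f) v
    = (c == b)%:R *: E a f v
      - (-1) ^+ ((par a (+) par b) && (par c (+) par f))
          *: ((a == f)%:R *: E c b v).
  have := congr1 (fun z : endo W => z v) (E_gl a b c f).
  by rewrite !endoBE !endo_signE !endo_natE.
exists (@GlRep K M N (superspace_of PP) (fun a b => E a b) gE_parity gE_rel), vac, l.
split => //; apply/homogeneousP; rewrite parity_superspace_of /P endo_signE.
by have /homogeneousP -> := hv; rewrite scale1r.
Qed.

(** * Subrepresentations and quotients *)

Section SubQuotient.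
Variables (K : numFieldType) (V : superspace K) (I : Type) (A : I -> {linear V -> V}).
Variables (S : V -> Prop) (hS : invariant_subspace A S).

Let Ssub : subspace S. Proof. by case: hS. Qed.
Let Sh e v : S v -> S (hpart V e v). Proof. by case: hS => _ _ + _; apply. Qed.
Let SA i v : S v -> S (A i v). Proof. by case: hS => _ _ _; apply. Qed.

Lemma super_sub :
  exists (U : superspace K) (B : I -> {linear U -> U}) (j : {linear U -> V}),
    [/\ injective j, forall v, S v <-> exists u, j u = v,
        forall e u, j (hpart U e u) = hpart V e (j u)
      & forall i u, j (B i u) = A i (j u)].
Proof.
have [W [j [jinj jS]]] := subspace_type Ssub.
have Sj u : S (j u) by apply/jS; exists u.
have restrict (f : {linear V -> V}) : (forall v, S v -> S (f v)) ->
    exists g : {linear W -> W}, forall u, j (g u) = f (j u).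
  move=> fS; have [g gE] := mklinear (linearP (f \o j) : linear (f \o j : W -> V)).
  have [h hE] := @factor_inj _ W V W j g jinj
    (fun u => (jS (g u)).1 (eq_ind_r S (fS _ (Sj u)) (gE u))).
  by exists h => u; rewrite hE gE.
have /choice[h hE] : forall e, exists g : {linear W -> W},
    forall u, j (g u) = hpart V e (j u) by move=> e; apply/restrict/Sh.
have /choice[B BE] : forall i, exists g : {linear W -> W},
    forall u, j (g u) = A i (j u) by move=> i; apply/restrict/SA.
have hc d e v : h d (h e v) = if d == e then h e v else 0.
  by apply: jinj; rewrite !hE hpart_comp; case: eqP => _; rewrite ?hE ?linear0.
have hs v : h false v + h true v = v.
  by apply: jinj; rewrite linearD !hE hpart_sum.
by exists (Superspace hc hs), B, j; split.
Qed.

Lemma super_quot :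
  exists (U : superspace K) (B : I -> {linear U -> U}) (q : {linear V -> U}),
    [/\ forall u, exists v, q v = u, forall v, q v = 0 <-> S v,
        forall e v, q (hpart V e v) = hpart U e (q v)
      & forall i v, q (A i v) = B i (q v)].
Proof.
have [W [q [qsurj qS]]] := quotient_type Ssub.
have descend (f : {linear V -> V}) : (forall v, S v -> S (f v)) ->
    exists g : {linear W -> W}, forall v, g (q v) = q (f v).
  move=> fS; have [g gE] := mklinear (linearP (q \o f) : linear (q \o f : V -> W)).
  have [h hE] : exists h : {linear W -> W}, forall v, h (q v) = g v.
    apply: factor_surj => // v /qS Sv; rewrite gE /=; apply/qS; exact: fS.
  by exists h => v; rewrite hE gE.
have /choice[h hE] : forall e, exists g : {linear W -> W},
    forall v, g (q v) = q (hpart V e v) by move=> e; apply/descend/Sh.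
have /choice[B BE] : forall i, exists g : {linear W -> W},
    forall v, g (q v) = q (A i v) by move=> i; apply/descend/SA.
have hc d e v : h d (h e v) = if d == e then h e v else 0.
  have [u <-] := qsurj v; rewrite !hE hpart_comp.
  by case: eqP => _; rewrite ?hE ?linear0.
have hs v : h false v + h true v = v.
  by have [u <-] := qsurj v; rewrite !hE -linearD hpart_sum.
by exists (Superspace hc hs), B, q; split.
Qed.
End SubQuotient.

Lemma sub_parity (K : numFieldType) (U V : superspace K) (j : {linear U -> V})
    (f : U -> U) (g : V -> V) d :
  injective j -> (forall e u, j (hpart U e u) = hpart V e (j u)) ->
  (forall u, j (f u) = g (j u)) -> has_parity d g -> has_parity d f.
Proof.
move=> jinj jh jf gd e u hu; apply: jinj; rewrite jh jf; apply: gd.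
by rewrite /homogeneous -jh hu.
Qed.

Lemma quot_parity (K : numFieldType) (U V : superspace K) (q : {linear V -> U})
    (f : U -> U) (g : V -> V) d :
  (forall u, exists v, q v = u) ->
  (forall e v, q (hpart V e v) = hpart U e (q v)) ->
  (forall v, q (g v) = f (q v)) -> has_parity d g -> has_parity d f.
Proof.
move=> qs qh qf gd e u hu; have [v vu] := qs u.
rewrite -hu -vu -qh -qf /homogeneous -qh; congr (q _).
by apply: gd; apply: hpart_homogeneous.
Qed.

(** * Vectors below an eigenvalue *)

Section Hkill.
Variables (K : numFieldType) (V : lmodType K) (H : {linear V -> V}) (mu : K).

(** v is killed by (H - mu + 1) ... (H - mu + m), that is, v is a sum of
    eigenvectors of H with eigenvalues among mu - 1, ..., mu - m. *)
Fixpoint below (m : nat) (v : V) : Prop :=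
  if m is m'.+1 then below m' (H v - (mu - m%:R) *: v) else v = 0.

Lemma below_lin m c u v : below m u -> below m v -> below m (c *: u + v).
Proof.
elim: m u v => [|m IH] u v /=; first by move=> -> ->; rewrite scaler0 addr0.
move=> hu hv; have := IH _ _ hu hv; congr below.
rewrite linearP scalerBr scalerDr !scalerA (mulrC c); by zmod.
Qed.

Lemma below0 m : below m 0.
Proof. by elim: m => [|m IH] //=; rewrite linear0 scaler0 subr0. Qed.

Lemma belowZ m c u : below m u -> below m (c *: u).
Proof.
by move=> h; rewrite -[_ *: _]addr0; apply: below_lin => //; apply: below0.
Qed.

Lemma below_H m u : below m u -> below m (H u).
Proof.
elim: m u => [|m IH] u /=; first by move=> ->; rewrite linear0.
by move=> /IH; rewrite linearB linearZ.
Qed.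

Lemma belowS m u : below m u -> below m.+1 u.
Proof.
move=> h /=; rewrite -[H u]scale1r -scaleNr; apply: below_lin.
  exact: below_H.
exact: belowZ.
Qed.

Lemma below_le m m' u : (m <= m')%N -> below m u -> below m' u.
Proof.
move=> /subnK <-; elim: (m' - m)%N => [|i IH] // /IH; exact: belowS.
Qed.

Lemma below_eigen j u : (0 < j)%N -> H u = (mu - j%:R) *: u -> below j u.
Proof.
by case: j => // j _ hu /=; rewrite hu subrr; apply: below0.
Qed.

Lemma below_eigen_eq0 m u : H u = mu *: u -> below m u -> u = 0.
Proof.
elim: m u => [|m IH] u hu //=.
have -> : H u - (mu - m.+1%:R) *: u = m.+1%:R *: u.
  by rewrite hu scalerBl; zmod.
move=> bu; have hw : H (m.+1%:R *: u) = mu *: (m.+1%:R *: u).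
  by rewrite linearZ /= hu !scalerA mulrC.
by have /eqP := IH _ hw bu; rewrite scaler_eq0 pnatr_eq0 => /eqP.
Qed.

(** A functional of eigenvalue mu turns (H - mu + 1) ... (H - mu + m) into
    multiplication by m!, which is not zero. *)
Lemma below_functional (U : lmodType K) (l : {linear V -> U}) m u :
  (forall v, l (H v) = mu *: l v) -> below m u -> l u = 0.
Proof.
move=> lH; elim: m u => [|m IH] u /=; first by move=> ->; rewrite linear0.
move=> /IH; rewrite linearB linearZ /= lH -scalerBl opprB addrC subrK.
by move=> /eqP; rewrite scaler_eq0 pnatr_eq0 /= => /eqP.
Qed.

(** The operator (H - mu + 1) ... (H - mu + m) kills u, preserves S and
    multiplies v by m!. *)
Lemma below_project (S : V -> Prop) m v u : subspace S ->
  (forall w, S w -> S (H w)) -> H v = mu *: v -> below m u -> S (v + u) -> S v.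
Proof.
move=> hS SH hv; elim: m v hv u => [|m IH] v hv u /=.
  by move=> ->; rewrite addr0.
move=> hu Sw.
have Sw' : S (m.+1%:R *: v + (H u - (mu - m.+1%:R) *: u)).
  have -> : m.+1%:R *: v + (H u - (mu - m.+1%:R) *: u)
      = H (v + u) - (mu - m.+1%:R) *: (v + u).
    rewrite linearD hv !scalerBl !scalerDr; by zmod.
  apply: subspaceB => //; [exact: SH|exact: subspaceZ].
have := IH _ _ _ hu Sw'; rewrite linearZ /= hv !scalerA mulrC => /(_ erefl) Sv.
rewrite -[v]scale1r -(mulVf (_ : m.+1%:R != 0 :> K)) ?pnatr_eq0 // -scalerA.
exact: subspaceZ.
Qed.
End Hkill.

(** * Words in the generators *)

Section HighestWeightWords.
Variables (K : numFieldType) (M N : nat) (V : yangian_rep K M N).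
Local Notation I := 'I_(M + N).
Local Notation letter := (nat * (I * I))%type.
Local Notation op := (@Y_op _ _ _ V).
Local Notation T := (Y_T V).

Definition hw_vector (v : V) (lam : nat -> I -> K) : Prop :=
  (forall r (a b : I), (0 < r)%N -> (a < b)%N -> T r a b v = 0) /\
  (forall r a, (0 < r)%N -> T r a a v = lam r a *: v).

Definition word_op (w : seq letter) (v : V) : V := foldr op v w.
Definition word_deg (w : seq letter) : nat := sumn [seq x.1 | x <- w].
Definition positive_word (w : seq letter) := all (fun x : letter => (0 < x.1)%N) w.
Definition lowering_word (w : seq letter) :=
  all (fun x : letter => (x.2.2 < x.2.1)%N) w.

Lemma Y_opP x c u v : op x (c *: u + v) = c *: op x u + op x v.
Proof. exact: linearP. Qed.

Lemma word_opP w c u v : word_op w (c *: u + v) = c *: word_op w u + word_op w v.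
Proof. by elim: w => [|x w IH] //=; rewrite IH Y_opP. Qed.

Lemma word_op_cat w1 w2 v : word_op (w1 ++ w2) v = word_op w1 (word_op w2 v).
Proof. exact: foldr_cat. Qed.

Lemma word_deg_cat w1 w2 : word_deg (w1 ++ w2) = (word_deg w1 + word_deg w2)%N.
Proof. by rewrite /word_deg map_cat sumn_cat. Qed.

Lemma preim_subspace (Q : V -> Prop) w :
  subspace Q -> subspace (fun u => Q (word_op w u)).
Proof.
move=> [Q0 QL]; split=> [|c u u' Qu Qu']; last by rewrite word_opP; apply: QL.
by have := word_opP w (-1) 0 0; rewrite scaler0 addr0 scaleN1r addNr => ->.
Qed.

Lemma Y_swap m n a b c d u : (0 < m)%N -> (0 < n)%N ->
  T m a b (T n c d u)
  = ((c == b)%:R *: T (m + n - 1) a d u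
    - (-1) ^+ ((par a (+) par b) && (par c (+) par d))
          *: ((a == d)%:R *: T (m + n - 1) c b u)
    + (-1) ^+ ((par c && (par a (+) par b)) (+) (par a && par b))
          *: \sum_(1 <= r < minn m n)
               (T r c b (T (m + n - 1 - r) a d u)
                - T (m + n - 1 - r) c b (T r a d u)))
    + (-1) ^+ ((par a (+) par b) && (par c (+) par d)) *: T n c d (T m a b u).
Proof. by move=> m0 n0; rewrite -Y_T_rel // /supercomm subrK. Qed.

Variables (v : V) (lam : nat -> I -> K).
Hypothesis hw : hw_vector v lam.

(** A letter T^{ab}_(r) with a <= b, r > 0 acts on v by a scalar, so it can be
    dropped once it has been moved to the right end of the word.  Each exchange
    on the way costs words of smaller total degree only, whatever their letters,
    and the induction is on that degree. *)
Lemma words_spanned (Q : V -> Prop) : subspace Q ->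
  (forall w, positive_word w -> lowering_word w -> Q (word_op w v)) ->
  forall w, positive_word w -> Q (word_op w v).
Proof.
move=> hQ Qlow w; have [d] := ubnP (word_deg w); elim: d w => // d IHd w.
move=> wd pw; case: (boolP (lowering_word w)) => [lw|]; first exact: Qlow.
move=> /allPn[x xw nx]; move: wd pw; case/splitPr: xw => w1 w2.
elim: w2 w1 => [|y w3 IH] w1.
  rewrite word_deg_cat /positive_word all_cat /= => dg /and3P[p1 x0 _].
  have QL := preim_subspace w1 hQ.
  rewrite word_op_cat /=; move: x nx x0 dg => [r [a b]] /=.
  rewrite -leqNgt leq_eqVlt => ab r0 dg; case: hw => hlt hdiag.
  move: ab => /orP[/eqP ab|ab]; rewrite /Y_op /=; last first.
    by rewrite hlt //; case: QL.
  have <- : a = b by apply: val_inj.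
  rewrite hdiag //; apply: (subspaceZ (lam r a) QL); apply: IHd => //.
  by move: dg; rewrite /word_deg /=; lia.
rewrite word_deg_cat /positive_word all_cat /= => dg /and4P[p1 x0 y0 p3].
have QL := preim_subspace w1 hQ; have [_ QLL] := QL.
rewrite word_op_cat /=; set u := word_op w3 v.
have Q1 (z : letter) : (0 < z.1)%N -> (z.1 < x.1 + y.1)%N -> Q (word_op w1 (op z u)).
  move=> z0 zd; have := IHd (w1 ++ z :: w3); rewrite word_op_cat; apply.
    by move: dg; rewrite word_deg_cat /word_deg /= !ltnS; apply: leq_trans;
      rewrite ltn_add2l addnA ltn_add2r.
  by rewrite /positive_word all_cat /= p1 z0.
have Q2 (z z' : letter) : (0 < z.1)%N -> (0 < z'.1)%N -> (z.1 + z'.1 < x.1 + y.1)%N ->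
    Q (word_op w1 (op z (op z' u))).
  move=> z0 z0' zd; have := IHd (w1 ++ z :: z' :: w3); rewrite word_op_cat; apply.
    by move: dg; rewrite word_deg_cat /word_deg /= !ltnS; apply: leq_trans;
      rewrite ltn_add2l !addnA ltn_add2r.
  by rewrite /positive_word all_cat /= p1 z0 z0'.
have Q3 : Q (word_op w1 (op y (op x u))).
  have := IH (rcons w1 y); rewrite -cats1 -catA word_op_cat; apply.
    by move: dg; rewrite !word_deg_cat /word_deg /= addn0 (addnCA y.1).
  by rewrite /positive_word !all_cat /= p1 y0 x0.
move: x y nx x0 y0 Q1 Q2 Q3 {IH dg} => [m [a b]] [n [c e]] /= _ m0 n0 Q1 Q2 Q3.
rewrite (Y_swap a b c e u m0 n0 : op (m, (a, b)) (op (n, (c, e)) u) = _).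
apply: (subspaceD QL); last exact: (subspaceZ _ QL Q3).
apply: (subspaceD QL).
  apply: (subspaceB QL).
    by apply: (subspaceZ _ QL); apply: (Q1 (_, (a, e))) => /=; lia.
  do 2 apply: (subspaceZ _ QL).
  by apply: (Q1 (_, (c, b))) => /=; lia.
apply: (subspaceZ _ QL); rewrite big_nat; apply: (subspace_sum _ QL) => r.
rewrite leq_min => /and3P[r1 rm rn]; apply: (subspaceB QL).
  by apply: (Q2 (r, (c, b)) (_, (a, e))) => /=; lia.
by apply: (Q2 (_, (c, b)) (r, (a, e))) => /=; lia.
Qed.

(** A grading element of gl(M|N), chosen such that T^{ab}_(r) raises its
    eigenvalues by b - a. *)
Definition height_op : {linear V -> V} :=
  (\sum_(c : I) (- (c%:R : K)) *: mkendo (T 1 c c) : endo V).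

Lemma height_opE u : height_op u = \sum_(c : I) (- (c%:R : K)) *: T 1 c c u.
Proof. by rewrite /height_op /= endo_sumE. Qed.

Lemma height_op_T r (a b : I) u : (0 < r)%N ->
  height_op (T r a b u) = T r a b (height_op u) + (b%:R - a%:R : K) *: T r a b u.
Proof.
move=> r0; rewrite !height_opE linear_sum.
have E c : T 1 c c (T r a b u) = T r a b (T 1 c c u)
    + ((c == a)%:R - (c == b)%:R : K) *: T r a b u.
  rewrite Y_swap // addbb expr0 !scale1r big_geq ?scaler0 ?addr0; last first.
    by rewrite geq_min leqnn.
  rewrite addrC add1n subn1 /= scalerBl; congr (_ + (_ - _)).
    by rewrite eq_sym; case: eqP => [->|_] //; rewrite !scale0r.
  by case: eqP => [->|_] //; rewrite !scale0r.
under eq_bigr do rewrite E scalerDr scalerA.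
rewrite big_split /= -scaler_suml; congr (_ + _ *: _).
  by apply: eq_bigr => c _; rewrite linearZ.
under eq_bigr do rewrite mulrBr.
rewrite sumrB (bigD1 a) //= eqxx mulr1 big1 => [|c /negbTE->]; last by rewrite mulr0.
rewrite (bigD1 b) //= eqxx mulr1 [X in _ - (_ + X)]big1 => [|c /negbTE->].
  by rewrite !addr0 opprK addrC.
by rewrite mulr0.
Qed.

Definition height (lam : nat -> I -> K) : K := \sum_(c : I) (- c%:R) * lam 1 c.

Lemma height_op_hw : height_op v = height lam *: v.
Proof.
rewrite height_opE /height scaler_suml; apply: eq_bigr => c _.
by rewrite (hw.2) // scalerA.
Qed.

Definition drop_of (w : seq letter) : nat := sumn [seq (x.2.1 - x.2.2)%N | x : letter <- w].

Lemma height_op_word w : positive_word w -> lowering_word w ->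
  height_op (word_op w v) = (height lam - (drop_of w)%:R) *: word_op w v.
Proof.
elim: w => [|[r [a b]] w IH] /=; first by rewrite subr0 height_op_hw.
move=> /andP[r0 pw] /andP[/= ba lw].
rewrite -[LHS]/(height_op (T r a b (word_op w v))) height_op_T // IH //.
rewrite linearZ /= -scalerDl; congr (_ *: _).
rewrite /drop_of /= natrD natrB; last exact: ltnW.
by zmod.
Qed.

(** The letters T^{ab}_(0) act by scalars, so words without them suffice. *)
Definition cyclic_span (u : V) : Prop := forall S : V -> Prop, subspace S ->
  (forall w, positive_word w -> S (word_op w v)) -> S u.

Lemma cyclic_span_subspace : subspace cyclic_span.
Proof.
split=> [S [] //|c u u' hu hu' S hS SW].
by have [_ SL] := hS; apply: SL; [apply: hu|apply: hu'].
Qed.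

Lemma cyclic_span_word w : positive_word w -> cyclic_span (word_op w v).
Proof. by move=> pw S hS; apply. Qed.

Lemma cyclic_span_hw : cyclic_span v.
Proof. exact: (@cyclic_span_word [::]). Qed.

Lemma cyclic_span_min S : invariant_subspace op S -> S v ->
  forall u, cyclic_span u -> S u.
Proof.
move=> [S0 SL Sh SA] Sv u; apply; first by split.
by elim=> [|x w IH] //= /andP[_ /IH]; apply: SA.
Qed.

(** By [words_spanned] the span consists of v and of nonempty lowering words,
    whose heights are smaller than that of v by positive integers. *)
Lemma cyclic_span_decomp u : cyclic_span u ->
  exists c u' m, u = c *: v + u' /\ below height_op (height lam) m u'.
Proof.
pose Q u := exists c u' m, u = c *: v + u' /\ below height_op (height lam) m u'.
have hQ : subspace Q.
  split=> [|c u1 u2 [c1 [u1' [m1 [-> h1]]]] [c2 [u2' [m2 [-> h2]]]]].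
    by exists 0, 0, 0%N; rewrite scale0r addr0.
  exists (c * c1 + c2), (c *: u1' + u2'), (maxn m1 m2); split.
    by rewrite scalerDr scalerDl !scalerA; zmod.
  apply: below_lin; first by apply: below_le h1; apply: leq_maxl.
  by apply: below_le h2; apply: leq_maxr.
move=> hu; apply: (hu Q hQ); apply: words_spanned => // -[|x w] pw lw.
  by exists 1, 0, 0%N; rewrite scale1r addr0.
exists 0, (word_op (x :: w) v), (drop_of (x :: w)); rewrite scale0r add0r; split=> //.
apply: below_eigen; last exact: height_op_word.
by move: lw => /=/andP[h _]; rewrite /drop_of /= addn_gt0 subn_gt0 h.
Qed.

Lemma word_homogeneous w e : positive_word w -> homogeneous e v ->
  exists e', homogeneous e' (word_op w v).
Proof.
move=> + ve; elim: w => [_|[r [a b]] w IH /= /andP[r0 /IH[e' he']]]; first by exists e.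
by exists (e' (+) (par a (+) par b)); apply: Y_T_parity.
Qed.

Lemma cyclic_span_invariant e : homogeneous e v ->
  invariant_subspace op cyclic_span.
Proof.
move=> ve; have [S0 SL] := cyclic_span_subspace; split => //.
- move=> d u hu; apply: (hu (fun u => cyclic_span (hpart V d u))).
    by split=> [|c x y]; rewrite ?linear0 // linearP; apply: SL.
  move=> w pw; have [e' he'] := word_homogeneous pw ve.
  rewrite -he' hpart_comp; case: eqP => _ //.
  by rewrite he'; apply: cyclic_span_word.
move=> [r [a b]] u hu; case: (posnP r) => [->|r0].
  by rewrite /Y_op /= Y_T0; apply: (subspaceZ _ cyclic_span_subspace).
apply: (hu (fun u => cyclic_span (op (r, (a, b)) u))).
  split=> [|c x y]; last by rewrite Y_opP; apply: SL.
  by rewrite /Y_op /= linear0.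
move=> w pw; apply: (@cyclic_span_word ((r, (a, b)) :: w)).
by rewrite /positive_word /= r0.
Qed.

End HighestWeightWords.

(** * Irreducible modules of any highest weight *)

Section EvaluationWords.
Variables (K : numFieldType) (M N : nat).
Local Notation I := 'I_(M + N).

(** Modules over gl(M|N) are studied through their evaluation representations,
    so that the results on words serve for both algebras. *)
Lemma ev_op_intertwines (pi pi' : gl_rep K M N) (f : {linear pi -> pi'}) :
  (forall a b u, f (gl_E pi a b u) = gl_E pi' a b (f u)) ->
  forall x u, f (Y_op (V := ev_Y pi) x u) = Y_op (V := ev_Y pi') x (f u).
Proof.
move=> fE [[|[|r]] [a b]] u; rewrite /Y_op /=; first by rewrite linearZ.
  exact: fE.
by rewrite linear0.
Qed.

Lemma word_op_intertwines (V V' : yangian_rep K M N) (f : V -> V') :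
  (forall x u, f (Y_op x u) = Y_op x (f u)) ->
  forall w u, f (word_op w u) = word_op w (f u).
Proof. by move=> fE w u; elim: w => [|x w IH] //=; rewrite fE IH. Qed.

Lemma ev_invariant (pi : gl_rep K M N) (S : pi -> Prop) :
  invariant_subspace (@Y_op _ _ _ (ev_Y pi)) S
  <-> invariant_subspace (@gl_op _ _ _ pi) S.
Proof.
split=> -[S0 SL Sh SA]; split => //.
  by move=> [a b] v; apply: (SA (1%N, (a, b))).
move=> [[|[|r]] [a b]] v Sv; rewrite /Y_op /=; last exact: S0.
  by rewrite -[_ *: _]addr0; apply: SL.
exact: (SA (a, b)).
Qed.

Definition ev_weight (lam : I -> K) (r : nat) (a : I) : K :=
  if r is 1 then lam a else 0.

Lemma ev_hw (pi : gl_rep K M N) (v : pi) lam :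
  (forall a b : I, (a < b)%N -> gl_E pi a b v = 0) ->
  (forall a, gl_E pi a a v = lam a *: v) ->
  hw_vector (V := ev_Y pi) v (ev_weight lam).
Proof.
move=> v1 v2; split=> [[|[|r]] a b //= _ ab|[|[|r]] a //= _]; first exact: v1.
by rewrite scale0r.
Qed.
End EvaluationWords.

Section Irreducible.
Variables (K : numFieldType) (M N : nat) (lam : 'I_(M + N) -> K) (e : bool).
Local Notation I := 'I_(M + N).

(** The vectors u such that l vanishes on the homogeneous components of all
    images of u under words form an invariant subspace, the radical.  Modulo
    the radical, take the span of the highest weight vector v.  An invariant
    subspace that is not 0 contains some g with l g <> 0; as l vanishes on all
    vectors of lower height, the component of g along v is not zero, and it
    lies in the subspace by [below_project]. *)
Lemma irreducible_hw_exists :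
  exists (pi : gl_rep K M N) (v : pi) (l : {linear pi -> K^o}),
    [/\ irreducible (@gl_op _ _ _ pi), homogeneous e v, l v = 1,
        hw_vector (V := ev_Y pi) v (ev_weight lam)
      & forall S, invariant_subspace (@gl_op _ _ _ pi) S -> S v -> forall u, S u].
Proof.
have [pi0 [v0 [l0 [he0 hlt0 hdiag0 l01 l0E]]]] := weight_module_exists lam e.
pose A0 (x : I * I) : {linear pi0 -> pi0} := gl_E pi0 x.1 x.2.
pose Y0 := ev_Y pi0.
pose rad (u : pi0) := forall w d, positive_word w ->
  l0 (hpart pi0 d (word_op (V := Y0) w u)) = 0.
have word0 w : word_op (V := Y0) w 0 = 0.
  by have := word_opP w (-1) (0 : Y0) 0; rewrite scaler0 addr0 scaleN1r addNr.
have rad_inv : invariant_subspace A0 rad.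
  split.
  - by move=> w d _; rewrite word0 !linear0.
  - move=> c u v hu hv w d pw.
    by rewrite (word_opP w c (u : Y0) v) !linearP /= hu // hv // scaler0 addr0.
  - move=> d u hu w d' pw.
    have [d'' ->] : exists d'', word_op (V := Y0) w (hpart pi0 d u)
        = hpart pi0 d'' (word_op (V := Y0) w u).
      elim: w pw => [_|[r [a b]] w IH /= /andP[r0 /IH[d'' ->]]]; first by exists d.
      exists (d'' (+) (par a (+) par b)); apply: has_parity_hpart.
      exact: (Y_T_parity (y := Y0)).
    by rewrite hpart_comp; case: eqP => _; [apply: hu|rewrite linear0].
  - move=> [a b] u hu w d pw.
    have := hu (rcons w (1%N, (a, b))) d; rewrite -cats1 word_op_cat; apply.
    by rewrite /positive_word all_cat /= andbT.
have [U [B [q [qs qrad qh qA]]]] := super_quot rad_inv.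
have qE a b u : q (gl_E pi0 a b u) = B (a, b) (q u) by exact: (qA (a, b)).
have Bpar a b : has_parity (par a (+) par b) (B (a, b)).
  exact: (quot_parity qs qh (qA (a, b)) (gl_E_parity a b)).
have Brel a b c d v : supercomm (par a (+) par b) (par c (+) par d)
      (B (a, b)) (B (c, d)) v
    = (c == b)%:R *: B (a, d) v
      - (-1) ^+ ((par a (+) par b) && (par c (+) par d))
          *: ((a == d)%:R *: B (c, b) v).
  have [u <-] := qs v; have := congr1 q (gl_E_rel (g := pi0) a b c d u).
  by rewrite /supercomm !linearB !linearZ /= !linearZ /= !qE.
pose piQ := @GlRep K M N U (fun a b => B (a, b)) Bpar Brel.
have [l1 l1E] : exists l1 : {linear piQ -> K^o}, forall u, l1 (q u) = l0 u.
  apply: factor_surj => // u /qrad hu.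
  by rewrite -[u]hpart_sum linearD /= !(hu [::]) // addr0.
have qY x u : q (Y_op (V := Y0) x u) = Y_op (V := ev_Y piQ) x (q u).
  by apply: (@ev_op_intertwines K M N pi0 piQ q) => a b w; apply: (qA (a, b)).
pose vQ : piQ := q v0.
have vQ_hw : hw_vector (V := ev_Y piQ) vQ (ev_weight lam).
  apply: ev_hw => [a b ab|a].
    by rewrite -[LHS](qA (a, b)) /A0 /= hlt0 // linear0.
  by rewrite -[LHS](qA (a, a)) /A0 /= hdiag0 linearZ.
have vQ_hom : homogeneous e vQ by rewrite /homogeneous -qh he0.
pose AQ (x : I * I) : {linear piQ -> piQ} := gl_E piQ x.1 x.2.
have span_inv : invariant_subspace AQ (cyclic_span (V := ev_Y piQ) vQ).
  apply: (ev_invariant (pi := piQ) _).1.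
  exact: (cyclic_span_invariant (V := ev_Y piQ) vQ_hom).
have [L [C [j [jinj jS jh jA]]]] := super_sub span_inv.
have Cpar a b : has_parity (par a (+) par b) (C (a, b)).
  exact: (sub_parity jinj jh (jA (a, b)) (gl_E_parity (g := piQ) a b)).
have Crel a b c d v : supercomm (par a (+) par b) (par c (+) par d)
      (C (a, b)) (C (c, d)) v
    = (c == b)%:R *: C (a, d) v
      - (-1) ^+ ((par a (+) par b) && (par c (+) par d))
          *: ((a == d)%:R *: C (c, b) v).
  apply: jinj; rewrite /supercomm [LHS]linearB [X in _ - X = _]linearZ /=.
  rewrite [RHS]linearB [X in _ = X - _]linearZ [X in _ = _ - X]linearZ /=.
  rewrite [X in _ = _ - _ *: X]linearZ /= !jA.
  exact: (gl_E_rel (g := piQ)).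
pose pi := @GlRep K M N L (fun a b => C (a, b)) Cpar Crel.
have jE a b u : j (gl_E pi a b u) = gl_E piQ a b (j u) by exact: (jA (a, b)).
have jY x u : j (Y_op (V := ev_Y pi) x u) = Y_op (V := ev_Y piQ) x (j u).
  exact: (@ev_op_intertwines K M N pi piQ j).
have [v vE] := (jS vQ).1 (@cyclic_span_hw _ _ _ (ev_Y piQ) vQ).
pose l : {linear pi -> K^o} := l1 \o j.
have lv : l v = 1 by rewrite /l /= vE l1E.
have v_hw : hw_vector (V := ev_Y pi) v (ev_weight lam).
  apply: ev_hw => [a b ab|a]; apply: jinj; rewrite jE vE ?linear0 ?linearZ /= ?vE.
    exact: (vQ_hw.1 1%N).
  exact: (vQ_hw.2 1%N).
have v_hom : homogeneous e v by apply: jinj; rewrite jh vE.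
have all_span u : cyclic_span (V := ev_Y pi) v u.
  suff [u' [/jinj-> //]] : exists u', j u' = j u /\ cyclic_span (V := ev_Y pi) v u'.
  apply: ((jS (j u)).2 (ex_intro _ u erefl) (fun z => exists u', j u' = z /\ _)).
    have [S0 SL] := cyclic_span_subspace (V := ev_Y pi) v.
    split=> [|c z z' [u1 [<- h1]] [u2 [<- h2]]]; first by exists 0; rewrite linear0.
    by exists (c *: u1 + u2); rewrite linearP; split=> //; apply: SL.
  move=> w pw; exists (word_op (V := ev_Y pi) w v); split.
    by rewrite (@word_op_intertwines K M N (ev_Y pi) (ev_Y piQ) j jY) vE.
  exact: cyclic_span_word.
have lE a u : l (gl_E pi a a u) = lam a * l u.
  rewrite /l /= jA; have [u0 <-] := qs (j u).
  by rewrite -[AQ _ _](qA (a, a)) !l1E l0E.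
have lH u : l (height_op (ev_Y pi) u) = height (ev_weight lam) *: l u.
  rewrite height_opE linear_sum /height scaler_suml; apply: eq_bigr => c _.
  transitivity ((- c%:R : K) *: l (gl_E pi c c u)); first exact: linearZ.
  by rewrite lE -scalerA.
exists pi, v, l; split => //; last first.
  move=> S hS Sv u; apply: (cyclic_span_min _ Sv (all_span u)).
  exact/ev_invariant.
split; first by exists v => v0E; move: lv; rewrite v0E linear0 => /eqP; rewrite eq_sym oner_eq0.
move=> S hS; have [|] := pselect (forall u, S u -> u = 0); first by left.
move=> /existsNP[f /not_implyP[Sf fn0]]; right.
have [f0 f0E] := qs (j f).
have : ~ rad f0 by move=> /qrad; rewrite f0E => jf; apply: fn0; apply: jinj; rewrite jf linear0.
move=> /existsNP[w /existsNP[d /not_implyP[pw lw]]].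
have hS' := (ev_invariant S).2 hS; have [S0 SL Sh SA] := hS'.
pose g := hpart pi d (word_op (V := ev_Y pi) w f).
have Sg : S g.
  by apply: Sh; elim: (w) => [|x w' IH] //=; apply: SA.
have lg : l g <> 0.
  rewrite /l /= jh (@word_op_intertwines K M N (ev_Y pi) (ev_Y piQ) j jY) -f0E.
  rewrite -(@word_op_intertwines K M N Y0 (ev_Y piQ) q qY) -qh l1E.
  exact: lw.
have [c [u' [m [gE hu']]]] := cyclic_span_decomp v_hw (all_span g).
have cn0 : c != 0.
  apply/eqP => c0; apply: lg; rewrite gE c0 scale0r add0r.
  exact: (below_functional lH hu').
have Ssub : subspace S by split.
have Scv : S (c *: v).
  apply: (below_project Ssub _ _ hu'); last by rewrite -gE.
    move=> z Sz; rewrite height_opE; apply: subspace_sum => // a _.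
    by apply: subspaceZ => //; apply: (SA (1%N, (a, a))).
  rewrite [LHS]linearZ -[LHS]/(c *: height_op (ev_Y pi) v).
  by rewrite (height_op_hw v_hw) !scalerA mulrC.
have Sv : S v.
  by rewrite -[v]scale1r -(mulVf cn0) -scalerA; apply: subspaceZ.
by move=> u; apply: (cyclic_span_min hS' Sv (all_span u)).
Qed.
End Irreducible.

(** * Highest weight vectors in finite dimension *)

Section Eigenvectors.
Variables (K : numClosedFieldType) (V : lmodType K).
Hypothesis hfd : finite_dimensional V.

(** The vectors T^i s, i <= n, are dependent, so some polynomial q <> 0 in T
    kills s.  Splitting off linear factors one at a time, one meets a last
    nonzero vector, on which the next factor T - a vanishes. *)
Lemma eigenvector_exists (T : {linear V -> V}) (S : V -> Prop) s :
  subspace S -> (forall v, S v -> S (T v)) -> S s -> s <> 0 ->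
  exists v mu, [/\ S v, v <> 0 & T v = mu *: v].
Proof.
move=> hS ST Ss sn0; have [n [f [f' fK _]]] := hfd.
pose L (q : {poly K}) : V := \sum_(i < n.+1) q`_i *: iter i T s.
have L_lin c (q q' : {poly K}) : L (c *: q + q') = c *: L q + L q'.
  rewrite /L scaler_sumr -big_split; apply: eq_bigr => i _ /=.
  by rewrite coefD coefZ scalerDl scalerA.
have S_L (q : {poly K}) : S (L q).
  apply: subspace_sum => // i _; apply: subspaceZ => //.
  by elim: (nat_of_ord i) => //= k; apply: ST.
have L_X (q : {poly K}) a : (size q <= n)%N -> L (q * ('X - a%:P)) = T (L q) - a *: L q.
  move=> sq; have -> : q * ('X - a%:P) = (- a) *: q + q * 'X.
    by rewrite mulrBr addrC mulrC mul_polyC scaleNr.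
  rewrite L_lin scaleNr addrC; congr (_ - _).
  rewrite /L big_ord_recl coefMX /= scale0r add0r linear_sum big_ord_recr /=.
  rewrite (nth_default 0 sq) scale0r linear0 addr0; apply: eq_bigr => i _.
  by rewrite coefMX /= linearZ.
have [q [qn0 sq Lq]] : exists q : {poly K}, [/\ q != 0, (size q <= n.+1)%N & L q = 0].
  pose A := \matrix_(i < n.+1) f (iter i T s).
  have : kermx A != 0.
    rewrite kermx_eq0 /row_free neq_ltn ltnS.
    by rewrite (leq_trans (rank_leq_col A)).
  move=> /rowV0Pn[c /sub_kermxP cA cn0].
  exists (\poly_(i < n.+1) c 0 (inord i)); split; last 1 first.
  - apply: (can_inj fK); rewrite linear0 -[RHS]cA mulmx_sum_row linear_sum.
    by apply: eq_bigr => i _; rewrite linearZ /= rowK coef_poly ltn_ord inord_val.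
  - apply: contra_neq cn0 => q0; apply/rowP => i; rewrite mxE.
    by have := coef_poly n.+1 (fun i => c 0 (inord i)) i;
      rewrite q0 coef0 ltn_ord inord_val.
  - exact: size_poly.
have [k] := ubnP (size q); elim: k => // k IH in q qn0 sq Lq *.
move=> qk; have [sq1|sq1] := leqP (size q) 1.
  move: Lq; rewrite (size1_polyC sq1) /L big_ord_recl /= coefC eqxx big1 => [|i _].
    rewrite addr0 => /eqP; rewrite scaler_eq0 => /orP[/eqP q0|/eqP //].
    by move: qn0; rewrite (size1_polyC sq1) q0 polyC0 eqxx.
  by rewrite coefC scale0r.
have [a /factor_theorem[q1 qE]] : exists a, root q a.
  by apply/closed_rootP; rewrite neq_ltn sq1 orbT.
have q1n0 : q1 != 0 by apply: contra_neq qn0 => q10; rewrite qE q10 mul0r.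
have sq1E : size q = (size q1).+1.
  by rewrite qE size_Mmonic ?monicXsubC // size_XsubC addn2.
have sq1n : (size q1 <= n)%N by rewrite -ltnS -sq1E.
have [L1|/eqP L1] := eqVneq (L q1) 0.
  by apply: (IH q1) => //; [apply: leqW|rewrite -ltnS -sq1E].
exists (L q1), a; split => //.
by apply/eqP; rewrite -subr_eq0 -L_X // -qE Lq.
Qed.

Lemma common_eigenvector (J : eqType) (r : seq J) (T : J -> {linear V -> V})
    (S : V -> Prop) s :
  subspace S -> (forall j v, S v -> S (T j v)) ->
  (forall i j v, S v -> T i (T j v) = T j (T i v)) -> S s -> s <> 0 ->
  exists v, [/\ S v, v <> 0 & forall j, j \in r -> exists mu, T j v = mu *: v].
Proof.
move=> hS ST Tc Ss sn0; elim: r => [|j r IH] in S s hS ST Tc Ss sn0 *.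
  by exists s.
have [v [mu [Sv vn0 vE]]] := eigenvector_exists hS (ST j) Ss sn0.
have [|||u [[Su uE] un0 uT]] :=
  IH (fun w => S w /\ T j w = mu *: w) v _ _ _ (conj Sv vE) vn0.
- split=> [|c x y [Sx xE] [Sy yE]].
    by split; [case: hS|rewrite linear0 scaler0].
  split; first by case: hS => _; apply.
  by rewrite linearP xE yE scalerDr !scalerA mulrC.
- move=> i w [Sw wE]; split; first exact: ST.
  by rewrite Tc // wE linearZ.
- by move=> i k w [Sw _]; apply: Tc.
exists u; split => // i; rewrite inE => /orP[/eqP->|/uT//].
by exists mu.
Qed.

Lemma eigenvalues_finite (T : {linear V -> V}) :
  exists q : {poly K}, q != 0 /\
    forall v mu, v <> 0 -> T v = mu *: v -> root q mu.
Proof.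
have [n [f fb]] := hfd; have [f' fK f'K] := fb.
have lf' : linear f' by apply: (can2_linear fK f'K).
have [g gE] := mklinear lf'.
pose A := lin1_mx (f \o T \o g).
exists (char_poly A); split; first exact/monic_neq0/char_poly_monic.
move=> v mu vn0 vE; rewrite -eigenvalue_root_char; apply/eigenvalueP.
exists (f v); first by rewrite mul_rV_lin1 /= gE fK vE linearZ.
by apply/eqP => fv0; apply: vn0; rewrite -[v]fK fv0 -gE linear0.
Qed.
End Eigenvectors.

Section FiniteDimensional.
Variables (K : numClosedFieldType) (M N p : nat) (V : W_rep K M N p).
Local Notation I := 'I_(M + N).
Local Notation T := (Y_T V).
Hypothesis hfd : finite_dimensional V.

Definition singular (v : V) : Prop :=
  forall r (a b : I), (0 < r)%N -> (a < b)%N -> T r a b v = 0.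

Lemma singular_subspace : subspace singular.
Proof.
split=> [r a b _ _|c u v hu hv r a b r0 ab]; first by rewrite linear0.
by rewrite linearP hu // hv // scaler0 addr0.
Qed.

(** If no nonzero vector is killed by all raising operators, then an eigenvector
    of the height can be raised again and again, its eigenvalue growing by a
    positive integer each time, and the height has infinitely many
    eigenvalues. *)
Lemma singular_exists : (exists v : V, v <> 0) -> exists v, singular v /\ v <> 0.
Proof.
move=> [v0 v0n0]; have [//|no] := pselect (exists v, singular v /\ v <> 0).
have [q [qn0 hq]] := eigenvalues_finite hfd (height_op V).
suff H k : exists v mu (l : seq K), [/\ v <> 0, height_op V v = mu *: v,
    uniq l, size l = k & all (root q) l /\
    forall z, z \in l -> exists j : nat, z = mu - j.+1%:R].
  have [v [mu [l [_ _ ul sl [rl _]]]]] := H (size q).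
  by have := max_poly_roots qn0 rl ul; rewrite sl ltnn.
elim: k => [|k [v [mu [l [vn0 vE ul sl [rl hl]]]]]].
  have S1 : subspace (fun _ : V => True) by split.
  have [v [mu [_ vn0 vE]]] := eigenvector_exists hfd (T := height_op V) S1 (fun _ _ => Logic.I) Logic.I v0n0.
  by exists v, mu, [::].
have : ~ singular v by move=> sv; apply: no; exists v.
move=> /existsNP[r /existsNP[a /existsNP[b /not_implyP[r0 /not_implyP[ab hT]]]]].
exists (T r a b v), (mu + (b - a)%N%:R), (mu :: l); split => //.
- rewrite height_op_T // vE linearZ /= -scalerDl natrB //; exact: ltnW.
- rewrite /= ul andbT; apply/negP => /hl[j] /eqP.
  by rewrite -subr_eq0 opprB addrC subrK pnatr_eq0.
- by rewrite /= sl.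
split; first by rewrite /= rl (hq v).
move=> z; rewrite inE => /orP[/eqP->|/hl[j ->]].
  exists (b - a).-1; rewrite prednK ?subn_gt0 // addrK //.
exists ((b - a) + j)%N; rewrite -addnS natrD.
by zmod.
Qed.

(** By induction on the total degree.  Exchanging T^{ab} and T^{cc} leaves
    T^{ab} or T^{ac} applied to v and quadratic terms of smaller total degree.
    For c = a these are T^{ab} T^{aa} v, for c > a they begin with T^{ac}
    applied to v, and for c < a they are of the form T^{cb} T^{ac} v, where a
    further exchange produces only terms T^{ab} v and T^{ab} T^{cc} v. *)
Lemma singular_cartan_stable m n (a b c : I) v : singular v ->
  (0 < m)%N -> (0 < n)%N -> (a < b)%N -> T m a b (T n c c v) = 0.
Proof.
move=> sv; have [d] := ubnP (m + n)%N; elim: d m n a b c => // d IH m n a b c md.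
move=> m0 n0 ab; rewrite Y_swap // (sv m a b) // linear0 scaler0 addr0.
have Z (z : V) (r : K) : z = 0 -> r *: z = 0 by move=> ->; rewrite scaler0.
have nab : (a == b) = false by apply/eqP => E; move: ab; rewrite E ltnn.
have [ca|ac|/val_inj ca] := ltngtP c a.
- have cb : (c < b)%N by apply: ltn_trans ab.
  have -> : (c == b) = false by apply/eqP => E; move: cb; rewrite E ltnn.
  have -> : (a == c) = false by apply/eqP => E; move: ca; rewrite E ltnn.
  rewrite !scale0r scaler0 subr0 add0r; apply: (Z).
  have key x y : (0 < x)%N -> (0 < y)%N -> (x + y < d)%N ->
      T x c b (T y a c v) = 0.
    move=> x0 y0 xy; rewrite Y_swap // (sv x c b) // linear0 scaler0 addr0.
    rewrite nab scale0r sub0r (sv _ a b) ?scaler0 ?oppr0 ?add0r //; last by lia.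
    rewrite ?scaler0 ?oppr0 ?add0r; apply: (Z).
    rewrite big_nat big1 // => r; rewrite leq_min => /and3P[r1 rx ry].
    by rewrite !IH ?subr0 //; lia.
  rewrite big_nat big1 // => r; rewrite leq_min => /and3P[r1 rm rn].
  by rewrite !key ?subr0 //; lia.
- have -> : (a == c) = false by apply/eqP => E; move: ac; rewrite E ltnn.
  rewrite scale0r scaler0 subr0 (sv _ a c) //; last by lia.
  rewrite scaler0 add0r; apply: (Z).
  rewrite big_nat big1 // => r; rewrite leq_min => /and3P[r1 rm rn].
  by rewrite !(sv _ a c) ?linear0 ?subr0 ?addr0 //; lia.
rewrite ca eqxx nab scale0r sub0r (sv _ a b) //; last by lia.
rewrite !scaler0 oppr0 add0r; apply: (Z).
rewrite big_nat big1 // => r; rewrite leq_min => /and3P[r1 rm rn].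
by rewrite !IH ?subr0 //; lia.
Qed.

Lemma singular_stable n c v : (0 < n)%N -> singular v -> singular (T n c c v).
Proof. by move=> n0 sv r a b r0 ab; apply: singular_cartan_stable. Qed.

(** For a < b every term of the commutator begins with some T^{ab} applied to
    v; for a = b the commutator is a sum of commutators of smaller total
    degree. *)
Lemma singular_cartan_comm m n (a b : I) v : singular v ->
  (0 < m)%N -> (0 < n)%N -> T m a a (T n b b v) = T n b b (T m a a v).
Proof.
have Z (z : V) (r : K) : z = 0 -> r *: z = 0 by move=> ->; rewrite scaler0.
have lt x y (c e : I) w : singular w -> (c < e)%N -> (0 < x)%N -> (0 < y)%N ->
    T x c c (T y e e w) = T y e e (T x c c w).
  move=> sw ce x0 y0; rewrite Y_swap // addbb expr0 !scale1r -[RHS]add0r; congr (_ + _).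
  have nce : (c == e) = false by apply/eqP => E; move: ce; rewrite E ltnn.
  rewrite [e == c]eq_sym nce !scale0r subr0 add0r; apply: (Z).
  rewrite big_nat big1 // => r; rewrite leq_min => /and3P[r1 rx ry].
  by rewrite !(sw _ c e) ?linear0 ?subr0 ?addr0 //; lia.
have [ab|ba|/val_inj->] := ltngtP a b; move=> sv m0 n0.
- exact: lt.
- by apply/esym; apply: lt.
have [d] := ubnP (m + n)%N; elim: d m n m0 n0 => // d IH m n m0 n0 md.
rewrite Y_swap // addbb expr0 !scale1r -[RHS]add0r; congr (_ + _).
rewrite eqxx !scale1r subrr add0r; apply: (Z).
rewrite big_nat big1 // => r; rewrite leq_min => /and3P[r1 rx ry].
by rewrite IH ?subrr //; lia.
Qed.

(** The T^{aa}_(r) commute on the singular vectors and preserve them, so they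
    have a common eigenvector there.  They are even, and the raising operators
    have a parity, so its homogeneous components have the same properties. *)
Lemma hw_vector_exists : (exists v : V, v <> 0) ->
  exists (v : V) (e : bool) lam,
    [/\ v <> 0, homogeneous e v & hw_vector (V := V) v lam].
Proof.
move=> /singular_exists[s [ss sn0]].
pose C (j : nat * I) : {linear V -> V} := T j.1.+1 j.2 j.2.
have [||u [su un0 uE]] := common_eigenvector hfd [seq (r, a) | r <- iota 0 p, a <- enum I]
  (T := C) singular_subspace _ _ ss sn0.
- by move=> j v; apply: singular_stable.
- by move=> i j v sv; apply: singular_cartan_comm.
have [e ue] : exists e, hpart V e u <> 0.
  apply: contrapT => no; apply: un0; rewrite -[u]hpart_sum.
  have h e : hpart V e u = 0 by apply: contrapT => he; apply: no; exists e.
  by rewrite !h addr0.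
have eig r a : exists mu, (0 < r)%N -> T r a a u = mu *: u.
  case: r => [|r]; first by exists 0.
  have [rp|pr] := ltnP r p; last first.
    by exists 0 => _; rewrite scale0r; apply: W_trunc.
  have [|mu muE] := uE (r, a); last by exists mu.
  by apply/allpairsP; exists (r, a); rewrite mem_iota mem_enum.
have /choice[lam lamE] : forall x : nat * I, exists mu, (0 < x.1)%N ->
    T x.1 x.2 x.2 u = mu *: u by move=> [r a]; apply: eig.
exists (hpart V e u), e, (fun r a => lam (r, a)); split => //.
  exact: hpart_homogeneous.
split=> [r a b r0 ab|r a r0].
  by rewrite (has_parity_hpart _ _ (Y_T_parity _ _ r0)) su // linear0.
rewrite (has_parity_hpart _ _ (Y_T_parity _ _ r0)) addbb addbF.
by rewrite (lamE (r, a)) // linearZ.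
Qed.
End FiniteDimensional.

(** * Representations with the same highest weight *)

Section Pairs.
Variables (K : fieldType) (V W : lmodType K).

Definition pair_map (f : {linear V -> V}) (g : {linear W -> W}) (x : V * W) :=
  (f x.1, g x.2).

Fact pair_map_linear f g : linear (pair_map f g).
Proof. by move=> c x y; rewrite /pair_map /= !linearP. Qed.

HB.instance Definition _ f g :=
  GRing.isLinear.Build K (V * W)%type (V * W)%type *:%R (pair_map f g)
    (pair_map_linear f g).
End Pairs.

Section DirectSum.
Variables (K : numFieldType) (M N p : nat) (V W : W_rep K M N p).
Local Notation D := (V * W)%type.
Local Notation I := 'I_(M + N).

Let h e : {linear D -> D} := pair_map (hpart V e) (hpart W e).

Let h_comp d e (x : D) : h d (h e x) = if d == e then h e x else 0.
Proof.
rewrite -[LHS]/(hpart V d (hpart V e x.1), hpart W d (hpart W e x.2)).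
by rewrite !hpart_comp; case: eqP.
Qed.

Let h_sum (x : D) : h false x + h true x = x.
Proof.
case: x => x y.
rewrite -[LHS]/(hpart V false x + hpart V true x, hpart W false y + hpart W true y).
by rewrite !hpart_sum.
Qed.

Let X : superspace K := Superspace h_comp h_sum.
Let T r (a b : I) : {linear X -> X} := pair_map (Y_T V r a b) (Y_T W r a b).

Let T_E r a b (x : X) : T r a b x = (Y_T V r a b x.1, Y_T W r a b x.2).
Proof. by []. Qed.

Let T0 a b (x : X) : T 0 a b x = (a == b)%:R *: x.
Proof. by rewrite T_E !Y_T0; case: x. Qed.

Let T_parity n a b : (0 < n)%N -> has_parity (par a (+) par b) (T n a b).
Proof.
move=> n0 d x xd; have x1 : homogeneous d x.1 by have := congr1 fst xd.
have x2 : homogeneous d x.2 by have := congr1 snd xd.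
by congr pair; apply: Y_T_parity.
Qed.

Let T_rel m n a b c d (x : X) : (0 < m)%N -> (0 < n)%N ->
  supercomm (par a (+) par b) (par c (+) par d) (T m a b) (T n c d) x
    = (c == b)%:R *: T (m + n - 1) a d x
      - (-1) ^+ ((par a (+) par b) && (par c (+) par d))
          *: ((a == d)%:R *: T (m + n - 1) c b x)
      + (-1) ^+ ((par c && (par a (+) par b)) (+) (par a && par b))
          *: \sum_(1 <= r < minn m n)
               (T r c b (T (m + n - 1 - r) a d x)
                - T (m + n - 1 - r) c b (T r a d x)).
Proof.
move=> m0 n0; apply: injective_projections.
  rewrite [X in _ = X](_ : _ = (c == b)%:R *: Y_T V (m + n - 1) a d x.1
      - (-1) ^+ ((par a (+) par b) && (par c (+) par d))
          *: ((a == d)%:R *: Y_T V (m + n - 1) c b x.1)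
      + (-1) ^+ ((par c && (par a (+) par b)) (+) (par a && par b))
          *: \sum_(1 <= r < minn m n)
               (Y_T V r c b (Y_T V (m + n - 1 - r) a d x.1)
                - Y_T V (m + n - 1 - r) c b (Y_T V r a d x.1))).
    exact: Y_T_rel.
  by congr (_ + _ *: _); exact: (raddf_sum (@fst V W)).
rewrite [X in _ = X](_ : _ = (c == b)%:R *: Y_T W (m + n - 1) a d x.2
    - (-1) ^+ ((par a (+) par b) && (par c (+) par d))
        *: ((a == d)%:R *: Y_T W (m + n - 1) c b x.2)
    + (-1) ^+ ((par c && (par a (+) par b)) (+) (par a && par b))
        *: \sum_(1 <= r < minn m n)
             (Y_T W r c b (Y_T W (m + n - 1 - r) a d x.2)
              - Y_T W (m + n - 1 - r) c b (Y_T W r a d x.2))).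
  exact: Y_T_rel.
by congr (_ + _ *: _); exact: (raddf_sum (@snd V W)).
Qed.

Let T_trunc n a b (x : X) : (p < n)%N -> T n a b x = 0.
Proof. by move=> pn; rewrite T_E !W_trunc. Qed.

Lemma direct_sum_exists :
  exists (U : W_rep K M N p) (p1 : {linear U -> V}) (p2 : {linear U -> W})
      (pr : V -> W -> U),
    [/\ intertwiner (@Y_op _ _ _ U) (@Y_op _ _ _ V) p1,
        intertwiner (@Y_op _ _ _ U) (@Y_op _ _ _ W) p2,
        forall v w, p1 (pr v w) = v, forall v w, p2 (pr v w) = w
      & forall x y, p1 x = p1 y -> p2 x = p2 y -> x = y].
Proof.
exists (@WRep K M N p (YangianRep T0 T_parity T_rel) T_trunc).
by exists fst, snd, pair; split => // -[x x'] [y y'] /= -> ->.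
Qed.
End DirectSum.

Lemma sub_rep (K : numFieldType) (M N p : nat) (V : W_rep K M N p) (S : V -> Prop) :
  invariant_subspace (@Y_op _ _ _ V) S ->
  exists (U : W_rep K M N p) (j : {linear U -> V}),
    [/\ injective j, forall v, S v <-> exists u, j u = v
      & intertwiner (@Y_op _ _ _ U) (@Y_op _ _ _ V) j].
Proof.
move=> hS; pose A x : {linear V -> V} := Y_T V x.1 x.2.1 x.2.2.
have [U [B [j [jinj jS jh jA]]]] := super_sub (A := A) hS.
have Bpar n a b : (0 < n)%N -> has_parity (par a (+) par b) (B (n, (a, b))).
  by move=> n0; exact: (sub_parity jinj jh (jA (n, (a, b))) (Y_T_parity a b n0)).
have jB n a b u : j (B (n, (a, b)) u) = Y_T V n a b (j u) by rewrite jA.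
have B0 a b u : B (0%N, (a, b)) u = (a == b)%:R *: u.
  by apply: jinj; rewrite jB Y_T0 linearZ.
have Brel m n a b c d u : (0 < m)%N -> (0 < n)%N ->
    supercomm (par a (+) par b) (par c (+) par d) (B (m, (a, b))) (B (n, (c, d))) u
    = (c == b)%:R *: B ((m + n - 1)%N, (a, d)) u
      - (-1) ^+ ((par a (+) par b) && (par c (+) par d))
          *: ((a == d)%:R *: B ((m + n - 1)%N, (c, b)) u)
      + (-1) ^+ ((par c && (par a (+) par b)) (+) (par a && par b))
          *: \sum_(1 <= r < minn m n)
               (B (r, (c, b)) (B ((m + n - 1 - r)%N, (a, d)) u)
                - B ((m + n - 1 - r)%N, (c, b)) (B (r, (a, d)) u)).
  move=> m0 n0; apply: jinj.
  transitivity (supercomm (par a (+) par b) (par c (+) par d)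
      (Y_T V m a b) (Y_T V n c d) (j u)).
    by rewrite /supercomm linearB [X in _ - X = _]linearZ /= !jB.
  rewrite Y_T_rel // linearD linearB; congr (_ - _ + _).
  - by rewrite linearZ /= jB.
  - by rewrite [RHS]linearZ /= [X in _ = _ *: X]linearZ /= jB.
  rewrite [RHS]linearZ /= [X in _ = _ *: X]linear_sum; congr (_ *: _); apply: eq_bigr => r _.
  by rewrite [RHS]linearB /= !jB.
have Btr n a b u : (p < n)%N -> B (n, (a, b)) u = 0.
  by move=> pn; apply: jinj; rewrite jB W_trunc // linear0.
pose Y := @YangianRep K M N U (fun n a b => B (n, (a, b))) B0 Bpar Brel.
exists (@WRep K M N p Y Btr), j; split => //.
by split => // -[n [a b]] u; exact: jB.
Qed.

Lemma preim_invariant (K : numFieldType) (V W : superspace K) (I : Type)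
    (A : I -> V -> V) (B : I -> W -> W) (f : {linear V -> W}) (S : W -> Prop) :
  intertwiner A B f -> invariant_subspace B S ->
  invariant_subspace A (fun v => S (f v)).
Proof.
move=> [fh fA] [S0 SL Sh SB]; split=> [|c u v su sv|e v sv|i v sv].
- by rewrite linear0.
- by rewrite linearP; apply: SL.
- by rewrite fh; apply: Sh.
- by rewrite fA; apply: SB.
Qed.

(** The subquotient is the subrepresentation of W + V generated by (w, v).  If
    its projection to W is not injective, the irreducibility of V puts (0, v)
    into it.  By [cyclic_span_decomp], (0, v) = c (w, v) + y with y below the
    height of (w, v); but y is an eigenvector of that same height, so y = 0,
    and w <> 0 forces c = 0 and v = 0. *)
Lemma subquotient_of_hw (K : numFieldType) (M N p : nat) (V W : W_rep K M N p)
    (v : V) (w : W) e lam :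
  irreducible (@Y_op _ _ _ V) -> v <> 0 -> w <> 0 ->
  homogeneous e v -> homogeneous e w ->
  hw_vector (V := V) v lam -> hw_vector (V := W) w lam ->
  isomorphic_to_subquotient V W.
Proof.
move=> [_ irr] vn0 wn0 ve we vhw whw.
have [D [p1 [p2 [pr [p1i p2i p1E p2E pext]]]]] := direct_sum_exists W V.
have [[p1h p1A] [p2h p2A]] := (p1i, p2i).
have p1T r a b x : p1 (Y_T D r a b x) = Y_T W r a b (p1 x) by apply: (p1A (r, (a, b))).
have p2T r a b x : p2 (Y_T D r a b x) = Y_T V r a b (p2 x) by apply: (p2A (r, (a, b))).
have pr_hw w' v' : hw_vector (V := W) w' lam -> hw_vector (V := V) v' lam ->
    hw_vector (V := D) (pr w' v') lam.
  move=> [w1 w2] [v1 v2]; split=> [r a b r0 ab|r a r0]; apply: pext.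
  - by rewrite p1T p1E w1 // linear0.
  - by rewrite p2T p2E v1 // linear0.
  - by rewrite p1T linearZ /= !p1E w2.
  - by rewrite p2T linearZ /= !p2E v2.
have hw0 : hw_vector (V := W) 0 lam by split=> *; rewrite linear0 ?scaler0.
pose x := pr w v; have xhw : hw_vector (V := D) x lam by apply: pr_hw.
have xe : homogeneous e x.
  by apply: pext; rewrite ?p1h ?p2h ?p1E ?p2E.
have inv := cyclic_span_invariant (V := D) xe.
have [U [j [jinj jS [jh jA]]]] := sub_rep inv.
have Sj u : cyclic_span (V := D) x (j u) by apply/jS; exists u.
exists U, (p1 \o j), (p2 \o j).
have pr0L : linear (pr 0 : V -> D).
  by move=> c y z; apply: pext; rewrite linearP /= ?p1E ?p2E ?scaler0 ?addr0.
have [i0 i0E] := mklinear pr0L.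
have i0i : intertwiner (@Y_op _ _ _ V) (@Y_op _ _ _ D) i0.
  by split=> *; rewrite !i0E; apply: pext;
    rewrite ?p1h ?p2h ?p1A ?p2A ?p1E ?p2E /Y_op ?linear0.
split.
- by split=> *; rewrite /= ?jh ?jA ?p1h ?p1A.
- suff inj0 u : p1 (j u) = 0 -> u = 0.
    move=> u u' /= uu'; apply/eqP; rewrite -subr_eq0; apply/eqP/inj0.
    by rewrite !linearB /= uu' subrr.
  move=> ju; have jE : j u = i0 (p2 (j u)).
    by rewrite i0E; apply: pext; rewrite ?p1E ?p2E.
  have [z|all] := irr _ (preim_invariant i0i inv).
    have z0 : p2 (j u) = 0 by apply: z; rewrite -jE.
    by apply: jinj; rewrite jE z0 !linear0.
  have [c [y [m [i0v hy]]]] := cyclic_span_decomp xhw (all v).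
  have y0 : y = 0.
    apply: below_eigen_eq0 hy; rewrite (_ : y = i0 v - c *: x).
      rewrite linearB linearZ /= (height_op_hw xhw) i0E (height_op_hw (pr_hw _ _ hw0 vhw)).
      by rewrite scalerBr !scalerA mulrC.
    by rewrite i0v addrC addKr.
  move: i0v; rewrite y0 addr0 i0E => prE.
  have := congr1 p1 prE; rewrite p1E linearZ /= p1E => /esym/eqP.
  rewrite scaler_eq0 => /orP[/eqP c0|/eqP //].
  by case: vn0; have := congr1 p2 prE; rewrite p2E c0 scale0r linear0.
- by split=> *; rewrite /= ?jh ?jA ?p2h ?p2A.
have inv' : invariant_subspace (@Y_op _ _ _ V) (fun y => exists u, (p2 \o j) u = y).
  split=> [|c _ _ [u <-] [u' <-]|d _ [u <-]|i _ [u <-]].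
  - by exists 0; rewrite linear0.
  - by exists (c *: u + u'); rewrite linearP.
  - by exists (hpart U d u); rewrite /= jh p2h.
  - by exists (Y_op i u); rewrite /= jA p2A.
have [z|//] := irr _ inv'; case: vn0; apply: z.
have [u uE] := (jS x).1 (@cyclic_span_hw _ _ _ D x).
by exists u; rewrite /= uE p2E.
Qed.

(** * Realization of a highest weight on a tensor product *)

Lemma monic_split (K : closedFieldType) (p : nat) (c : nat -> K) : c 0 = 1 ->
  exists z : 'I_p -> K, forall u,
    \prod_k (u + z k) = \sum_(r < p.+1) u ^+ (p - r) * c r.
Proof.
move=> c0; pose q := \poly_(i < p.+1) c (p - i)%N.
have lq : c (p - p)%N != 0 by rewrite subnn c0 oner_neq0.
have sq : size q = p.+1 by rewrite size_poly_eq.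
have mq : lead_coef q = 1 by rewrite lead_coef_poly // subnn.
have [s sE] := closed_field_poly_normal q.
rewrite mq scale1r in sE.
have ss : size s = p by apply: succn_inj; rewrite -sq sE size_prod_XsubC.
exists (fun k => - s`_k) => u.
transitivity q.[u].
  by rewrite sE horner_prod (big_nth 0) big_mkord ss; apply: eq_bigr => k _; rewrite hornerXsubC.
rewrite horner_poly (reindex_inj rev_ord_inj); apply: eq_bigr => i _ /=.
by rewrite subSS subKn 1?mulrC // -ltnS.
Qed.

Lemma tensor_neq0 (K : numFieldType) (s : nat) (V : 'I_s -> superspace K)
    (W : lmodType K) (tau : (forall k, V k) -> W) (v : forall k, V k)
    (l : forall k, {linear V k -> K^o}) :
  is_tensor_product tau -> (forall k, l k (v k) = 1) -> tau v <> 0.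
Proof.
move=> tauP lv; have [f fE] := tensor_functional tauP l.
move=> tv0; have := fE v; rewrite tv0 linear0 big1 // => /eqP.
by rewrite eq_sym oner_eq0.
Qed.

Theorem theorem4p7 (R : realType) (M N p : nat)
    (hM : (0 < M)%N) (hN : (0 < N)%N) (hp : (0 < p)%N)
    (V : W_rep R[i] M N p)
    (hfd : finite_dimensional V)
    (hirr : irreducible (@Y_op _ _ _ V)) :
  (exists pi : gl_rep R[i] M N,
     [/\ irreducible (@gl_op _ _ _ pi), highest_weight pi
       & isomorphic V (ev pi hp)])
  \/
  (exists (s : nat) (pi : 'I_s -> gl_rep R[i] M N) (W : W_rep R[i] M N p),
     [/\ (0 < s <= p)%N,
         forall k, irreducible (@gl_op _ _ _ (pi k)) /\ highest_weight (pi k),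
         is_tensor_rep (fun k => ev (pi k) hp) W
       & isomorphic_to_subquotient V W]).
Proof.
right; have [v [e [lam [vn0 ve vhw]]]] := hw_vector_exists hfd hirr.1.
(* The coefficients of the monic polynomial q_a, by codegree. *)
pose c (a : 'I_(M + N)) r : R[i] := if r is 0 then 1 else (-1) ^+ par a * lam r a.
have /choice[z zE] : forall a, exists z : 'I_p -> R[i], forall u,
    \prod_k (u + z k) = \sum_(r < p.+1) u ^+ (p - r) * c a r.
  by move=> a; apply: monic_split.
pose mu k a := (-1) ^+ par a * z a k.
(* The highest weight vectors of the pi_k are even, except that the first one
   carries the parity of v. *)
pose d (k : 'I_p) : bool := e && (k == Ordinal hp).
have /choice[pi hpi] k := irreducible_hw_exists (mu k) (d k).
pose w k := projT1 (cid (hpi k)); have hw k := projT2 (cid (hpi k)).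
pose l k := projT1 (cid (hw k)).
have hl k : [/\ irreducible (@gl_op _ _ _ (pi k)), homogeneous (d k) (w k),
    l k (w k) = 1, hw_vector (V := ev_Y (pi k)) (w k) (ev_weight (mu k))
  & forall S, invariant_subspace (@gl_op _ _ _ (pi k)) S -> S (w k) ->
      forall u, S u] := projT2 (cid (hw k)).
have [X [tau tauP]] := tensor_space_exists (fun k => pi k : lmodType R[i]).
have [tmap tmapE] := tensor_map_exists tauP.
pose W := tensor_rep tauP tmapE.
have w_hom k : homogeneous (d k) (w k) by case: (hl k).
have w_up k (a b : 'I_(M + N)) : (a < b)%N -> gl_E (pi k) a b (w k) = 0.
  by case: (hl k) => _ _ _ [h _] _; apply: (h 1%N).
have w_mu k a : gl_E (pi k) a a (w k) = mu k a *: w k.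
  by case: (hl k) => _ _ _ [_ h] _; apply: (h 1%N).
exists p, pi, W; split.
- by rewrite hp leqnn.
- move=> k; have [irr hom lw _ gen] := hl k; split => //.
  exists (w k), (d k), (mu k); split => //; last exact: w_up.
  by move=> w0; move: lw; rewrite w0 linear0 => /eqP; rewrite eq_sym oner_eq0.
- exact: (tensor_rep_spec hp tauP tmapE).
have lam_gt r a : (p < r)%N -> lam r a = 0.
  move=> pr; have := vhw.2 r a (leq_ltn_trans (leq0n p) pr).
  by rewrite W_trunc // => /esym/eqP; rewrite scaler_eq0 => /orP[/eqP //|/eqP].
apply: (@subquotient_of_hw _ _ _ _ V W v (tau w) e lam) => //.
- by apply: (tensor_neq0 (l := l)) => // k; case: (hl k).
- have := tensor_rep_parity tauP tmapE w_hom; congr homogeneous.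
  rewrite (bigD1 (Ordinal hp)) //= /d eqxx andbT big1 ?addbF // => k /negbTE->.
  by rewrite andbF.
split=> [r a b r0 ab|r a r0]; first exact: (tensor_rep_up tauP tmapE w_hom w_up).
have [rp|pr] := leqP r p; last by rewrite W_trunc // lam_gt // scale0r.
rewrite (tensor_rep_weight tauP tmapE w_hom w_up w_mu (c := c a)) ?r0 // => [|u].
  case: r r0 rp => // r _ _; by rewrite /c mulrA -signr_addb addbb mul1r.
rewrite -zE; apply: eq_bigr => k _.
by rewrite /mu mulrA -signr_addb addbb mul1r.
Qed.
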